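(* Let $q$ be a power of an odd prime $p$. Let $k$ be a positive even integer, let $d>2$ be a divisor of $k$ with $p\nmid d$, let $n$ be a positive integer divisible by $2k$, and let $a$ be the integer with $\phi(d)+2a=k$. Then the curve $$\mathcal{X}:\quad y^q-y=x\sum_{j=0}^{\frac{n}{2k}-1}\varphi_d(x)^{q^{a+kj}}$$ is minimal over $\mathbb{F}_{q^n}$.
   Context: $\phi$ is Euler's totient function. For $d$ not divisible by the characteristic $p$ of $\mathbb{F}_q$, $\Phi_d(x)=\prod_{1\le s\le d,\ \gcd(s,d)=1}(x-\xi^s)$, with $\xi$ a primitive $d$-th root of unity over $\mathbb{F}_q$, is the $d$-th cyclotomic polynomial over $\mathbb{F}_q$ (its coefficients lie in $\mathbb{F}_p$). Writing $\Phi_d(x)=\sum_{i=0}^{\phi(d)}a_ix^i$, define $\varphi_d(x)=\sum_{i=0}^{\phi(d)}a_ix^{q^i}$. A curve given by an affine equation $y^q-y=xS(x)$ means the smooth, projective, geometrically irreducible curve with that function field; it has exactly one point at infinity, which is rational, so its number of rational points over a finite field is one plus the number of affine solutions over that field. A curve of genus $g$ defined over $\mathbb{F}_{q^{N}}$ is called minimal over $\mathbb{F}_{q^{N}}$ if its number of $\mathbb{F}_{q^N}$-rational points equals $q^N+1-2g\sqrt{q^N}$. *)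

(* Defs.v *)
From HB Require Import structures.
From mathcomp Require Import all_boot all_order all_algebra all_field.
From mathcomp Require Import boolp classical_sets.
From mathcomp Require Import freeg.

Set Implicit Arguments.
Unset Strict Implicit.
Unset Printing Implicit Defensive.

Import Order.TTheory GRing.Theory Num.Theory.
Local Open Scope ring_scope.

(* A function field over F is presented as a finite extension L of F(x), where
   F(x) = {fraction {poly F}}; [xF] is x and [constF] is the embedding F -> L. *)

Definition ratpoly (F : fieldType) (f : {poly F}) : {fraction {poly F}} :=
  FracField.tofrac f.

Definition polyF (F : fieldType) (L : fieldExtType {fraction {poly F}})
  (f : {poly F}) : L := (ratpoly f)%:A.

Definition constF (F : fieldType) (L : fieldExtType {fraction {poly F}})
  (c : F) : L := polyF L c%:P.

Definition xF (F : fieldType) (L : fieldExtType {fraction {poly F}}) : L :=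
  polyF L 'X.

(* The points of the smooth projective model of L/F are the normalized discrete
   valuations of L that are trivial on F.  The value at 0 should be +oo; the
   convention [place_val0] only makes two places with the same values on
   nonzero elements equal, and the sets below never use it. *)

Record place (F : fieldType) (L : fieldExtType {fraction {poly F}}) := Place {
  place_val :> L -> int;
  place_val0 : place_val 0 = 0;
  place_valM : forall u v : L, u != 0 -> v != 0 ->
    place_val (u * v) = place_val u + place_val v;
  place_valD : forall u v : L, u != 0 -> v != 0 -> u + v != 0 ->
    Order.min (place_val u) (place_val v) <= place_val (u + v);
  place_valC : forall c : F, place_val (constF L c) = 0;
  place_val_norm : exists t : L, t != 0 /\ place_val t = 1
}.

HB.instance Definition _ (F : fieldType) (L : fieldExtType {fraction {poly F}})
  := gen_eqMixin (place L).
HB.instance Definition _ (F : fieldType) (L : fieldExtType {fraction {poly F}})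
  := gen_choiceMixin (place L).

(* For F-subspaces W and V of L with W contained in V: the F-dimension of V / W
   is d, i.e. some d vectors of V form a basis of V modulo W. *)

Definition has_quot_dim (F : fieldType) (L : fieldExtType {fraction {poly F}})
  (V W : set L) (d : nat) : Prop :=
  exists b : 'I_d -> L, (forall i, V (b i)) /\
    forall z, V z ->
      exists! c : 'rV[F]_d, W (z - \sum_(i < d) constF L (c 0 i) * b i).

(* The value 0 for an infinite-dimensional V / W is junk; it is not reached
   below, since residue fields and Riemann-Roch spaces are finite over F. *)
Definition quot_dim (F : fieldType) (L : fieldExtType {fraction {poly F}})
  (V W : set L) : nat :=
  xget 0%N [set d | has_quot_dim V W d]%classic.

Definition place_ring (F : fieldType) (L : fieldExtType {fraction {poly F}})
  (P : place L) : set L := [set z | z != 0 -> 0 <= P z]%classic.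

Definition place_ideal (F : fieldType) (L : fieldExtType {fraction {poly F}})
  (P : place L) : set L := [set z | z != 0 -> 0 < P z]%classic.

Definition place_deg (F : fieldType) (L : fieldExtType {fraction {poly F}})
  (P : place L) : nat := quot_dim (place_ring P) (place_ideal P).

Definition divisor (F : fieldType) (L : fieldExtType {fraction {poly F}}) :=
  {freeg (place L) / int}.

Definition div_deg (F : fieldType) (L : fieldExtType {fraction {poly F}})
  (D : divisor L) : int :=
  \sum_(P <- dom D) coeff P D * (place_deg P)%:Z.

Definition riemann_roch_space (F : fieldType)
  (L : fieldExtType {fraction {poly F}}) (D : divisor L) : set L :=
  [set z | z != 0 -> forall P : place L, 0 <= P z + coeff P D]%classic.

Definition div_dim (F : fieldType) (L : fieldExtType {fraction {poly F}})
  (D : divisor L) : nat := quot_dim (riemann_roch_space D) [set 0]%classic.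

(* g is the genus of L/F: the maximum of deg D - l(D) + 1 over all divisors. *)
Definition is_genus (F : fieldType) (L : fieldExtType {fraction {poly F}})
  (g : nat) : Prop :=
  (forall D : divisor L, div_deg D - (div_dim D)%:Z + 1 <= g%:Z) /\
  (exists D : divisor L, div_deg D - (div_dim D)%:Z + 1 = g%:Z).

(* L = F(x, y) is the function field of the curve y^q - y = f(x).
   The dimension condition says that y^q - y - f(x) is irreducible over F(x);
   the last condition, that F is algebraically closed in L, is geometric
   irreducibility of the curve when F is perfect (in particular finite). *)
Definition is_function_field (F : fieldType) (q : nat) (f : {poly F})
  (L : fieldExtType {fraction {poly F}}) (y : L) : Prop :=
  [/\ y ^+ q - y = polyF L f,
      <<1; y>>%VS = fullv,
      \dim {:L} = q &
      forall (z : L) (h : {poly F}), h != 0 ->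
        (map_poly (constF L) h).[z] = 0 -> exists c : F, z = constF L c].

(* The curve y^q - y = f(x) exists as a geometrically irreducible curve, and
   its genus is g; the function field is unique up to isomorphism. *)
Definition curve_has_genus (F : fieldType) (q : nat) (f : {poly F}) (g : nat)
  : Prop :=
  exists (L : fieldExtType {fraction {poly F}}) (y : L),
    is_function_field q f y /\ is_genus L g.

(* Valid when the model has exactly one point at infinity, which is rational
   (e.g. q a power of the characteristic p, and deg f prime to p). *)
Definition num_rational_points (F : finFieldType) (q : nat) (f : {poly F})
  : nat :=
  (#|[set xy : F * F | xy.2 ^+ q - xy.2 == f.[xy.1]]|).+1.

Definition minimal_curve (F : finFieldType) (q : nat) (f : {poly F}) : Prop :=
  exists g : nat, curve_has_genus q f g /\
    (num_rational_points q f)%:R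
      = #|F|%:R + 1 - 2 * g%:R * sqrtC #|F|%:R :> algC.

(* Phi has its coefficients in F, while the primitive d-th root of unity lives
   in some extension E of F.  For d > 1, [cyclotomic xi d] has the same factors
   whether exponents run over 0 <= s < d or 1 <= s <= d. *)
Definition is_cyclotomic (F : fieldType) (d : nat) (Phi : {poly F}) : Prop :=
  exists (E : fieldType) (iota : {rmorphism F -> E}) (xi : E),
    d.-primitive_root xi /\ map_poly iota Phi = cyclotomic xi d.

Definition q_associate (F : fieldType) (q : nat) (Phi : {poly F}) : {poly F} :=
  \sum_(i < size Phi) Phi`_i *: 'X^(q ^ i).

Definition curve_rhs (F : fieldType) (q k n a : nat) (Phi : {poly F})
  : {poly F} :=
  'X * \sum_(j < n %/ (2 * k)) q_associate q Phi ^+ (q ^ (a + k * j)).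

(* Main.v *)
(* Let s be the q-Frobenius of F, of order n, and Tr the trace to F_q: the curve
   has q points above x if Tr (f x) = 0, and none otherwise.  Write
   X^k - 1 = Phi G.  As Phi is reciprocal, 2 Tr (f x) = Q (v), where v = Phi(s)(T x),
   T is the trace from F to the field of q^k elements, and Q is the quadratic form
   defined on V = ker G(s), of dimension 2a over F_q, by the Bezoutian
   (G(X) - G(Z)) / (X - Z).  The map x |-> v is onto V.  The Gram determinant of Q
   is (-1)^a D^2 for a Moore determinant D of a basis of V, and s D = - D because
   G(0) = -1.  Hence Q is nondegenerate of elliptic type, and it has
   q^(2a-1) - (q-1) q^(a-1) zeros.

   The genus of y^q - y = f, with f monic of degree q c + 1, is c q (q - 1) / 2.
   There is one pole of x, and F[x, y] is the ring of functions regular elsewhere: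
   above every point of the affine curve there is a place, given by a power series
   solution for y.  Since x^i y^j, j < q, has pole order q i + (q c + 1) j, the
   dimension of L(q t infinity) is q t + 1 - g for t >= c q.  Every divisor is at
   most div h + q t infinity for some polynomial h in x and some t, a divisor of
   degree at most q t (because the sum of the e_i f_i at the zeros of h is at most
   q deg h) whose space is h^-1 L(q t infinity); removing a place from a divisor
   lowers the dimension by at most its degree, which gives deg D - l(D) + 1 <= g
   in general. *)

(* The sum defining f has only m terms, where n = 2km. As Phi is reciprocal of degree k - 2a, the
   forms Tr (x s^i Phi(s) x) for i = a + kj and for i = a + k(2m - 1 - j) coincide, so doubling
   completes the sum to all j < 2m, and the completed sum is a trace from F to the field of q^k
   elements. This is what the exponent a and the divisibility of n by 2k are for, and p odd permits
   the division by 2. The inequality phi(d) < d <= k gives a > 0, so that V is not zero. The type of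
   Q is read off without a diagonal basis: D^2 lies in F_q while D does not, so D^2 is a nonsquare
   of F_q. The genus is a maximum over all divisors, hence every place has to be controlled,
   including those with a residue field larger than F. *)
From HB Require Import structures.
Require Import Defs.
From mathcomp Require Import all_boot all_order all_algebra all_field.
From mathcomp Require Import boolp.
From mathcomp Require Import zify ring.

Set Implicit Arguments.
Unset Strict Implicit.
Unset Printing Implicit Defensive.

Import Order.TTheory GRing.Theory Num.Theory.
Local Open Scope ring_scope.

(** * Dimensions over a finite field *)

Section LinearAlgebra.
Variables (F : finFieldType) (L : comNzRingType) (iota : {rmorphism F -> L}).
Implicit Types V W : L -> Prop.

Definition lcomb (I : finType) (u : I -> L) (c : I -> F) : L :=
  \sum_i iota (c i) * u i.

Definition subsp W : Prop :=
  [/\ W 0, forall u v, W u -> W v -> W (u + v)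
    & forall c u, W u -> W (iota c * u)].

Definition indep (I : finType) (u : I -> L) W : Prop :=
  forall c : I -> F, W (lcomb u c) -> forall i, c i = 0.

Lemma lcombD (I : finType) (u : I -> L) c d :
  lcomb u c + lcomb u d = lcomb u (fun i => c i + d i).
Proof.
by rewrite -big_split; apply: eq_bigr => i _; rewrite rmorphD mulrDl.
Qed.

Lemma lcombZ (I : finType) (u : I -> L) a c :
  iota a * lcomb u c = lcomb u (fun i => a * c i).
Proof.
by rewrite mulr_sumr; apply: eq_bigr => i _; rewrite rmorphM mulrA.
Qed.

Lemma lcombB (I : finType) (u : I -> L) c d :
  lcomb u c - lcomb u d = lcomb u (fun i => c i - d i).
Proof.
rewrite -[- _]mulN1r -[X in X * _](rmorphN1 iota) lcombZ lcombD.
by apply: eq_bigr => i _; rewrite mulN1r.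
Qed.

Lemma subspN W u : subsp W -> W u -> W (- u).
Proof.
by case=> _ _ sZ Wu; rewrite -mulN1r -(rmorphN1 iota); apply: sZ.
Qed.

Lemma subspB W u v : subsp W -> W u -> W v -> W (u - v).
Proof. by move=> sW Wu Wv; case: (sW) => _ + _; apply=> //; apply: subspN. Qed.

Lemma subsp_sum W (I : Type) (r : seq I) (P : pred I) (u : I -> L) :
  subsp W -> (forall i, P i -> W (u i)) -> W (\sum_(i <- r | P i) u i).
Proof. by case=> W0 WD _ Wu; apply: (big_ind W) => //. Qed.

Lemma subsp_lcomb W (I : finType) (u : I -> L) c :
  subsp W -> (forall i, W (u i)) -> W (lcomb u c).
Proof.
by move=> sW Wu; apply: subsp_sum => // i _; case: sW => _ _; apply.
Qed.

Lemma subsp0 : subsp (fun z => z = 0).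
Proof.
by split=> //= [u v -> ->|c u ->]; rewrite ?addr0 ?mulr0.
Qed.

(* F being finite, dimensions can be compared by counting linear combinations. *)
Lemma indep_leq (I J : finType) (u : I -> L) (w : J -> L) W : subsp W ->
  indep u W -> (forall i, exists c, W (u i - lcomb w c)) -> (#|I| <= #|J|)%N.
Proof.
move=> sW iu /choice[M hM].
have hx (l : I -> F) : W (lcomb u l - lcomb w (fun j => \sum_i l i * M i j)).
  suff -> : lcomb u l - lcomb w (fun j => \sum_i l i * M i j)
      = \sum_i iota (l i) * (u i - lcomb w (M i)).
    by apply: subsp_sum => // i _; case: sW => _ _; apply.
  under [RHS]eq_bigr do rewrite mulrBr.
  rewrite sumrB; congr (_ - _).
  under [RHS]eq_bigr do rewrite lcombZ.
  rewrite /lcomb exchange_big; apply: eq_bigr => j _.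
  by rewrite rmorph_sum mulr_suml.
pose f (l : {ffun I -> F}) : {ffun J -> F} := [ffun j => \sum_i l i * M i j].
have fI : injective f.
  move=> l l' /ffunP eqf; apply/ffunP => i; apply/eqP; rewrite -subr_eq0.
  apply/eqP; apply: (iu (fun i => l i - l' i)); rewrite -lcombB.
  have := subspB sW (hx l) (hx l').
have -> : lcomb w (fun j => \sum_i l' i * M i j) = lcomb w (fun j => \sum_i l i * M i j).
  by apply: eq_bigr => j _; have := eqf j; rewrite !ffunE => ->.
by rewrite opprB addrA subrK.
have /leq_card := fI; rewrite !card_ffun leq_exp2l //.
exact: finNzRing_gt1.
Qed.

(** The notion [has_quot_dim], with uniqueness of coordinates replaced by independence modulo W,
    which suits counting arguments; [has_quot_dim_fdim] matches the two. *)
Definition fdim V W (d : nat) : Prop :=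
  exists b : 'I_d -> L, [/\ forall i, V (b i), indep b W
    & forall z, V z -> exists c, W (z - lcomb b c)].

Lemma fdim_uniq V W d d' : subsp W -> fdim V W d -> fdim V W d' -> d = d'.
Proof.
move=> sW [b [Vb ib sb]] [b' [Vb' ib' sb']].
apply/eqP; rewrite eqn_leq.
rewrite -[X in (X <= _)%N]card_ord -[X in (_ <= X)%N](card_ord d').
rewrite -[X in _ && (X <= _)%N](card_ord d') -[X in _ && (_ <= X)%N](card_ord d).
by rewrite (indep_leq sW ib (fun i => sb' _ (Vb i)))
  (indep_leq sW ib' (fun i => sb _ (Vb' i))).
Qed.

(** A maximal independent family exists thanks to the bound B, and it spans: a vector outside its
    span could be adjoined to it. *)
Lemma fdim_exists V W B : subsp V -> subsp W ->
  (forall m (u : 'I_m -> L), (forall i, V (u i)) -> indep u W -> (m <= B)%N) ->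
  exists2 d, (d <= B)%N & fdim V W d.
Proof.
move=> sV sW bnd.
pose Q m := `[< exists u : 'I_m -> L, (forall i, V (u i)) /\ indep u W >].
have Q0 : exists m, Q m.
  exists 0%N; apply/asboolP; exists (fun _ => 0).
  by split=> [i|c _ i]; case: i.
have QB m : Q m -> (m <= B)%N by move=> /asboolP[u [Vu iu]]; apply: bnd iu.
have [d /asboolP[b [Vb ib]] maxd] := ex_maxnP Q0 QB.
exists d; first exact: bnd ib.
exists b; split=> // z Vz; apply: contrapT => nz.
suff /maxd : Q d.+1 by rewrite ltnn.
apply/asboolP; exists (fun i => if unlift ord_max i is Some j then b j else z).
split=> [i|c]; first by case: unlift.
rewrite /lcomb big_ord_recr /= unlift_none.
under eq_bigr => i _.
  rewrite (_ : widen_ord _ i = lift ord_max i) ?liftK; last first.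
    by apply: ord_inj; rewrite lift_max.
  over.
move=> Wc.
have c0 : c ord_max = 0.
  apply: contrapT => /eqP cn0; apply: nz.
  exists (fun i => - ((c ord_max)^-1 * c (lift ord_max i))).
  case: sW => _ _ /(_ (c ord_max)^-1 _ Wc).
  rewrite mulrDr mulrA -rmorphM mulVf // rmorph1 mul1r addrC.
  suff -> : lcomb b (fun i => - ((c ord_max)^-1 * c (lift ord_max i))) =
    - (iota (c ord_max)^-1 * \sum_(i < d) iota (c (lift ord_max i)) * b i).
    by rewrite opprK.
  rewrite mulr_sumr -sumrN; apply: eq_bigr => i _.
  by rewrite rmorphN mulNr rmorphM mulrA.
move: Wc; rewrite c0 rmorph0 mul0r addr0 => /(ib (fun i => c (lift ord_max i))) ci.
by move=> i; case: (unliftP ord_max i) => [j|] ->.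
Qed.

Lemma fdim_ge V W d m (u : 'I_m -> L) : subsp W -> fdim V W d ->
  (forall i, V (u i)) -> indep u W -> (m <= d)%N.
Proof.
move=> sW [b [Vb ib sb]] Vu iu; rewrite -[m]card_ord -[d]card_ord.
exact: (indep_leq sW iu (fun i => sb _ (Vu i))).
Qed.

End LinearAlgebra.

(** * Quadratic forms over finite fields *)

Section Diagonalization.
Variables (K : fieldType) (two0 : (2%:R : K) != 0).

(** Polarization: if the quadratic form vanished everywhere, its value at e_i + e_j would give 2
    A_ij = 0. *)
Lemma anisotropic_row n (A : 'M[K]_n) : A^T = A -> A != 0 ->
  exists v : 'rV[K]_n, v *m A *m v^T != 0.
Proof.
move=> sA; apply: contra_neqP => /forallNP h; apply/matrixP => i j.
have Q (v : 'rV_n) : v *m A *m v^T = 0 by apply/eqP; have /negP := h v; rewrite negbK.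
have E k l : delta_mx (0 : 'I_1) k *m A *m (delta_mx (0 : 'I_1) l)^T = (A k l)%:M.
  by rewrite trmx_delta -rowE -colE; apply/matrixP => s t; rewrite !ord1 !mxE.
have := Q (delta_mx 0 i + delta_mx 0 j).
rewrite linearD /= !mulmxDr !mulmxDl !Q add0r addr0 !E.
have -> : A j i = A i j by rewrite -[in LHS]sA mxE.
move/matrixP/(_ 0 0); rewrite !mxE eqxx !mulr1n -mulr2n -mulr_natl.
by move/eqP; rewrite mulf_eq0 (negPf two0) => /eqP.
Qed.

Lemma diagonalization n (A : 'M[K]_n) : A^T = A ->
  exists2 P : 'M[K]_n, P \in unitmx & is_diag_mx (P *m A *m P^T).
Proof.
elim: n A => [|n IH] A sA.
  by exists 1%:M; rewrite ?unitmx1 //; apply/is_diag_mxP => -[].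
have [->|nzA] := eqVneq A 0.
  exists 1%:M; rewrite ?unitmx1 // mulmx0 mul0mx; apply/is_diag_mxP => i j _.
  by rewrite mxE.
have [v qv] := anisotropic_row sA nzA.
have vn0 : v != 0 by apply: contraNneq qv => ->; rewrite !mul0mx.
(* An invertible matrix whose first row is proportional to [v]: it completes the anisotropic vector
   to a basis. *)
pose P := row_ebase v; have uP : P \in unitmx by apply: row_ebase_unit.
pose w := row (0 : 'I_(1 + n)) P.
have [al Ev] : exists al, v = al *: w.
  exists (col_ebase v 0 0); rewrite -[in LHS](mulmx_ebase v) rank_rV vn0.
  apply/matrixP => i j; rewrite ord1 !mxE (bigD1 0) //= big1 ?addr0; last first.
    move=> k kn0; rewrite !mxE big_ord1 mxE /= andbC.
    by case: k kn0 => -[|k] hk //= _; rewrite mulr0 mul0r.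
  by rewrite !mxE big_ord1 !mxE eqxx mulr1.
have qw : (P *m A *m P^T) 0 0 != 0.
  apply: contraNneq qv => q0.
  rewrite Ev linearZ /= -!scalemxAl -scalemxAr scalerA.
  suff -> : w *m A *m w^T = 0 by rewrite scaler0.
  apply/matrixP => i j; rewrite !ord1 -row_mul tr_row -!row_mul [RHS]mxE -q0.
  rewrite !mxE; apply: eq_bigr => k _; rewrite !mxE; congr (_ * _).
pose A' : 'M_(1 + n) := P *m A *m P^T.
have sA' : A'^T = A' by rewrite /A' !trmx_mul trmxK sA mulmxA.
pose b := ursubmx A'; pose C := drsubmx A'.
have ulE (B : 'M_(1 + n)) : ulsubmx B = (B 0 0)%:M.
  apply/matrixP => i j; rewrite !ord1 !mxE eqxx mulr1n.
  by congr (B _ _); apply: val_inj.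
have EA : A' = block_mx (A' 0 0)%:M b b^T C.
  by rewrite -[LHS]submxK ulE trmx_ursub sA'.
pose al' := A' 0 0; have al0 : al' != 0 by [].
have sC : C^T = C by rewrite trmx_drsub sA'.
(* [T] makes the other basis vectors orthogonal to the first one; what remains is the Schur
   complement [C'], to which the induction applies. *)
pose T : 'M_(1 + n) := block_mx 1%:M 0 (- al'^-1 *: b^T) 1%:M.
have uT : T \in unitmx by rewrite unitmxE det_lblock !det1 mulr1 unitr1.
pose C' := C - al'^-1 *: (b^T *m b).
have ET : T *m A' *m T^T = block_mx al'%:M 0 0 C'.
  rewrite EA -/al' /T tr_block_mx !mulmx_block !trmx1 trmx0 !mul1mx !mul0mx.
  rewrite !mulmx1 !mulmx0 !addr0 linearZ /= trmxK.
  rewrite -!scalemxAl -!scalemxAr !mul_mx_scalar !mul_scalar_mx !scalerA.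
  rewrite mulNr mulVf // !scaleN1r !addNr mul0mx scaler0 add0r scaleNr.
  by rewrite [- _ + _]addrC.
have sC' : C'^T = C'.
  by rewrite /C' linearB linearZ /= trmx_mul trmxK sC.
have [Q uQ dQ] := IH C' sC'.
pose R : 'M_(1 + n) := block_mx 1%:M 0 0 Q.
exists (R *m T *m P).
  have uR : R \in unitmx by rewrite unitmxE det_lblock det1 mul1r -unitmxE.
  by rewrite !unitmx_mul uT uP uR.
have -> : R *m T *m P *m A *m (R *m T *m P)^T = R *m (T *m A' *m T^T) *m R^T.
  by rewrite /A' !trmx_mul !mulmxA.
rewrite ET /R tr_block_mx !mulmx_block !trmx0 trmx1 !mul1mx !mul0mx !mulmx0.
rewrite !mulmx1 !addr0 !add0r.
rewrite mul0mx; apply: (etrans (@is_diag_block_mx K 1 n 1 n _ _ _ _ erefl)).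
by rewrite !eqxx dQ scalar_mx_is_diag.
Qed.

End Diagonalization.

Section BinaryForms.
Variables (K : finFieldType) (two0 : (2%:R : K) != 0) (odd_card : odd #|K|).
Let q := #|K|.

Definition is_square (u : K) : bool := [exists s, s ^+ 2 == u].

Lemma card_le_squares : (q <= (#|[set x ^+ 2 | x : K]|).*2)%N.
Proof.
rewrite /q -[X in (X <= _)%N]sum1_card (partition_big_imset (fun x : K => x ^+ 2)) /=.
apply: (@leq_trans (\sum_(u in [set x ^+ 2 | x : K]) 2)%N); last first.
  by rewrite sum_nat_const muln2.
apply: leq_sum => u /imsetP[s _ ->].
rewrite sum1_card (leq_trans _ (_ : #|[set s; - s]| <= 2)%N) //; last first.
  by rewrite cards2; case: (_ != _).
apply: subset_leq_card; apply/subsetP => x; rewrite !inE -eqf_sqr.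
by [].
Qed.

(** Pigeonhole: the sets of squares and of c + u y^2 both have more than q / 2 elements, q being
    odd, so they meet. *)
Lemma nonsquare_form_represents u c : u != 0 ->
  exists z : K * K, z.1 ^+ 2 - u * z.2 ^+ 2 = c.
Proof.
move=> u0; pose A := [set x ^+ 2 | x : K]; pose B := [set c + u * x | x in A].
have cB : #|B| = #|A|.
  by rewrite card_imset // => x y /addrI /(mulfI u0).
have : ~~ [disjoint A & B].
  apply/negP; rewrite -setI_eq0 => /eqP dAB.
  have := max_card (mem (A :|: B)); rewrite cardsU dAB cards0 subn0 cB addnn.
  move=> le; have := card_le_squares; rewrite -/A => ge.
  have /eqP E : #|K| == #|A|.*2 by rewrite eqn_leq ge le.
  by have := odd_card; rewrite E odd_double.
case/pred0Pn => w /andP[/imsetP[x _ wx] /imsetP[_ /imsetP[y _ ->] wy]].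
by exists (x, y) => /=; rewrite -wx wy addrK.
Qed.

(** The form factors as (x - s y)(x + s y), and both factors are free coordinates because 2 s is
    invertible; this leaves the solutions of x y = c. *)
Lemma count_hyperbolic (s c : K) : s != 0 ->
  (\sum_(z : K * K) (z.1 ^+ 2 - s ^+ 2 * z.2 ^+ 2 == c)%R = (c == 0%R) * q + q.-1)%N.
Proof.
move=> s0.
have two_s : 2%:R * s != 0 by rewrite mulf_neq0.
transitivity (\sum_(z : K * K) (z.1 * z.2 == c)%R)%N.
  pose f (z : K * K) := (z.1 - s * z.2, z.1 + s * z.2).
  have fI : injective f.
    move=> [x y] [x' y'] [e1 e2].
    have ey : y = y'.
      apply: (mulfI two_s); rewrite (_ : 2 * s * y = (x + s * y) - (x - s * y)).
        by rewrite e1 e2; ring.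
      by ring.
    by move: e1; rewrite ey => /addIr ->.
  rewrite [RHS](reindex_inj fI); apply: eq_bigr => z _ /=.
  by congr (nat_of_bool (_ == c)); ring.
rewrite -(pair_bigA _ (fun x y => (x * y == c) : nat)) /= (bigD1 0) //=.
congr addn.
  under eq_bigr do rewrite mul0r eq_sym.
  by rewrite sum_nat_const mulnC.
rewrite (eq_bigr (fun=> 1%N)) => [|x x0].
  by rewrite sum1_card -(cardC1 (0 : K)); apply: eq_card => x; rewrite !inE.
rewrite (bigD1 (x^-1 * c)) //= mulrA mulfV // mul1r eqxx big1 // => y.
by apply: contraNeq; rewrite eqb0 negbK => /eqP <-; rewrite mulrA mulVf // mul1r.
Qed.

(** The form is the norm of the quadratic extension by a square root of u. It vanishes only at the
    origin, and by multiplicativity it takes all nonzero values equally often, so q^2 = 1 + (q - 1)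
    M 1. *)
Lemma count_elliptic (u c : K) : ~~ is_square u ->
  (\sum_(z : K * K) (z.1 ^+ 2 - u * z.2 ^+ 2 == c)%R =
    if c == 0%R then 1 else q.+1)%N.
Proof.
move=> nu.
have u0 : u != 0.
  by apply: contra nu => /eqP ->; apply/existsP; exists 0; rewrite expr0n.
pose N (z : K * K) := z.1 ^+ 2 - u * z.2 ^+ 2.
pose M c := (\sum_(z : K * K) (N z == c))%N.
rewrite -/(M c).
have M0 : M 0 = 1%N.
  rewrite /M (bigD1 (0, 0)) //= {1}/N /= expr0n mulr0 subrr eqxx big1 // => -[x y].
  apply: contraNeq; rewrite eqb0 negbK /N subr_eq0 /= => /eqP E.
  have [y0|yn0] := eqVneq y 0.
    by move: E; rewrite y0 expr0n mulr0 => /eqP; rewrite expf_eq0 => /eqP ->.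
  case/negP: nu; apply/existsP; exists (x / y).
  by rewrite expr_div_n E mulfK // expf_neq0.
have M1 d : d != 0 -> M d = M 1.
  move=> d0; have [[a b] /= Eab] := nonsquare_form_represents d u0.
  (* Multiplication by a + b sqrt u, an element of norm d. *)
  pose f (z : K * K) := (a * z.1 + u * b * z.2, b * z.1 + a * z.2).
  have Nf z : N (f z) = d * N z by rewrite /N /f -Eab /=; ring.
  have fI : injective f.
    apply: (can_inj (g := fun w : K * K =>
      ((a * w.1 - u * b * w.2) / d, (a * w.2 - b * w.1) / d))).
    move=> [x y]; rewrite /f /=; congr pair; apply: (mulIf d0).
      by rewrite divfK // -Eab; ring.
    by rewrite divfK // -Eab; ring.
  rewrite /M (reindex_inj fI); apply: eq_bigr => z _.
  by rewrite Nf -[X in _ == X](mulr1 d) (inj_eq (mulfI d0)).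
have S : (\sum_c M c = q * q)%N.
  rewrite exchange_big /= (eq_bigr (fun=> 1%N)) ?sum1_card ?card_prod // => z _.
  rewrite (bigD1 (N z)) //= eqxx big1 // => d.
  by rewrite eq_sym => /negPf ->.
have q1 : (1 < q)%N by apply: finNzRing_gt1.
have M1E : M 1 = q.+1.
  move: S; rewrite (bigD1 0) //= M0 (eq_bigr (fun=> M 1)) => [|d /M1 //].
  rewrite sum_nat_const (_ : #|_| = q.-1); last first.
    by rewrite -(cardC1 (0 : K)); apply: eq_card => x; rewrite !inE.
  by case: (q) q1 => // -[|m] // _ /=; nia.
by have [->|/M1 ->] := eqVneq c 0; rewrite ?M0.
Qed.

(** The quadratic character on nonzero elements; at 0 its value is 1, not 0. *)
Definition sqsign (u : K) : int := if is_square u then 1 else -1.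

(** After multiplication by a the form becomes (a x)^2 - (- a b) y^2, hyperbolic or elliptic
    according to whether - a b is a square. *)
Lemma count_binary (a b c : K) : a != 0 -> b != 0 ->
  (\sum_(z : K * K) (a * z.1 ^+ 2 + b * z.2 ^+ 2 == c)%R)%N%:Z
    = q%:Z + sqsign (- (a * b)) * ((c == 0)%:Z * q%:Z - 1).
Proof.
move=> a0 b0.
have -> : (\sum_(z : K * K) (a * z.1 ^+ 2 + b * z.2 ^+ 2 == c)%R =
    \sum_(z : K * K) (z.1 ^+ 2 - (- (a * b)) * z.2 ^+ 2 == a * c)%R)%N.
  pose f (z : K * K) := (a * z.1, z.2).
  have fI : injective f by move=> [x y] [x' y'] [/(mulfI a0) -> ->].
  rewrite [RHS](reindex_inj fI); apply: eq_bigr => z _.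
  rewrite -(inj_eq (mulfI a0)); congr (nat_of_bool (_ == _)).
  by rewrite /f /=; ring.
have q1 : (1 < q)%N by apply: finNzRing_gt1.
rewrite /sqsign; case: ifPn => [/existsP[s /eqP Es]|nsq].
  have s0 : s != 0.
    by apply: contra_eq_neq Es => ->; rewrite expr0n /= eq_sym oppr_eq0 mulf_neq0.
  rewrite -Es count_hyperbolic // mulf_eq0 (negPf a0) /=.
  by case: (c == 0); lia.
rewrite count_elliptic // mulf_eq0 (negPf a0) /=.
by case: (c == 0); lia.
Qed.

End BinaryForms.

Section EvenForms.
Variables (K : finFieldType) (two0 : (2%:R : K) != 0) (odd_card : odd #|K|).
Local Notation q := #|K|.

Lemma is_squareM (u v : K) : u != 0 -> is_square u -> is_square (u * v) = is_square v.
Proof.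
move=> u0 /existsP[s /eqP su].
have s0 : s != 0 by apply: contra_eq_neq su => ->; rewrite expr0n /= eq_sym.
apply/existsP/existsP => -[t /eqP tE].
  by exists (t / s); rewrite expr_div_n su tE mulrAC divff // mul1r.
by exists (s * t); rewrite exprMn su tE.
Qed.

(** The squares and u times the squares meet only in 0, and each set has at least (q + 1) / 2
    elements, so together they exhaust K; the nonsquare v is therefore u times a square. *)
Lemma nonsquareM (u v : K) : ~~ is_square u -> ~~ is_square v -> is_square (u * v).
Proof.
move=> nu nv; have u0 : u != 0.
  by apply: contra nu => /eqP ->; apply/existsP; exists 0; rewrite expr0n.
pose A := [set x ^+ 2 | x : K]; pose B := [set u * x | x in A].
have cB : #|B| = #|A| by rewrite card_imset //; apply: mulfI.
have AB : A :&: B \subset [set 0].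
  apply/subsetP => w; rewrite !inE => /andP[/imsetP[x _ ->]].
  case/imsetP => _ /imsetP[y _ ->] E; apply: contraNT nu => x0.
  have y0 : y != 0.
    by apply: contraNneq x0 => y0; rewrite E y0 expr0n mulr0.
  by apply/existsP; exists (x / y); rewrite expr_div_n E mulfK // expf_neq0.
have : v \in A :|: B.
  suff -> : A :|: B = setT by rewrite inE.
  apply/eqP; rewrite eqEcard subsetT cardsT cardsU cB addnn /=.
  have ar m s i : odd m -> (m <= s.*2)%N -> (i <= 1)%N -> (m <= s.*2 - i)%N.
    move=> om ms i1; have : m != s.*2 by apply: contraTneq om => ->; rewrite odd_double.
    by lia.
  by apply: ar; rewrite ?card_le_squares // (leq_trans (subset_leq_card AB)) ?cards1.
rewrite inE => /orP[/imsetP[x _ vE]|/imsetP[_ /imsetP[y _ ->] ->]].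
  by case/negP: nv; apply/existsP; exists x; rewrite vE.
by apply/existsP; exists (u * y); rewrite exprMn expr2 mulrA.
Qed.

Lemma sqsignM (u v : K) : u != 0 -> v != 0 -> sqsign (u * v) = sqsign u * sqsign v.
Proof.
move=> u0 v0; rewrite /sqsign.
have [su|nu] := boolP (is_square u); first by rewrite is_squareM // mul1r.
have [sv|nv] := boolP (is_square v); last by rewrite nonsquareM.
by rewrite mulrC is_squareM // (negPf nu).
Qed.

Fixpoint count_diag (d : seq K) (c : K) : int :=
  if d is b :: s then \sum_x count_diag s (c - b * x ^+ 2) else (c == 0)%:Z.

(** Variables are peeled off in pairs by [count_binary], each pair contributing the character of -
    b1 b2. The count is multiplied by q so that the formula also holds for the empty form, where the
    induction starts. *)
Lemma count_diag_even (a : nat) (d : seq K) (c : K) :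
  size d = (2 * a)%N -> all (fun b => b != 0) d ->
  q%:Z * count_diag d c = q%:Z ^+ (2 * a)
    + sqsign ((-1) ^+ a * \prod_(b <- d) b) * q%:Z ^+ a * ((c == 0)%:Z * q%:Z - 1).
Proof.
elim: a d c => [|a IH] d c.
  move/eqP; rewrite muln0 size_eq0 => /eqP -> _ /=.
  rewrite big_nil mulr1 /sqsign ifT ?mul1r; last first.
    by apply/existsP; exists 1; rewrite expr1n.
  by rewrite addrC subrK mulrC.
case: d => [|b1 [|b2 s]] //; first by case: a {IH}.
rewrite mulnS addnC addn2 => -[sz] /= /and3P[n1 n2 ns].
have := count_binary two0 odd_card c n1 n2.
set Nb := (\sum_z _)%N => EN.
pose e := sqsign ((-1) ^+ a * \prod_(b <- s) b).
have -> : q%:Z * (\sum_x \sum_y count_diag s (c - b1 * x ^+ 2 - b2 * y ^+ 2))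
   = \sum_(z : K * K) (q%:Z ^+ (2 * a) - e * q%:Z ^+ a +
       e * q%:Z ^+ a * q%:Z * (b1 * z.1 ^+ 2 + b2 * z.2 ^+ 2 == c)%:Z).
  rewrite pair_bigA mulr_sumr; apply: eq_bigr => z _ /=.
  rewrite IH // -/e (_ : (c - _ - _ == 0) = (b1 * z.1 ^+ 2 + b2 * z.2 ^+ 2 == c)).
    by ring.
  by rewrite -addrA -opprD subr_eq0 eq_sym.
rewrite big_split /= -mulr_sumr sumr_const card_prod.
have -> : \sum_(z : K * K) (b1 * z.1 ^+ 2 + b2 * z.2 ^+ 2 == c)%:Z = Nb%:Z.
  by rewrite /Nb (big_morph Posz PoszD (erefl _)).
rewrite EN !big_cons.
have -> : (-1) ^+ a.+1 * (b1 * (b2 * \prod_(b <- s) b)) =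
  (- (b1 * b2)) * ((-1) ^+ a * \prod_(b <- s) b) by rewrite exprS; ring.
have p0 : \prod_(b <- s) b != 0 by rewrite prodf_seq_neq0.
rewrite sqsignM -/e ?oppr_eq0 ?mulf_neq0 // ?signr_eq0 //.
rewrite -mulr_natr natrM !natz !exprS; ring.
Qed.

Lemma count_diagE n (d : 'rV[K]_n) (c : K) :
  (\sum_(x : 'rV[K]_n) (\sum_i d 0 i * x 0 i ^+ 2 == c)%R)%N%:Z
   = count_diag [seq d 0 i | i <- enum 'I_n] c.
Proof.
elim: n d c => [|n IH] d c.
  rewrite (eq_bigr (fun=> (c == 0%R) : nat)) => [|x _]; last first.
    by rewrite big_ord0 eq_sym.
  by rewrite sum_nat_const card_mx muln0 expn0 mul1n (size0nil (size_enum_ord 0)).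
rewrite enum_ordSl /= -map_comp.
pose f (z : K * 'rV[K]_n) : 'rV[K]_(1 + n) := row_mx z.1%:M z.2.
have fB : bijective f.
  exists (fun x : 'rV[K]_(1 + n) => (x 0 0, rsubmx x)) => [[u y]|x]; rewrite /f /=.
    rewrite row_mxKr; congr pair.
    by rewrite mxE; case: splitP => [j _|//]; rewrite ord1 mxE eqxx mulr1n.
  rewrite -[RHS]hsubmxK; congr row_mx; apply/matrixP => i j.
  by rewrite !ord1 !mxE eqxx mulr1n; congr (x _ _); apply: val_inj.
rewrite (reindex f) /=; last exact: onW_bij.
rewrite -(pair_bigA _ (fun u y => (\sum_i d 0 i * f (u, y) 0 i ^+ 2 == c)%R : nat)) /=.
rewrite (big_morph Posz PoszD (erefl _)); apply: eq_bigr => u _.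
have -> : [seq ((fun i => d 0 i) \o lift ord0) i | i <- enum 'I_n]
    = [seq rsubmx (d : 'rV_(1 + n)) 0 i | i <- enum 'I_n].
  by apply: eq_map => i /=; rewrite mxE; congr (d _ _); apply: val_inj.
rewrite -IH; congr Posz; apply: eq_bigr => y _; congr nat_of_bool.
rewrite big_ord_recl -[in RHS](inj_eq (addrI (d 0 0 * u ^+ 2))).
rewrite [in RHS]addrCA subrr addr0; congr (_ == _); congr (_ + _).
  congr (_ * _ ^+ 2); rewrite mxE; case: splitP => [j _|//].
  by rewrite ord1 mxE eqxx mulr1n.
apply: eq_bigr => i _; rewrite (_ : lift ord0 i = rshift 1 i); last exact: val_inj.
by rewrite /f row_mxEr mxE.
Qed.

(** Diagonalizing by P multiplies the determinant by the square of det P, so the character of the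
    discriminant stays -1. *)
Lemma count_quadratic_even a (A : 'M[K]_(2 * a)) : (0 < a)%N -> A^T = A ->
  \det A != 0 -> ~~ is_square ((-1) ^+ a * \det A) ->
  ((\sum_(x : 'rV[K]_(2 * a)) ((x *m A *m x^T) 0 0 == 0)%R) + (q - 1) * q ^ a.-1
     = q ^ (2 * a).-1)%N.
Proof.
move=> a0 sA dA nsA.
have [P uP /diag_mxP [d Ed]] := diagonalization two0 sA.
have E : (\sum_(x : 'rV[K]_(2 * a)) ((x *m A *m x^T) 0 0 == 0)%R)%N
    = (\sum_(x : 'rV[K]_(2 * a)) (\sum_i d 0 i * x 0 i ^+ 2 == 0)%R)%N.
  rewrite (reindex_inj (can_inj (mulmxK uP))); apply: eq_bigr => x _.
  have -> : x *m P *m A *m (x *m P)^T = x *m (P *m A *m P^T) *m x^T.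
    by rewrite trmx_mul !mulmxA.
  rewrite Ed.
  congr (nat_of_bool (_ == _)); rewrite mxE; apply: eq_bigr => i _.
  by rewrite mul_mx_diag !mxE; ring.
have detE : \det A * (\det P) ^+ 2 = \prod_i d 0 i.
  by rewrite -det_diag -Ed !det_mulmx det_tr; ring.
have dP : \det P != 0 by rewrite -unitfE -unitmxE.
have pd : \prod_i d 0 i != 0 by rewrite -detE mulf_neq0 ?expf_neq0.
have := @count_diag_even a [seq d 0 i | i <- enum 'I_(2 * a)] 0.
rewrite size_map size_enum_ord big_map big_enum /= => /(_ erefl).
have -> : all (fun b => b != 0) [seq d 0 i | i <- enum 'I_(2 * a)].
  apply/allP => _ /mapP[i _ ->]; apply: contraNneq pd => di.
  by rewrite (bigD1 i) //= di mul0r.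
move=> /(_ isT); rewrite -count_diagE -E eqxx mul1r -detE.
have -> : sqsign ((-1) ^+ a * (\det A * \det P ^+ 2)) = -1.
  rewrite mulrA mulrC /sqsign is_squareM ?expf_neq0 //.
    by rewrite (negPf nsA).
  by apply/existsP; exists (\det P).
set N := (\sum_x _)%N => EN; apply/eqP; rewrite -(eqr_nat int) natrD.
have q0 : q%:Z != 0 by have := finNzRing_gt1 K; lia.
apply/eqP/(mulfI q0); rewrite mulrDr [N%:R]natz EN.
rewrite natrM !natrX natrB ?(ltnW (finNzRing_gt1 K)) //.
case: a a0 {A sA dA nsA P uP d Ed E detE dP pd N EN} => // a _.
have -> : (2 * a.+1 = (a + a).+2)%N by rewrite mul2n -addnn addSn addnS.
by rewrite !natz !succnK !exprS exprD; ring.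
Qed.

End EvenForms.

(** * Polynomials in the Frobenius automorphism *)

Section IteratedMorphism.
Variables (R : nzRingType) (s : {rmorphism R -> R}).

Lemma iter_mul i x y : iter i s (x * y) = iter i s x * iter i s y.
Proof. by elim: i => //= i ->; rewrite rmorphM. Qed.

Lemma iter_sub i x y : iter i s (x - y) = iter i s x - iter i s y.
Proof. by elim: i => //= i ->; rewrite rmorphB. Qed.

Lemma iter_zero i : iter i s 0 = 0.
Proof. by elim: i => //= i ->; rewrite rmorph0. Qed.

Lemma iter_add i x y : iter i s (x + y) = iter i s x + iter i s y.
Proof. by elim: i => //= i ->; rewrite rmorphD. Qed.

Lemma iter_sum i (I : Type) (r : seq I) (P : pred I) (E : I -> R) :
  iter i s (\sum_(j <- r | P j) E j) = \sum_(j <- r | P j) iter i s (E j).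
Proof. exact: (big_morph _ (iter_add i) (iter_zero i)). Qed.

Lemma iter_fixed i x : s x = x -> iter i s x = x.
Proof. by move=> sx; elim: i => //= i ->. Qed.

Lemma iterMfixed N t x : iter N s x = x -> iter (N * t) s x = x.
Proof. by move=> sx; elim: t => [|t IH]; rewrite ?muln0 // mulnS iterD IH. Qed.

End IteratedMorphism.

Section SkewAction.
Variables (K F : fieldType) (iota : {rmorphism K -> F}).
Implicit Types (P Q G H : {poly K}) (c : K) (u v w x y z : F).

Definition act (s : F -> F) (P : {poly K}) (v : F) : F :=
  \sum_(i < size P) iota P`_i * iter i s v.

Section One.
Variable s : {rmorphism F -> F}.
Hypothesis sK : forall c, s (iota c) = iota c.

Lemma actE N P v : (size P <= N)%N ->
  act s P v = \sum_(i < N) iota P`_i * iter i s v.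
Proof.
move=> le; rewrite /act (big_ord_widen N (fun i => iota P`_i * iter i s v) le) big_mkcond.
apply: eq_bigr => i _; case: ltnP => // lei.
by rewrite nth_default // rmorph0 mul0r.
Qed.

Lemma actDl P Q v : act s (P + Q) v = act s P v + act s Q v.
Proof.
pose N := maxn (size P) (size Q).
rewrite !(@actE N) ?leq_maxl ?leq_maxr ?size_polyD // -big_split.
by apply: eq_bigr => i _; rewrite coefD rmorphD mulrDl.
Qed.

Lemma actCl c P v : act s (c%:P * P) v = iota c * act s P v.
Proof.
have le : (size (c%:P * P)%R <= size P)%N by rewrite mul_polyC; apply: size_scale_leq.
rewrite (actE _ le) mulr_sumr.
by apply: eq_bigr => i _; rewrite coefCM rmorphM mulrA.
Qed.

Lemma actB P u v : act s P (u - v) = act s P u - act s P v.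
Proof.
by rewrite /act -sumrB; apply: eq_bigr => i _; rewrite iter_sub mulrBr.
Qed.

Lemma act0 P : act s P 0 = 0.
Proof. by rewrite -[X in act s P X](subrr 0) actB subrr. Qed.

Lemma actN P u : act s P (- u) = - act s P u.
Proof. by rewrite -sub0r actB act0 sub0r. Qed.

Lemma actD P u v : act s P (u + v) = act s P u + act s P v.
Proof. by rewrite -[v]opprK actB actN !opprK. Qed.

Lemma act_sum P (I : Type) (r : seq I) (Q : pred I) (E : I -> F) :
  act s P (\sum_(j <- r | Q j) E j) = \sum_(j <- r | Q j) act s P (E j).
Proof. exact: (big_morph _ (actD P) (act0 P)). Qed.

Lemma actZ P c v : act s P (iota c * v) = iota c * act s P v.
Proof.
rewrite /act mulr_sumr; apply: eq_bigr => i _.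
by rewrite iter_mul (iter_fixed i (sK c)) mulrCA.
Qed.

Lemma act_iter P i v : act s P (iter i s v) = iter i s (act s P v).
Proof.
rewrite /act iter_sum; apply: eq_bigr => j _.
by rewrite iter_mul (iter_fixed i (sK _)) -!iterD addnC.
Qed.

Lemma act_cons P c v : act s (P * 'X + c%:P) v = act s P (s v) + iota c * v.
Proof.
rewrite (@actE (size P).+1); last first.
  rewrite (leq_trans (size_polyD _ _)) // geq_max size_polyC.
  rewrite (leq_trans (leq_b1 _)) // andbT (leq_trans (size_polyMleq _ _)) //.
  by rewrite size_polyX addn2.
rewrite big_ord_recl coefD coefMX coefC /= add0r addrC; congr (_ + _).
apply: eq_bigr => i _.
by rewrite /bump leq0n add1n coefD coefMX coefC /= addr0 -iterS iterSr.
Qed.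

Lemma actM P Q v : act s (P * Q) v = act s P (act s Q v).
Proof.
elim/poly_ind: P v => [|P c IH] v; first by rewrite mul0r /act size_poly0 !big_ord0.
rewrite act_cons mulrDl actDl actCl; congr (_ + _).
rewrite mulrAC -[X in act s X](addr0) -[0]polyC0 act_cons rmorph0 mul0r addr0 IH.
by have /= -> := act_iter Q 1 v.
Qed.

Lemma actXn k v : act s 'X^k v = iter k s v.
Proof.
rewrite (@actE k.+1) ?size_polyXn // big_ord_recr /= coefXn eqxx rmorph1 mul1r.
by rewrite big1 ?add0r // => i _; rewrite coefXn ltn_eqF // rmorph0 mul0r.
Qed.

Lemma act1 v : act s 1 v = v.
Proof. by rewrite -(expr0 'X) actXn. Qed.

Lemma act_Xn_sub1 k v : act s ('X^k - 1) v = iter k s v - v.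
Proof.
by rewrite actDl actXn -[- 1]mulr1 -[-1]polyCN actCl rmorphN rmorph1 act1 mulN1r.
Qed.

End One.

Variables s r : {rmorphism F -> F}.
Hypotheses (sK : forall c, s (iota c) = iota c) (rK : forall c, r (iota c) = iota c).
Hypotheses (srK : cancel s r) (rsK : cancel r s).

Lemma iter_sr i : cancel (iter i s) (iter i r).
Proof. by elim: i => // i IH x; rewrite (iterSr i r) /= srK IH. Qed.

Lemma iter_rs i : cancel (iter i r) (iter i s).
Proof. by elim: i => // i IH x; rewrite (iterSr i s) /= rsK IH. Qed.

Lemma iter_comm i j v : iter j r (iter i s v) = iter i s (iter j r v).
Proof.
elim: i => //= i <-; elim: j => //= j ->.
by rewrite srK rsK.
Qed.

Lemma act_comm P i v : act r P (iter i s v) = iter i s (act r P v).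
Proof.
rewrite /act iter_sum; apply: eq_bigr => j _.
rewrite iter_mul (iter_fixed i (sK _)); congr (_ * _).
exact: iter_comm.
Qed.

(* The action of (H(X) - H(Z)) / (X - Z) on u (x) w, with X acting on u by s
   and Z acting on w by r = s^-1. *)
Definition bez (H : {poly K}) (u w : F) : F :=
  \sum_(i < size H) iota H`_i * \sum_(j < i) iter j s u * iter (i.-1 - j) r w.

Lemma bezE N H u w : (size H <= N)%N -> bez H u w =
  \sum_(i < N) iota H`_i * \sum_(j < i) iter j s u * iter (i.-1 - j) r w.
Proof.
move=> le; rewrite /bez (big_ord_widen N
  (fun i => iota H`_i * \sum_(j < i) iter j s u * iter (i.-1 - j) r w) le) big_mkcond.
apply: eq_bigr => i _; case: ltnP => // lei.
by rewrite nth_default // rmorph0 mul0r.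
Qed.

Lemma bezDl P Q u w : bez (P + Q) u w = bez P u w + bez Q u w.
Proof.
pose N := maxn (size P) (size Q).
rewrite !(@bezE N) ?leq_maxl ?leq_maxr ?size_polyD // -big_split.
by apply: eq_bigr => i _; rewrite coefD rmorphD mulrDl.
Qed.

Lemma bezCl c P u w : bez (c%:P * P) u w = iota c * bez P u w.
Proof.
have le : (size (c%:P * P)%R <= size P)%N by rewrite mul_polyC; apply: size_scale_leq.
rewrite (bezE _ _ le) mulr_sumr.
by apply: eq_bigr => i _; rewrite coefCM rmorphM mulrA.
Qed.

Lemma bezD H u u' w : bez H (u + u') w = bez H u w + bez H u' w.
Proof.
rewrite /bez -big_split; apply: eq_bigr => i _ /=; rewrite -mulrDr -big_split.
by congr (_ * _); apply: eq_bigr => j _; rewrite iter_add mulrDl.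
Qed.

Lemma bezZ H c u w : bez H (iota c * u) w = iota c * bez H u w.
Proof.
rewrite /bez mulr_sumr; apply: eq_bigr => i _; rewrite mulrCA; congr (_ * _).
rewrite mulr_sumr; apply: eq_bigr => j _.
by rewrite iter_mul (iter_fixed j (sK c)) mulrA.
Qed.

Lemma bezDr H u w w' : bez H u (w + w') = bez H u w + bez H u w'.
Proof.
rewrite /bez -big_split; apply: eq_bigr => i _ /=; rewrite -mulrDr -big_split.
by congr (_ * _); apply: eq_bigr => j _; rewrite iter_add mulrDr.
Qed.

Lemma bezZr H c u w : bez H u (iota c * w) = iota c * bez H u w.
Proof.
rewrite /bez mulr_sumr; apply: eq_bigr => i _; rewrite mulrCA; congr (_ * _).
rewrite mulr_sumr; apply: eq_bigr => j _.
by rewrite iter_mul (iter_fixed _ (rK c)) mulrCA.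
Qed.

(** The constant c cancels, and (X H(X) - Z H(Z)) / (X - Z) is X times the Bezoutian of H plus
    H(Z). *)
Lemma bez_cons H c u w : bez (H * 'X + c%:P) u w = bez H (s u) w + u * act r H w.
Proof.
rewrite (@bezE (size H).+1); last first.
  rewrite (leq_trans (size_polyD _ _)) // geq_max size_polyC.
  rewrite (leq_trans (leq_b1 _)) // andbT (leq_trans (size_polyMleq _ _)) //.
  by rewrite size_polyX addn2.
rewrite big_ord_recl big_ord0 mulr0 add0r [RHS]addrC mulr_sumr /bez -big_split.
apply: eq_bigr => i _; rewrite lift0 coefD coefMX coefC /= addr0.
rewrite big_ord_recl subn0 mulrDr mulrCA; congr (_ + _ * _).
apply: eq_bigr => j _; rewrite lift0 iterSr.
by congr (_ * iter _ r w); lia.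
Qed.

(** P(X) G(X) - P(Z) G(Z) = P(X) (G(X) - G(Z)) + (P(X) - P(Z)) G(Z), and G(Z) kills w. *)
Lemma bezM P G u w : act r G w = 0 -> bez (P * G) u w = bez G (act s P u) w.
Proof.
move=> Gw; elim/poly_ind: P u => [|P c IH] u.
  rewrite mul0r /act size_poly0 big_ord0 /bez size_poly0 big_ord0.
  rewrite big1 // => i _; rewrite big1 ?mulr0 // => j _.
  by rewrite iter_zero mul0r.
rewrite act_cons // mulrDl bezDl bezCl bezD bezZ; congr (_ + _).
rewrite mulrAC -[X in bez X](addr0) -[0]polyC0 bez_cons IH actM //.
by rewrite Gw act0 mulr0 addr0.
Qed.

Lemma bez_Xn_sub1 k u w :
  bez ('X^k - 1) u w = \sum_(j < k) iter j s u * iter (k.-1 - j) r w.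
Proof.
rewrite bezDl -[- 1]mulr1 -[-1]polyCN bezCl [bez 1 _ _](_ : _ = 0); last first.
  by rewrite /bez size_poly1 big_ord1 big_ord0 mulr0.
rewrite mulr0 addr0 (@bezE k.+1) ?size_polyXn // big_ord_recr /= coefXn eqxx.
rewrite rmorph1 mul1r big1 ?add0r // => i _.
by rewrite coefXn ltn_eqF // rmorph0 mul0r.
Qed.

(** A trace to the field fixed by s only on elements fixed by s^N: N = n covers all of F, and N = k
    the subfield of q^k elements. *)
Definition tr (N : nat) (z : F) : F := \sum_(i < N) iter i s z.

Lemma trD N x y : tr N (x + y) = tr N x + tr N y.
Proof. by rewrite /tr -big_split; apply: eq_bigr => i _; rewrite iter_add. Qed.

Lemma tr0 N : tr N 0 = 0.
Proof. by rewrite /tr big1 // => i _; rewrite iter_zero. Qed.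

Lemma tr_sum N (I : Type) (l : seq I) (Q : pred I) (E : I -> F) :
  tr N (\sum_(j <- l | Q j) E j) = \sum_(j <- l | Q j) tr N (E j).
Proof. exact: (big_morph _ (trD N) (tr0 N)). Qed.

Lemma trZ N c x : tr N (iota c * x) = iota c * tr N x.
Proof.
rewrite /tr mulr_sumr; apply: eq_bigr => i _.
by rewrite iter_mul (iter_fixed i (sK c)).
Qed.

Lemma tr_s N z : s (tr N z) = tr N (s z).
Proof.
by rewrite /tr rmorph_sum; apply: eq_bigr => i _; rewrite -iterS iterSr.
Qed.

Lemma tr_inv N z : iter N s z = z -> tr N (s z) = tr N z.
Proof.
case: N => [|N] zN; first by rewrite /tr !big_ord0.
rewrite /tr big_ord_recr -iterSr zN [RHS]big_ord_recl addrC.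
by congr (_ + _); apply: eq_bigr => i _; rewrite lift0 iterSr.
Qed.

Lemma tr_inv_iter N i z : iter N s z = z -> tr N (iter i s z) = tr N z.
Proof.
move=> zN; elim: i => //= i <-; apply: tr_inv.
by rewrite -iterD addnC iterD zN.
Qed.

(** Invariance of the trace under s moves s^i from y to r^i on x. *)
Lemma tr_adjoint N P x y : iter N s x = x -> iter N s y = y ->
  tr N (x * act s P y) = tr N (act r P x * y).
Proof.
move=> xN yN; rewrite /act mulr_sumr mulr_suml !tr_sum; apply: eq_bigr => i _.
rewrite mulrCA -mulrA !trZ; congr (_ * _).
rewrite -[in LHS](iter_rs i x) -iter_mul tr_inv_iter // iter_mul yN; congr (_ * _).
rewrite -[RHS](_ : iter i r (iter N s x) = _) ?xN //.
by apply: (can_inj (iter_sr i)); rewrite -iterD addnC iterD !iter_rs.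
Qed.

(** The operator form of P being palindromic of degree f: P(s) = s^f P(s^-1). *)
Definition reciprocal_act (P : {poly K}) (f : nat) :=
  forall v, act s P v = iter f s (act r P v).

(** The adjoint of s^i P(s) is s^(-i) P(s^-1), which is s^(-i-f) P(s) by reciprocity, and - i - f
    agrees with i' modulo N. It is used with N = n to pair the summands of f, and with N = k for the
    symmetry of the Gram matrix. *)
Lemma tr_sym N P f i i' t x y : reciprocal_act P f ->
  iter N s x = x -> iter N s y = y -> (i + i' + f = N * t)%N ->
  tr N (x * iter i s (act s P y)) = tr N (y * iter i' s (act s P x)).
Proof.
move=> rP xN yN E.
have -> : iter i s (act s P y) = act s P (iter i s y) by rewrite act_iter.
have yiN : iter N s (iter i s y) = iter i s y by rewrite -iterD addnC iterD yN.
rewrite tr_adjoint // [in RHS]rP -[in RHS]iterD -[RHS](tr_inv_iter i); last first.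
  rewrite iter_mul yN -iterD addnC iterD; congr (_ * iter _ s _).
  by rewrite -act_comm xN.
rewrite iter_mul mulrC; congr (tr N (_ * _)).
by rewrite -iterD addnA E -act_comm (iterMfixed t xN).
Qed.

End SkewAction.

Section MooreMatrix.
Variables (K F : fieldType) (iota : {rmorphism K -> F}) (s r : {rmorphism F -> F}).
Hypotheses (sK : forall c, s (iota c) = iota c) (rK : forall c, r (iota c) = iota c).
Hypotheses (srK : cancel s r) (rsK : cancel r s).

Definition moore d (b : 'I_d -> F) : 'M[F]_d := \matrix_(t, j) iter j s (b t).

Lemma det_map_iter (f : {rmorphism F -> F}) i d (A : 'M[F]_d) :
  \det (map_mx (iter i f) A) = iter i f (\det A).
Proof.
elim: i => [|i IH] /=; first by congr (\det _); apply/matrixP => x y; rewrite mxE.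
by rewrite -IH -det_map_mx; congr (\det _); apply/matrixP => x y; rewrite !mxE.
Qed.

(** Applying s shifts the columns of the Moore matrix, and G(s) b_t = 0 expresses the new last
    column by the old ones. This is multiplication by the companion matrix of G, whose determinant
    is (-1)^d G(0). *)
Lemma moore_frobenius (G : {poly K}) d (b : 'I_d -> F) : (size G).-1 = d ->
  G \is monic -> (forall t, act iota s G (b t) = 0) ->
  s (\det (moore b)) = (-1) ^+ d * iota G`_0 * \det (moore b).
Proof.
move=> Ed; case: d / Ed b => b mG Gb; set d := (size G).-1.
have G0 : (0 < size G)%N by rewrite size_poly_gt0 monic_neq0.
have sG : size G = d.+1 by rewrite /d prednK.
have detC : \det (companionmx G) = (-1) ^+ d * G`_0.
  by have := char_poly_det (companionmx G); rewrite companionmxK // => ->; rewrite signrMK.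
have -> : (-1) ^+ d * iota G`_0 = \det (map_mx iota (companionmx G)).
  by rewrite det_map_mx detC rmorphM rmorph_sign.
rewrite -det_map_mx -[LHS]det_tr -[X in _ * X]det_tr -det_mulmx; congr (\det _).
apply/matrixP => j t; rewrite !mxE -iterS.
have [jd|jd] := eqVneq (j : nat) d.-1.
  have d0 : (0 < d)%N by case: (d) j {jd} => // -[].
  have := Gb t; rewrite (@actE _ _ iota s d.+1) ?sG // big_ord_recr /=.
  have -> : G`_d = 1 by rewrite -(monicP mG) lead_coefE sG.
  rewrite rmorph1 mul1r addrC => /eqP; rewrite addr_eq0 => /eqP.
  rewrite -iterS jd prednK // => ->; rewrite -sumrN; apply: eq_bigr => l _.
  by rewrite !mxE jd eqxx rmorphN mulNr.
have ljd : (j.+1 < d)%N by move: (ltn_ord j) jd; rewrite -/d; lia.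
rewrite (bigD1 (Ordinal ljd)) //= !mxE (negPf jd) eqxx rmorph1 mul1r.
rewrite big1 ?addr0 // => l; rewrite -val_eqE /= => ll.
by rewrite !mxE (negPf jd) eq_sym (negPf ll) rmorph0 mul0r.
Qed.

(** Collecting the powers of s on [b t] and of r on [b u] factors the Gram matrix as M H M'^T, where
    M is the Moore matrix, M' its image under r^a, and H is unitriangular because G is monic. The
    shift a - 1 and d = 2a are what turns r^(d-1-l) s^(a-1) into s^l r^a. *)
Lemma bez_moore (G : {poly K}) a d (b : 'I_d -> F) : size G = d.+1 ->
  G \is monic -> d = (2 * a)%N -> (0 < a)%N ->
  \det (\matrix_(t, u) bez iota s r G (b t) (iter a.-1 s (b u)))
    = \det (moore b) * iter a r (\det (moore b)).
Proof.
move=> sG mG Ed a0.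
pose H : 'M[F]_d := \matrix_(j, l) if (j <= l)%N then iota G`_(d - (l - j)) else 0.
have -> : \matrix_(t, u) bez iota s r G (b t) (iter a.-1 s (b u))
    = moore b *m H *m (map_mx (iter a r) (moore b))^T.
  apply/matrixP => t u; rewrite [LHS]mxE.
  have -> : bez iota s r G (b t) (iter a.-1 s (b u)) =
     \sum_(j < d) iter j s (b t) * \sum_(j.+1 <= i < d.+1)
        iota G`_i * iter (i.-1 - j) r (iter a.-1 s (b u)).
    rewrite /bez sG.
    under [RHS]eq_bigr => j _.
      rewrite mulr_sumr big_geq_mkord; over.
    rewrite (exchange_big_dep xpredT) //=.
    apply: eq_bigr => i _; rewrite mulr_sumr.
    have lei : (i <= d)%N by rewrite -ltnS.
    rewrite (big_ord_widen d (fun j => iota G`_i * (iter j s (b t) *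
      iter (i.-1 - j) r (iter a.-1 s (b u)))) lei).
    by apply: eq_bigr => j _; rewrite mulrCA.
  rewrite -mulmxA mxE; apply: eq_bigr => j _; rewrite !mxE; congr (_ * _).
  rewrite big_nat_rev big_add1 /=.
  have -> : \sum_(l < d) H j l * (map_mx (iter a r) (moore b))^T l u =
     \sum_(j <= l < d) iota G`_(d - (l - j)) * iter l s (iter a r (b u)).
    rewrite big_geq_mkord [RHS]big_mkcond; apply: eq_bigr => l _ /=.
    rewrite !mxE; case: ifP => _; last by rewrite mul0r.
    by rewrite iter_comm.
  rewrite big_nat_cond [RHS]big_nat_cond; apply: eq_bigr => l.
  rewrite andbT => /andP[jl ld].
  have -> : (j.+1 + d.+1 - l.+2 = d - (l - j))%N by lia.
  congr (_ * _).
  have -> : ((d - (l - j)).-1 - j = d.-1 - l)%N by lia.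
  apply: (can_inj (iter_sr srK (d.-1 - l))); rewrite !iter_rs // -iterD.
  have -> : (d.-1 - l + l = a.-1 + a)%N by lia.
  by rewrite iterD iter_rs.
rewrite !det_mulmx det_tr det_map_iter.
suff -> : \det H = 1 by rewrite mulr1.
rewrite -det_tr det_trig; last first.
  by apply/is_trig_mxP => i j ij; rewrite !mxE leqNgt ij.
rewrite big1 // => i _; rewrite !mxE leqnn subnn subn0.
by rewrite -[d]/(d.+1.-1) -sG -lead_coefE (monicP mG) rmorph1.
Qed.

End MooreMatrix.

Section AdditivePolynomials.
Variables (F : finFieldType) (q : nat) (s : {rmorphism F -> F}).
Hypotheses (q1 : (1 < q)%N) (sE : forall x, s x = x ^+ q).

Lemma iter_frob i x : iter i s x = x ^+ (q ^ i).
Proof. by elim: i => //= i ->; rewrite sE -exprM -expnSr. Qed.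

(** Since s is v -> v^q, the sum is a nonzero polynomial in v of degree at most q^(N-1). *)
Lemma card_ker_additive N (c : nat -> F) i0 : (i0 < N)%N -> c i0 != 0 ->
  (#|[set v | (\sum_(i < N) c i * iter i s v == 0)%R]| <= q ^ N.-1)%N.
Proof.
move=> iN ci; pose p : {poly F} := \sum_(i < N) c i *: 'X^(q ^ i).
have pE v : p.[v] = \sum_(i < N) c i * iter i s v.
  by rewrite horner_sum; apply: eq_bigr => i _; rewrite hornerZ hornerXn iter_frob.
have p0 : p != 0.
  apply: contraNneq ci => p0; have := coef0 F (q ^ i0); rewrite -p0 coef_sum.
  rewrite (bigD1 (Ordinal iN)) //= coefZ coefXn eqxx mulr1 big1 ?addr0; first by move->.
  move=> i ii; rewrite coefZ coefXn; case: eqP => [/eqP|]; rewrite ?mulr0 //.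
  by rewrite eqn_exp2l // => /eqP E; case/eqP: ii; apply: val_inj.
have sp : (size p <= (q ^ N.-1).+1)%N.
  apply: (leq_trans (size_sum _ _ _)); apply/bigmax_leqP => i _.
  rewrite (leq_trans (size_scale_leq _ _)) // size_polyXn ltnS leq_pexp2l ?(ltnW q1) //.
  by have := ltn_ord i; lia.
have := @max_poly_roots F p (enum [set v | \sum_(i < N) c i * iter i s v == 0]) p0.
rewrite enum_uniq -cardE => h; rewrite -ltnS (leq_trans (h _ isT)) //.
by apply/allP => v; rewrite mem_enum inE rootE pE.
Qed.

End AdditivePolynomials.

Section Fibers.
Variables (F : finZmodType) (f : F -> F).
Hypothesis fB : forall x y, f (x - y) = f x - f y.

Lemma card_fiber x0 : #|[set x | f x == f x0]| = #|[set x | f x == 0]|.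
Proof.
have f0 : f 0 = 0 by rewrite -[X in f X](subrr 0) fB subrr.
rewrite -[RHS](card_imset _ (addrI x0)).
apply: eq_card => x; rewrite inE; apply/idP/imsetP => [/eqP fx|[z]].
  by exists (x - x0); rewrite ?inE ?fB ?fx ?subrr // addrC subrK.
rewrite inE => /eqP fz ->.
by rewrite -[z]opprK -[- z]sub0r !fB fz f0 !subr0.
Qed.

Lemma sum_fibers (h : F -> nat) :
  (\sum_x h (f x) = #|[set x | f x == 0%R]| * \sum_(v in [set f x | x : F]) h v)%N.
Proof.
rewrite (partition_big_imset f) /= big_distrr /=.
apply: eq_bigr => v /imsetP[x0 _ ->].
rewrite (eq_bigr (fun=> h (f x0))) => [|x /eqP -> //].
rewrite sum_nat_const -(card_fiber x0); congr (_ * _)%N.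
by apply: eq_card => x; rewrite inE.
Qed.

Lemma card_ker_im :
  (#|F| = #|[set x | f x == 0%R]| * #|[set f x | x : F]|)%N.
Proof.
have := sum_fibers (fun=> 1%N).
by rewrite !sum1_card.
Qed.

End Fibers.

(** * The number of points *)

Section PointCount.
Variables (K F : finFieldType) (iota : {rmorphism K -> F}) (s r : {rmorphism F -> F}).
Hypotheses (sK : forall c, s (iota c) = iota c) (rK : forall c, r (iota c) = iota c).
Hypotheses (srK : cancel s r) (rsK : cancel r s).
Local Notation q := #|K|.
Hypothesis sE : forall x, s x = x ^+ q.
Hypothesis fixK : forall x, s x = x -> exists c, x = iota c.
Variables n k m a phi : nat.
Hypotheses (nE : n = (k * (2 * m))%N) (m0 : (0 < m)%N) (a0 : (0 < a)%N).
Hypothesis kE : (phi + 2 * a)%N = k.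
Hypotheses (sn : forall x, iter n s x = x) (cardF : #|F| = (q ^ n)%N).
Variables Phi G : {poly K}.
Hypotheses (PhiG : Phi * G = 'X^k - 1) (sPhi : size Phi = phi.+1).
Hypotheses (mG : G \is monic) (sG : size G = (2 * a).+1) (G0 : G`_0 = -1).
Hypothesis Phi_recip : reciprocal_act iota s r Phi phi.
Hypotheses (two0 : (2%:R : K) != 0) (odd_q : odd q).

Local Notation sact := (act iota s).
Local Notation str := (tr s).

Let q1 : (1 < q)%N. Proof. exact: finNzRing_gt1. Qed.
Let k0 : (0 < k)%N. Proof. lia. Qed.
Let n0 : (0 < n)%N. Proof. nia. Qed.

(** Additive Hilbert 90 by counting: y^q - y has kernel F_q, hence an image of q^(n-1) elements; the
    image lies in the kernel of the trace, which has at most that many. *)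
Let count_artin_schreier (c : F) :
  (\sum_y (y ^+ q - y == c)%R = q * (str n c == 0%R))%N.
Proof.
pose f y := s y - y.
have fB x y : f (x - y) = f x - f y by rewrite /f rmorphB; ring.
have kerf : #|[set x | f x == 0%R]| = q.
  rewrite -(card_imset [pred x : K | true] (fmorph_inj iota)).
  apply: eq_card => x; rewrite inE subr_eq0; apply/eqP/imsetP => [/fixK[d ->]|[d _ ->]].
    by exists d.
  exact: sK.
have imf : #|[set f x | x : F]| = (q ^ n.-1)%N.
  have := card_ker_im fB; rewrite kerf cardF -{1}(prednK n0) expnS.
  by move/eqP; rewrite eqn_pmul2l ?(ltnW q1) // => /eqP.
have imE : [set f x | x : F] = [set z | str n z == 0].
  apply/eqP; rewrite eqEcard imf; apply/andP; split.
    apply/subsetP => _ /imsetP[x _ ->]; rewrite inE /f -mulN1r.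
    by rewrite -(rmorphN1 iota) trD trZ // rmorphN1 mulN1r tr_inv // subrr.
  rewrite -[n.-1]/(n.-1); have := @card_ker_additive F q s q1 sE n (fun=> 1) 0 n0 (oner_neq0 _).
  by under eq_finset => v do under eq_bigr do rewrite mul1r.
have -> : (\sum_y (y ^+ q - y == c)%R = \sum_y (f y == c)%R)%N.
  by apply: eq_bigr => y _; rewrite /f sE.
rewrite (sum_fibers fB (fun v => (v == c) : nat)) kerf imE; congr (_ * _)%N.
have [tc|tc] := boolP (str n c == 0).
  by rewrite (bigD1 c) ?inE //= eqxx big1 // => v /andP[_ /negPf ->].
rewrite big1 // => v; rewrite inE => tv; apply/eqP; rewrite eqb0.
by apply: contraNneq tc => <-.
Qed.

Let T (x : F) := \sum_(j < 2 * m) iter (k * j) s x.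

Let T_fixed x : iter k s (T x) = T x.
Proof.
have shift l : iter k s (\sum_(j < l) iter (k * j) s x) + x
    = \sum_(j < l) iter (k * j) s x + iter (k * l) s x.
  elim: l => [|l IH]; first by rewrite !big_ord0 iter_zero muln0.
  by rewrite !big_ord_recr /= iter_add addrAC IH -iterD -mulnS.
by apply: (addIr x); rewrite shift -nE sn.
Qed.

(** Transitivity of the trace through the field fixed by s^k, over which [T] is linear. *)
Let T_linear x z : iter k s z = z -> str n (x * z) = str k (T x * z).
Proof.
move=> zk; rewrite /tr nE.
have mulS l : \sum_(i < k * l) iter i s (x * z)
    = \sum_(i < k) iter i s ((\sum_(j < l) iter (k * j) s x) * z).
  elim: l => [|l IH].
    by rewrite muln0 !big_ord0 big1 // => i _; rewrite mul0r iter_zero.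
  rewrite mulnS addnC big_split_ord IH /= -big_split; apply: eq_bigr => i _ /=.
  rewrite big_ord_recr /= mulrDl iter_add; congr (_ + _).
  by rewrite addnC iterD iter_mul (iterMfixed l zk).
exact: mulS.
Qed.

Let f x := x * \sum_(j < m) iter (a + k * j) s (sact Phi x).

(** The summands j and 2m - 1 - j have equal traces, since (a + kj) + (a + k(2m - 1 - j)) + phi =
    2km = n; so twice the half sum is the full sum. *)
Let two_tr_f x : 2%:R * str n (f x) = str k (T x * iter a s (sact Phi (T x))).
Proof.
pose w j := x * iter (a + k * j) s (sact Phi x).
have trf : str n (f x) = \sum_(j < m) str n (w j) by rewrite /f mulr_sumr tr_sum.
have wrev j : (j < m)%N -> str n (w j) = str n (w ((2 * m).-1 - j)%N).
  move=> jm; apply: (tr_sym sK srK rsK (t := 1) Phi_recip) => //.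
  have -> : (a + k * j + (a + k * ((2 * m).-1 - j)) + phi =
      phi + 2 * a + k * (j + ((2 * m).-1 - j)))%N by ring.
  have -> : (j + ((2 * m).-1 - j) = (2 * m).-1)%N by lia.
  by rewrite kE -mulnS prednK ?nE ?muln1; lia.
have -> : 2%:R * str n (f x) = \sum_(j < 2 * m) str n (w j).
  rewrite mulr_natl mulr2n trf mul2n -addnn big_split_ord /=; congr (_ + _).
  rewrite (reindex_inj rev_ord_inj) /=; apply: eq_bigr => j _.
  rewrite wrev; last by have := ltn_ord j; lia.
  by congr (str n (w _)); have := ltn_ord j; lia.
rewrite -tr_sum -T_linear; last first.
  by rewrite -iterD addnC iterD -act_iter // T_fixed.
congr (str n _); rewrite -mulr_sumr; congr (x * _).
rewrite /T act_sum // iter_sum; apply: eq_bigr => j _.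
by rewrite act_iter // -iterD.
Qed.

Let qf v := bez iota s r G v (iter a.-1 s v).

(** The trace form is the Bezoutian of X^k - 1 = Phi G, because the shift a - 1 turns r^(k-1-j) into
    s^(a+j) modulo s^k. As G(r) kills the second argument, [bezM] leaves the Bezoutian of G at
    Phi(s) u. *)
Let bez_tr u w : iter k s u = u -> iter k s w = w ->
  str k (u * iter a s (sact Phi w)) = bez iota s r G (sact Phi u) (iter a.-1 s (sact Phi w)).
Proof.
move=> uk wk; set w' := iter a.-1 s (sact Phi w).
have w'E : sact Phi w = iter phi s (act iota r Phi w) by rewrite Phi_recip.
have Gw : act iota r G w' = 0.
  rewrite /w' w'E !act_comm // -actM // mulrC PhiG act_Xn_sub1 //.
  suff -> : iter k r w = w by rewrite subrr !iter_zero.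
  by rewrite -{1}wk iter_sr.
rewrite -bezM // PhiG bez_Xn_sub1 /tr; apply: eq_bigr => j _.
rewrite iter_mul; congr (_ * _); apply: (can_inj (iter_sr srK (k.-1 - j))).
rewrite /w' iter_rs // -!iterD.
have -> : (k.-1 - j + j + a = a.-1 + k)%N by have := ltn_ord j; lia.
by rewrite iterD -act_iter // wk.
Qed.

(** The map x -> v written as a single polynomial in s, so that its kernel is bounded by its
    degree. *)
Let f0 x := sact (Phi * \sum_(j < 2 * m) 'X^(k * j)) x.

Let f0E x : f0 x = sact Phi (T x).
Proof.
rewrite /f0 actM //; congr (sact Phi _).
rewrite (big_morph (fun P => sact P x) (fun P Q => actDl iota s P Q x) (_ : _ = 0)).
  by apply: eq_bigr => j _; rewrite actXn.
by rewrite /act size_poly0 big_ord0.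
Qed.

Let two_tr_qf x : 2%:R * str n (f x) = qf (f0 x).
Proof. by rewrite two_tr_f bez_tr ?T_fixed // f0E. Qed.

Let V := [set v | sact G v == 0].

Let f0B x y : f0 (x - y) = f0 x - f0 y. Proof. exact: actB. Qed.

Let f0V x : sact G (f0 x) = 0.
Proof. by rewrite f0E -actM // mulrC PhiG act_Xn_sub1 // T_fixed subrr. Qed.

Let act_bound (P : {poly K}) N : size P = N.+1 ->
  (#|[set v | sact P v == 0%R]| <= q ^ N)%N.
Proof.
move=> sP; have P0 : iota P`_N != 0.
  rewrite fmorph_eq0 -[N]/(N.+1.-1) -sP -lead_coefE lead_coef_eq0.
  by rewrite -size_poly_eq0 sP.
have := @card_ker_additive F q s q1 sE N.+1 (fun i => iota P`_i) N (ltnSn N) P0.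
by rewrite /act sP.
Qed.

(** Degrees give |ker f0| <= q^(n-2a) and |V| <= q^(2a). The image lies in V and |ker f0| |im f0| =
    q^n, so all these bounds are equalities. *)
Let image_kernel : #|[set x | f0 x == 0%R]| = (q ^ (n - 2 * a))%N /\
  [set f0 x | x : F] = V /\ #|V| = (q ^ (2 * a))%N.
Proof.
have kerB : (#|[set x | f0 x == 0%R]| <= q ^ (n - 2 * a))%N.
  apply: act_bound.
  pose S : {poly K} := \sum_(j < 2 * m) 'X^(k * j).
  have S0 : size S = (k * (2 * m).-1).+1.
    have m2 : ((2 * m).-1.+1 = 2 * m)%N by lia.
    rewrite /S -[in LHS]m2 big_ord_recr /= addrC size_polyDl size_polyXn //.
    rewrite ltnS (leq_trans (size_sum _ _ _)) //; apply/bigmax_leqP => i _.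
    by rewrite size_polyXn ltn_pmul2l.
  rewrite size_mul -?size_poly_eq0 ?sPhi -/S ?S0 // nE -kE.
  have -> : (2 * m = (2 * m).-1.+1)%N by lia.
  by rewrite mulnS; lia.
have VB : (#|V| <= q ^ (2 * a))%N by apply: act_bound.
have imV : [set f0 x | x : F] \subset V.
  by apply/subsetP => _ /imsetP[x _ ->]; rewrite inE f0V.
have E := card_ker_im f0B; rewrite cardF in E.
have an : (2 * a <= n)%N by rewrite nE; nia.
have Eq : (q ^ n = q ^ (n - 2 * a) * q ^ (2 * a))%N by rewrite -expnD subnK.
have le := subset_leq_card imV.
have p1 : (0 < q ^ (n - 2 * a))%N by rewrite expn_gt0 (ltnW q1).
have p2 : (0 < q ^ (2 * a))%N by rewrite expn_gt0 (ltnW q1).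
have [E1 E2] : #|[set x | f0 x == 0%R]| = (q ^ (n - 2 * a))%N /\
    #|[set f0 x | x : F]| = (q ^ (2 * a))%N.
  have leI := leq_trans le VB.
  by move: E; rewrite Eq; move: kerB leI p1 p2; move: #|_| #|_| => u v; nia.
split=> //; have EV : [set f0 x | x : F] = V by apply/eqP; rewrite eqEcard imV E2 VB.
by split=> //; rewrite -EV.
Qed.

(** V has q^(2a) elements, so a maximal independent family in it has 2a members; the last clause
    turns sums over V into sums over coordinate rows. *)
Let basis : exists b : 'I_(2 * a) -> F, [/\ forall i, b i \in V,
  (forall v, v \in V -> exists c, v = lcomb iota b c) &
  forall h : F -> nat,
   (\sum_(v in V) h v = \sum_(c : 'rV[K]_(2 * a)) h (lcomb iota b (fun i => c 0%R i)))%N].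
Proof.
have [_ [_ cV]] := image_kernel.
pose V' v := v \in V; pose W (v : F) := v = 0.
have sV : subsp iota V'.
  split=> [|u v|c u]; rewrite /V' !inE.
  - by rewrite act0 // eqxx.
  - by rewrite actD => /eqP -> /eqP ->; rewrite addr0.
  - by rewrite actZ // => /eqP ->; rewrite mulr0.
have sW : subsp iota W by apply: subsp0.
have inj m' (u : 'I_m' -> F) : indep iota u W ->
    injective (fun c : 'rV[K]_m' => lcomb iota u (fun i => c 0 i)).
  move=> iu c c' /eqP; rewrite -subr_eq0 lcombB => /eqP /iu E.
  by apply/rowP => i; apply/eqP; rewrite -subr_eq0 E.
have bnd m' (u : 'I_m' -> F) : (forall i, V' (u i)) -> indep iota u W -> (m' <= 2 * a)%N.
  move=> Vu iu; rewrite -(leq_exp2l _ _ q1) -cV -[m']mul1n -card_mx.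
  rewrite -(card_imset _ (inj _ _ iu)); apply/subset_leq_card/subsetP => _ /imsetP[c _ ->].
  exact: (@subsp_lcomb _ _ _ V').
have [d dB [b [Vb ib sb]]] := fdim_exists sV sW bnd.
have Vim : V = [set lcomb iota b (fun i => c 0 i) | c : 'rV[K]_d].
  apply/setP => v; apply/idP/imsetP => [/sb[c /eqP]|[c _ ->]]; last exact: (@subsp_lcomb _ _ _ V').
  rewrite subr_eq0 => /eqP ->; exists (\row_i c i) => //.
  by apply: eq_bigr => i _; rewrite mxE.
have dE : d = (2 * a)%N.
  have := cV; rewrite Vim card_imset; last exact: inj.
  by rewrite card_mx mul1n => /eqP; rewrite eqn_exp2l // => /eqP.
move: b Vb ib sb Vim; rewrite dE => b Vb ib sb Vim; exists b; split=> // [v|h].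
  by rewrite Vim => /imsetP[c _ ->]; exists (fun i => c 0 i).
by rewrite Vim big_imset //= => c c' _ _; apply: inj.
Qed.

Lemma count_qf_zeros :
  (\sum_(v in V) (qf v == 0%R) + (q - 1) * q ^ a.-1 = q ^ (2 * a).-1)%N.
Proof.
have [b [Vb Vspan ->]] := basis.
have [_ [imV cV]] := image_kernel.
(* Each basis vector is Phi(s) u with u fixed by s^k, so [bez_tr] writes the Gram entries as traces
   from the field of q^k elements. Hence they are symmetric and lie in K. *)
have /choice[u hu] : forall i, exists u, iter k s u = u /\ b i = sact Phi u.
  move=> i; have := Vb i; rewrite -imV => /imsetP[x _ ->].
  by exists (T x); rewrite T_fixed f0E.
pose B t l := bez iota s r G (b t) (iter a.-1 s (b l)).
have BE t l : B t l = str k (u t * iter a s (sact Phi (u l))).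
  by rewrite /B bez_tr ?(hu _).1 // -!(hu _).2.
have Bsym t l : B t l = B l t.
  rewrite !BE; apply: (tr_sym sK srK rsK (t := 1) Phi_recip); rewrite ?(hu _).1 //.
  by lia.
have /choice[A0 hA0] : forall tl, exists c, B tl.1 tl.2 = iota c.
  move=> [t l] /=; apply: fixK; rewrite BE tr_s tr_inv // iter_mul (hu _).1.
  by rewrite -iterD addnC iterD -act_iter // (hu _).1.
pose A : 'M[K]_(2 * a) := \matrix_(t, l) A0 (t, l).
have qfE (c : 'rV[K]_(2 * a)) :
    qf (lcomb iota b (fun i => c 0 i)) = iota ((c *m A *m c^T) 0 0).
  have bez0l w : bez iota s r G 0 w = 0.
    by apply: (addrI (bez iota s r G 0 w)); rewrite -bezD !addr0.
  have bez0r v : bez iota s r G v 0 = 0.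
    by apply: (addrI (bez iota s r G v 0)); rewrite -bezDr !addr0.
  rewrite /qf /lcomb iter_sum.
  rewrite (big_morph (fun x => bez iota s r G x _) (fun x y => bezD _ _ _ _ x y _) (bez0l _)).
  rewrite !mxE rmorph_sum.
  under eq_bigr => i _.
    rewrite bezZ // (big_morph (bez iota s r G (b i)) (bezDr _ _ _ _ _) (bez0r _)) mulr_sumr.
    over.
  rewrite exchange_big /=; apply: eq_bigr => l _.
  rewrite !mxE mulr_suml rmorph_sum; apply: eq_bigr => i _.
  rewrite iter_mul (iter_fixed _ (sK _)) bezZr // -/(B i l) mxE !rmorphM.
  by rewrite -(hA0 (i, l)) mulrA mulrAC.
pose D := \det (moore s b).
have sD : s D = - D.
  have sGp : (size G).-1 = (2 * a)%N by rewrite sG.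
  have Gb t : sact G (b t) = 0 by apply/eqP; have := Vb t; rewrite inE.
  rewrite (moore_frobenius sGp mG Gb) G0 rmorphN1 mulrN1 mulNr.
  by rewrite exprM sqrrN !expr1n mul1r.
have rD : r D = - D by apply: (can_inj srK); rewrite rsK rmorphN sD opprK.
have irD i : iter i r D = (-1) ^+ i * D.
  by elim: i => [|i IH]; rewrite ?mul1r //= IH rmorphM rmorph_sign rD mulrN exprS mulN1r mulNr.
have detA : iota (\det A) = (-1) ^+ a * D ^+ 2.
  rewrite -det_map_mx (_ : map_mx iota A = \matrix_(t, l) B t l).
    by rewrite bez_moore // -/D irD mulrCA -expr2.
  by apply/matrixP => t l; rewrite !mxE -(hA0 (t, l)).
(* A relation between the columns of the Moore matrix would make all q^(2a) elements of V roots of a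
   nonzero polynomial of degree at most q^(2a-1). *)
have Dn0 : D != 0.
  rewrite /D -det_tr; apply/negP => /det0P[c cn0 cM].
  have [i0 ci0] : exists i0, c 0 i0 != 0.
    by apply/existsP; apply: contraNT cn0 => /existsPn c0; apply/eqP/rowP => i;
       rewrite mxE; apply/eqP; have := c0 i; rewrite negbK.
  pose c' i := if insub i is Some j then c 0 j else 0.
  have c'E (i : 'I_(2 * a)) : c' i = c 0 i.
    by rewrite /c' insubT //= => lt; congr (c 0 _); apply: val_inj.
  have := @card_ker_additive F q s q1 sE (2 * a) c' i0 (ltn_ord i0).
  rewrite c'E => /(_ ci0); apply/negP; rewrite -ltnNge.
  apply: (@leq_trans (q ^ (2 * a))%N); first by rewrite ltn_exp2l //; lia.
  rewrite -cV; apply/subset_leq_card/subsetP => _ /Vspan[e ->].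
  rewrite inE; apply/eqP; under eq_bigr => j _.
    rewrite iter_sum mulr_sumr; under eq_bigr => i _.
      rewrite iter_mul (iter_fixed _ (sK _)) mulrCA; over.
    over.
  rewrite exchange_big big1 //= => i _; rewrite -mulr_sumr.
  have := congr1 (fun M : 'rV_(2 * a) => M 0 i) cM; rewrite !mxE => cMi.
  suff -> : \sum_(j < 2 * a) c' j * iter j s (b i) = 0 by rewrite mulr0.
  by apply: etrans cMi; apply: eq_bigr => j _; rewrite !mxE c'E.
have n2 : (2%:R : F) != 0 by rewrite -(rmorph_nat iota) fmorph_eq0.
rewrite -(count_quadratic_even two0 odd_q a0 (A := A)).
- by congr (_ + _)%N; apply: eq_bigr => c _; rewrite qfE fmorph_eq0.
- by apply/matrixP => t l; rewrite !mxE; apply: (fmorph_inj iota); rewrite -(hA0 (t, l)) -(hA0 (l, t)) /= Bsym.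
- by rewrite -(fmorph_eq0 iota) detA mulf_neq0 ?signr_eq0 ?expf_neq0.
(* A square root in K of the discriminant D^2 would be D or - D, hence fixed by s, against s D = - D
   and 2 != 0. *)
apply/negP => /existsP[t /eqP tE].
have : iota t ^+ 2 = D ^+ 2.
  by rewrite -rmorphXn tE rmorphM rmorph_sign detA signrMK.
move/eqP; rewrite eqf_sqr => Dt.
have sDD : s D = D.
  by case/orP: Dt => /eqP E; [rewrite -E sK | rewrite -[D]opprK -E rmorphN sK].
by move: sDD; rewrite sD => /eqP; rewrite eq_sym -addr_eq0 -mulr2n -mulr_natl mulf_eq0 (negPf n2) (negPf Dn0).
Qed.

(** Each x contributes q points when Q (f0 x) = 0 and none otherwise, and f0 has fibers of q^(n-2a)
    elements over V; the deficit has exponent 1 + (n - 2a) + (a - 1) = n - a. *)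
Lemma affine_point_count :
  (\sum_(z : F * F) (z.2 ^+ q - z.2 ==
       z.1 * \sum_(j < m) iter (a + k * j) s (sact Phi z.1))%R + (q - 1) * q ^ (n - a)
     = q ^ n)%N.
Proof.
have n2 : (2%:R : F) != 0 by rewrite -(rmorph_nat iota) fmorph_eq0.
have [kerE [imE _]] := image_kernel.
rewrite -(pair_bigA _ (fun x y => (y ^+ q - y == f x) : nat)) /=.
rewrite (eq_bigr (fun x => q * (qf (f0 x) == 0%R)))%N => [|x _]; last first.
  rewrite count_artin_schreier; congr (_ * nat_of_bool _)%N.
  by rewrite -two_tr_qf mulf_eq0 (negPf n2).
rewrite -big_distrr /= (sum_fibers f0B (fun v => (qf v == 0) : nat)) kerE imE.
have an : (2 * a <= n)%N by rewrite nE; nia.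
have -> : (q ^ n = q * q ^ (n - 2 * a) * q ^ (2 * a).-1)%N.
  by rewrite -expnS -expnD; congr (_ ^ _)%N; lia.
rewrite -count_qf_zeros mulnDr mulnA; congr (_ + _)%N.
have -> : (n - a = 1 + (n - 2 * a) + a.-1)%N by lia.
by rewrite !expnD expn1; ring.
Qed.

End PointCount.

(** * The subfield of q elements and cyclotomic polynomials *)

Section FixedField.
Variables (F : finFieldType) (s : {rmorphism F -> F}).

Definition fixed_pred : {pred F} := fun x => s x == x.

Lemma fixed_divring : divring_closed fixed_pred.
Proof.
split=> [|x y|x y]; rewrite !unfold_in ?rmorph1 //.
  by move=> /eqP sx /eqP sy; rewrite rmorphB sx sy.
by move=> /eqP sx /eqP sy; rewrite fmorph_div sx sy.
Qed.

HB.instance Definition _ := GRing.isDivringClosed.Build F fixed_pred fixed_divring.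

Record fixed_field := FixedField { fixed_val :> F; _ : fixed_val \in fixed_pred }.

HB.instance Definition _ := [isSub for fixed_val].
HB.instance Definition _ := [Finite of fixed_field by <:].
HB.instance Definition _ := [SubChoice_isSubIntegralDomain of fixed_field by <:].
HB.instance Definition _ := [SubIntegralDomain_isSubField of fixed_field by <:].

Lemma fixed_fieldP : exists (K : finFieldType) (iota : {rmorphism K -> F}),
  forall x, s x = x <-> exists c, x = iota c.
Proof.
exists fixed_field, (val : {rmorphism fixed_field -> F}) => x; split=> [sx|[[c cP] ->]].
  have xP : x \in fixed_pred by rewrite unfold_in sx eqxx.
  by exists (FixedField xP).
by apply/eqP.
Qed.

End FixedField.

Lemma frobenius_power (R : comNzRingType) p : p \in [pchar R] ->
  forall e, exists s : {rmorphism R -> R}, forall x, s x = x ^+ (p ^ e).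
Proof.
move=> pR; elim=> [|e [s sE]]; first by exists idfun => x.
exists (pFrobenius_aut pR \o s) => x /=.
by rewrite pFrobenius_autE sE -exprM -expnSr.
Qed.

Section Cyclotomic.
Variables (E : fieldType) (d : nat) (xi : E).
Hypothesis prim_xi : d.-primitive_root xi.
Local Notation C := (cyclotomic xi d).
Let d0 : (0 < d)%N. Proof. exact: prim_order_gt0 prim_xi. Qed.

Lemma cyclotomic_dvdp_Xn_sub_1 k : (d %| k)%N -> C %| 'X^k - 1.
Proof.
case/dvdnP=> m ->; rewrite mulnC exprM subrX1; apply: dvdp_mulr.
rewrite (prod_cyclotomic prim_xi) (bigD1_seq d) ?divisors_uniq //=.
  by rewrite divnn d0 expr1 dvdp_mulr.
by rewrite -dvdn_divisors.
Qed.

(** The p-th power maps the root xi^k to xi^(kp) and, p being prime to d, permutes the primitive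
    d-th roots of unity. *)
Lemma cyclotomic_frobenius p i : p \in [pchar E] -> ~~ (p %| d)%N -> C`_i ^+ p = C`_i.
Proof.
move=> pE npd; have pp := pcharf_prime pE.
have cop : coprime p d by rewrite prime_coprime.
rewrite -(pFrobenius_autE pE) -coef_map.
suff -> : map_poly (pFrobenius_aut pE) C = C by [].
rewrite /cyclotomic rmorph_prod /=.
pose h (k : 'I_d) := Ordinal (ltn_pmod (k * p) d0).
have hI : injective h.
  move=> x y /(congr1 val) /= /(congr1 (fun j => xi ^+ j)); rewrite !prim_expr_mod //.
  rewrite !exprM -!(pFrobenius_autE pE) => /fmorph_inj /eqP.
  by rewrite (eq_prim_root_expr prim_xi) !modn_small // => /eqP /val_inj.
rewrite [RHS](reindex_inj hI) /=.
rewrite [RHS](eq_bigl (fun k : 'I_d => coprime k d)) => [|k]; last first.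
  by rewrite coprime_modl coprimeMl cop andbT.
apply: eq_bigr => k _; rewrite rmorphB /= map_polyX map_polyC /=.
by rewrite pFrobenius_autE -exprM prim_expr_mod.
Qed.

(** The reversed polynomial vanishes at every primitive root, as their inverses are primitive too,
    so it equals C(0) C, and comparing constant terms gives C(0)^2 = 1. If C(0) = -1 then C(1) = -
    C(1), so 1 would be a primitive d-th root of unity, against d > 1. *)
Lemma cyclotomic_reciprocal i : (2%:R : E) != 0 -> (1 < d)%N -> C`_0 = 1 /\
  ((i <= totient d)%N -> C`_(totient d - i) = C`_i).
Proof.
move=> n2 d1; set f := totient d.
have xi0 : xi != 0.
  apply: contraTneq d0 => xi0; have := prim_expr_order prim_xi.
  by rewrite xi0 expr0n; case: (d) => //= _ /eqP; rewrite eq_sym oner_eq0.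
have rootC x : root C x = d.-primitive_root x by apply: root_cyclotomic.
have sC : size C = f.+1 by apply: size_cyclotomic.
have C00 : C`_0 != 0.
  rewrite -horner_coef0 -rootE rootC; apply: contraTN d0 => p0.
  have := prim_expr_order p0; rewrite expr0n; case: (d) => //= _ /eqP.
  by rewrite eq_sym oner_eq0.
have Cf : C`_f = 1 by rewrite -(monicP (cyclotomic_monic xi d)) lead_coefE sC.
pose D : {poly E} := \poly_(j < f.+1) C`_(f - j).
have sD : size D = f.+1 by rewrite size_poly_eq // subnn.
have rD x : d.-primitive_root x -> root D x.
  move=> px; have x0 : x != 0.
    apply: contraTneq d0 => x0; have := prim_expr_order px.
    by rewrite x0 expr0n; case: (d) => //= _ /eqP; rewrite eq_sym oner_eq0.
  have pV : d.-primitive_root x^-1.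
    have := prim_root_exp_coprime d.-1 px; rewrite coprime_sym coprimenP // => pd.
    suff -> : x^-1 = x ^+ d.-1 by [].
    by apply: (mulfI x0); rewrite divff // -exprS prednK // prim_expr_order.
  have := rootC x^-1; rewrite pV => /eqP; rewrite horner_coef sC => E0.
  apply/eqP; rewrite horner_poly.
  transitivity (x ^+ f * \sum_(i < f.+1) C`_i * x^-1 ^+ i); last by rewrite E0 mulr0.
  rewrite mulr_sumr (reindex_inj rev_ord_inj); apply: eq_bigr => j _ /=.
  have jf : (j <= f)%N by rewrite -ltnS.
  by rewrite subSS subKn // mulrCA exprVn expfB_cond // (negPf x0).
have DC : D = C`_0 *: C.
  pose rs := [seq xi ^+ k | k : 'I_d in [pred k : 'I_d | coprime k d]].
  have CE : C = \prod_(z <- rs) ('X - z%:P) by rewrite big_image.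
  have memrs z : (z \in rs) = d.-primitive_root z by rewrite -rootC CE root_prod_XsubC.
  have urs : uniq_roots rs.
    rewrite uniq_rootsE map_inj_in_uniq ?enum_uniq // => x y _ _ /eqP.
    by rewrite (eq_prim_root_expr prim_xi) !modn_small // => /eqP /val_inj.
  rewrite [LHS](all_roots_prod_XsubC _ _ urs) -?CE.
  - by rewrite lead_coefE sD coef_poly leqnn subnn.
  - by rewrite sD -sC CE size_prod_XsubC.
  - by apply/allP => z; rewrite memrs => /rD.
have Dcoef j : (j <= f)%N -> C`_(f - j) = C`_0 * C`_j.
  by move=> jf; rewrite -coefZ -DC coef_poly ltnS jf.
have C01 : C`_0 = 1.
  have := Dcoef f (leqnn f); rewrite subnn Cf mulr1 => _.
  have := Dcoef 0%N (leq0n f); rewrite subn0 Cf -expr2 => /esym /eqP.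
  rewrite -subr_eq0 -[X in _ - X](expr1n _ 2) subr_sqr mulf_eq0 subr_eq0 addr_eq0.
  case/orP=> /eqP // CN.
  have : C.[1] = - C.[1].
    rewrite {1}horner_coef sC (reindex_inj rev_ord_inj) /= horner_coef sC -sumrN.
    apply: eq_bigr => j _; have jf : (j <= f)%N by rewrite -ltnS.
    rewrite subSS Dcoef // CN mulN1r !expr1n.
    by rewrite mulNr.
  move/eqP; rewrite -addr_eq0 -mulr2n -mulr_natl mulf_eq0 (negPf n2) /= -rootE rootC.
  move=> p1; have := prim_order_dvd p1 1; rewrite expr1 eqxx dvdn1.
  by move=> /eqP E1; rewrite E1 in d1.
by split=> // jf; rewrite Dcoef // C01 mul1r.
Qed.

End Cyclotomic.

(** At most q by the degree. At least q because the image of s - 1 lies in the kernel of the trace,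
    which has at most q^(n-1) elements. *)
Lemma card_fixed_points (F : finFieldType) (q n : nat) (s : {rmorphism F -> F}) :
  (1 < q)%N -> (0 < n)%N -> (forall x, s x = x ^+ q) -> #|F| = (q ^ n)%N ->
  #|[set x : F | s x == x]| = q.
Proof.
move=> q1 n0 sE cF.
have sn x : iter n s x = x by rewrite (iter_frob sE) -cF expf_card.
pose f x := s x - x.
have fB x y : f (x - y) = f x - f y by rewrite /f rmorphB; ring.
have kerE : [set x | s x == x] = [set x | f x == 0].
  by apply/setP => x; rewrite !inE /f subr_eq0.
have upper : (#|[set x | f x == 0%R]| <= q)%N.
  have := @card_ker_additive F q s q1 sE 2 (fun i => if i == 0%N then -1 else 1) 1 isT (oner_neq0 _).
  rewrite expn1; congr (_ <= _)%N; apply: eq_card => x; rewrite !inE.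
  by rewrite big_ord_recl big_ord1 /= mulN1r mul1r addrC.
have im : (#|[set f x | x : F]| <= q ^ n.-1)%N.
  have := @card_ker_additive F q s q1 sE n (fun=> 1) 0 n0 (oner_neq0 _).
  apply: leq_trans; apply/subset_leq_card/subsetP => _ /imsetP[x _ ->].
  rewrite inE; under eq_bigr => i _ do rewrite mul1r iter_sub -iterSr.
  rewrite -(big_mkord xpredT (fun i => iter i.+1 s x - iter i s x)) telescope_sumr //.
  by rewrite sn subrr.
have := card_ker_im fB; rewrite cF kerE -(prednK n0) expnS => E.
apply/eqP; rewrite eqn_leq upper /=.
have p0 : (0 < q ^ n.-1)%N by rewrite expn_gt0 (ltnW q1).
rewrite -(leq_pmul2r p0) E /=; apply: leq_mul => //.
Qed.

(** * Degree of the right-hand side and the point count over F *)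

Section CurvePolynomial.
Variables (F : fieldType) (q : nat).
Hypothesis q1 : (1 < q)%N.

Lemma size_q_associate (Phi : {poly F}) (f : nat) : size Phi = f.+1 -> Phi \is monic ->
  size (q_associate q Phi) = (q ^ f).+1 /\ q_associate q Phi \is monic.
Proof.
move=> sP mP; have Pf : Phi`_f = 1 by rewrite -(monicP mP) lead_coefE sP.
have -> : q_associate q Phi = 'X^(q ^ f) + \sum_(i < f) Phi`_i *: 'X^(q ^ i).
  by rewrite /q_associate sP big_ord_recr /= Pf scale1r addrC.
have lt : (size (\sum_(i < f) Phi`_i *: 'X^(q ^ i))%R < size ('X^(q ^ f) : {poly F}))%N.
  rewrite size_polyXn ltnS (leq_trans (size_sum _ _ _)) //; apply/bigmax_leqP => i _.
  by rewrite (leq_trans (size_scale_leq _ _)) // size_polyXn ltn_exp2l.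
by rewrite monicE lead_coefDl // size_polyDl // size_polyXn lead_coefXn.
Qed.

(** The summands have degrees q^(f + a + k j), strictly increasing in j, so the last one
    dominates. *)
Lemma size_curve_rhs (k n a m f : nat) (Phi : {poly F}) :
  size Phi = f.+1 -> Phi \is monic -> (0 < k)%N -> n = (k * (2 * m))%N -> (0 < m)%N ->
  size (curve_rhs q k n a Phi) = (q ^ (f + a + k * m.-1)).+2 /\
  curve_rhs q k n a Phi \is monic.
Proof.
move=> sP mP k0 nE m0; have [sQ mQ] := size_q_associate sP mP.
set Q := q_associate q Phi in sQ mQ.
have mE : (n %/ (2 * k) = m.-1.+1)%N by rewrite prednK // nE mulnCA mulnA mulKn //; lia.
have sQj e : size (Q ^+ e) = (q ^ f * e).+1.
  by rewrite -[LHS]prednK ?size_poly_gt0 ?monic_neq0 ?monic_exp // size_exp sQ.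
pose h j := (f + (a + k * j))%N.
have sh j : size (Q ^+ (q ^ (a + k * j))) = (q ^ h j).+1 by rewrite sQj -expnD.
pose R := \sum_(j < m.-1) Q ^+ (q ^ (a + k * j)).
have lt : (size R < size (Q ^+ (q ^ (a + k * m.-1)))%R)%N.
  rewrite sh ltnS (leq_trans (size_sum _ _ _)) //; apply/bigmax_leqP => i _.
  by rewrite sh ltn_exp2l // /h !ltn_add2l ltn_pmul2l.
have mS : Q ^+ (q ^ (a + k * m.-1)) + R \is monic.
  by rewrite monicE lead_coefDl // -monicE monic_exp.
have -> : curve_rhs q k n a Phi = 'X * (Q ^+ (q ^ (a + k * m.-1)) + R).
  by rewrite /curve_rhs mE big_ord_recr addrC.
split; last by rewrite monicMl ?monicX.
by rewrite mulrC size_mulX ?monic_neq0 // size_polyDl // sh /h addnA.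
Qed.

End CurvePolynomial.

Lemma char_neq0_odd (R : nzRingType) p : p \in [pchar R] -> odd p -> (2%:R : R) != 0.
Proof.
move=> pR po; rewrite -(dvdn_pcharf pR) dvdn_divisors // !inE.
by have := pcharf_prime pR; case: p po {pR} => // -[|[|p]].
Qed.

Lemma totient_ltn d : (1 < d)%N -> (totient d < d)%N.
Proof.
case: d => [|d] // d1; rewrite totient_count_coprime big_nat_recl //= /coprime gcdn0.
rewrite (gtn_eqF d1) add0n ltnS big_mkord -[X in (_ <= X)%N]card_ord -sum1_card.
by apply: leq_sum => i _; apply: leq_b1.
Qed.

(** Phi is given over F, but its coefficients lie in the prime field and are fixed by s, so it
    descends to [PK] over the field K of q elements. The cofactor of [PK] in X^k - 1 is the G of
    [affine_point_count]. *)
Lemma curve_point_count (p e q : nat) (hp : prime p) (hpodd : odd p) (he : (0 < e)%N)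
  (hq : q = (p ^ e)%N)
  (k d n a : nat) (hk : (0 < k)%N)
  (hd : (2 < d)%N) (hdk : (d %| k)%N) (hpd : ~~ (p %| d)%N)
  (hn : (0 < n)%N) (hkn : (2 * k %| n)%N)
  (ha : (totient d + 2 * a)%N = k)
  (F : finFieldType) (hF : #|F| = (q ^ n)%N)
  (Phi : {poly F}) (hPhi : is_cyclotomic d Phi) :
  [/\ (#|[set xy : F * F | (xy.2 ^+ q - xy.2 == (curve_rhs q k n a Phi).[xy.1])%R]|
         + (q - 1) * q ^ (n - a) = q ^ n)%N,
      size Phi = (totient d).+1, Phi \is monic & (0 < a)%N].
Proof.
have q1 : (1 < q)%N by rewrite hq -(exp1n e) ltn_exp2r // prime_gt1.
have pF : p \in [pchar F].
  by apply: (@card_finPcharP F p (e * n)) => //; rewrite hF hq expnM.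
have d0 : (0 < d)%N by apply: ltn_trans hd.
have a0 : (0 < a)%N.
  rewrite lt0n; apply/eqP => a00; have := dvdn_leq hk hdk.
  by rewrite -ha a00 muln0 addn0 leqNgt totient_ltn // (ltn_trans _ hd).
have [s sE0] := frobenius_power pF e.
(* [r] is s^(n-1), the inverse of s because x^(q^n) = x on F. *)
have [r rE] := frobenius_power pF (e * n.-1).
have {}sE x : s x = x ^+ q by rewrite sE0 hq.
have srK : cancel s r.
  by move=> x; rewrite rE sE -exprM expnM -hq -expnS prednK // -hF expf_card.
have rsK : cancel r s.
  by move=> x; rewrite rE sE -exprM expnM -hq -expnSr prednK // -hF expf_card.
have sn x : iter n s x = x by rewrite (iter_frob sE) -hF expf_card.
have [K [iota fixK]] := fixed_fieldP s.
have sK c : s (iota c) = iota c by apply/fixK; exists c.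
have rK c : r (iota c) = iota c by rewrite -{1}(sK c) srK.
have cK : #|K| = q.
  rewrite -(card_fixed_points q1 hn sE hF) -(card_imset _ (fmorph_inj iota)).
  apply: eq_card => x; rewrite inE; apply/imsetP/eqP => [[c _ ->] //|/fixK[c ->]].
  by exists c.
have [E [j [xi [pxi PhiE]]]] := hPhi.
have pE : p \in [pchar E] by rewrite (fmorph_pchar j).
have PhiEi i : j Phi`_i = (cyclotomic xi d)`_i by rewrite -PhiE coef_map.
have Phi_fix i : s Phi`_i = Phi`_i.
  rewrite sE hq; elim: (e) => [//|l IH]; rewrite expnS exprM.
  rewrite (_ : Phi`_i ^+ p = Phi`_i) //.
  by apply: (fmorph_inj j); rewrite rmorphXn /= PhiEi (cyclotomic_frobenius pxi).
have sPhi : size Phi = (totient d).+1 by rewrite -(size_map_poly j) PhiE size_cyclotomic.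
have mPhi : Phi \is monic by rewrite -(map_monic j) PhiE cyclotomic_monic.
have /choice[c0 hc0] : forall i, exists c, Phi`_i = iota c by move=> i; apply/fixK.
pose PK := \poly_(i < (totient d).+1) c0 i.
have PKE : map_poly iota PK = Phi.
  apply/polyP => i; rewrite coef_map coef_poly; case: ltnP => ci /=; first by rewrite -hc0.
  by rewrite rmorph0 nth_default // sPhi.
have sPK : size PK = (totient d).+1 by rewrite -(size_map_poly iota) PKE.
have mPK : PK \is monic by rewrite -(map_monic iota) PKE.
have PKdvd : PK %| 'X^k - 1.
  rewrite -(dvdp_map iota) -(dvdp_map j) PKE PhiE !rmorphB /= !map_polyXn !rmorph1.
  exact: cyclotomic_dvdp_Xn_sub_1.
pose G := ('X^k - 1) %/ PK.
have PG : PK * G = 'X^k - 1 by rewrite mulrC divpK.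
have n2E : (2%:R : E) != 0 by apply: char_neq0_odd pE hpodd.
have n2K : (2%:R : K) != 0.
  by rewrite -(fmorph_eq0 iota) rmorph_nat; apply: char_neq0_odd pF hpodd.
have d1 : (1 < d)%N by apply: ltn_trans hd.
have recip i := cyclotomic_reciprocal pxi i n2E d1.
have PK0 : PK`_0 = 1.
  apply: (fmorph_inj iota); rewrite -coef_map PKE rmorph1.
  by apply: (fmorph_inj j); rewrite PhiEi (recip 0%N).1 rmorph1.
have PKr i : (i <= totient d)%N -> PK`_(totient d - i) = PK`_i.
  move=> ci; apply: (fmorph_inj iota); rewrite -!coef_map PKE.
  by apply: (fmorph_inj j); rewrite !PhiEi (recip i).2.
have mG : G \is monic by rewrite -(monicMl _ mPK) PG monic_Xn_sub_1.
have sG : size G = (2 * a).+1.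
  have := size_mul (monic_neq0 mPK) (monic_neq0 mG).
  by rewrite PG size_Xn_sub_1 // sPK addSn /= -ha -addnS => /addnI.
have G0 : G`_0 = -1.
  have := congr1 (fun P : {poly K} => P`_0) PG; rewrite coef0M PK0 mul1r => ->.
  by rewrite coefB coefXn coef1 eq_sym (gtn_eqF hk) sub0r.
have Precip : reciprocal_act iota s r PK (totient d).
  move=> v; rewrite /act iter_sum sPK (reindex_inj rev_ord_inj); apply: eq_bigr => i _ /=.
  have ci : (i <= totient d)%N by rewrite -ltnS.
  rewrite subSS PKr // iter_mul (iter_fixed _ (sK _)); congr (_ * _).
  by rewrite -[v in LHS](iter_rs rsK i) -iterD subnK.
have [m nE] : exists m, n = (k * (2 * m))%N.
  by have /dvdnP[m ->] := hkn; exists m; ring.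
have m0 : (0 < m)%N by move: hn; rewrite nE; case: (m) => //; rewrite !muln0.
split=> //.
have sK' : forall x, s x = x ^+ #|K| by rewrite cK.
have fix' x : s x = x -> exists c, x = iota c by move/fixK.
have oK : odd #|K| by rewrite cK hq oddX hpodd orbT.
have cF' : #|F| = (#|K| ^ n)%N by rewrite cK.
have := @affine_point_count K F iota s r sK rK srK rsK sK' fix' n k m (a) (totient d)
  nE m0 a0 ha sn cF' PK G PG sPK mG sG G0 Precip n2K oK.
rewrite cK => <-; congr (_ + _)%N.
rewrite -sum1_card big_mkcond /=; apply: eq_bigr => z _; rewrite inE.
suff -> : (curve_rhs q k n a Phi).[z.1] =
    z.1 * \sum_(j0 < m) iter (a + k * j0) s (act iota s PK z.1) by case: (_ == _).
rewrite /curve_rhs hornerM hornerX horner_sum nE [(2 * k)%N]mulnC mulnA.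
rewrite mulKn ?muln_gt0 ?hk //; congr (_ * _); apply: eq_bigr => l _.
rewrite horner_exp (iter_frob sE); congr (_ ^+ _).
rewrite /q_associate horner_sum /act sPK sPhi; apply: eq_bigr => i _.
by rewrite hornerZ hornerXn (iter_frob sE) -coef_map PKE.
Qed.

(** * The coordinate ring of the affine curve *)

Section FractionPolynomials.
Variable R : idomainType.
Local Notation tofrac := (@FracField.tofrac R).

Lemma fraction_quotient (z : {fraction R}) :
  exists a b, b != 0 /\ z = tofrac a / tofrac b.
Proof.
elim/quotW: z => -[[n d] /= d0]; exists n, d; split=> //.
have tn0 : tofrac d != 0 by rewrite tofrac_eq0.
apply: (mulIf tn0); rewrite divfK //; unlock FracField.tofrac.
rewrite -[LHS]FracField.pi_mul; apply/eqmodP; rewrite /= FracField.equivfE.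
by rewrite /FracField.mulf !numden_Ratio ?mulf_neq0 ?oner_neq0 //= !mulr1 mulrC.
Qed.

Lemma clear_denominators (P : {poly {fraction R}}) :
  exists c (Q : {poly R}), [/\ c != 0, size Q = size P & tofrac c *: P = map_poly tofrac Q].
Proof.
elim/poly_ind: P => [|P z [c [Q [c0 sQ E]]]].
  by exists 1, 0; rewrite oner_neq0 scaler0 rmorph0 !size_poly0.
have [a [b [b0 zE]]] := fraction_quotient z.
have t0 : tofrac b != 0 by rewrite tofrac_eq0.
have tI : injective tofrac by move=> x y /eqP; rewrite tofrac_eq => /eqP.
exists (c * b), (b%:P * Q * 'X + (c * a)%:P).
have ME : tofrac (c * b) *: (P * 'X + z%:P)
    = map_poly tofrac (b%:P * Q * 'X + (c * a)%:P).
  have -> : map_poly tofrac (b%:P * Q * 'X + (c * a)%:P)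
      = (tofrac b)%:P * map_poly tofrac Q * 'X + (tofrac (c * a))%:P.
    by rewrite rmorphD /= rmorphM /= rmorphM /= map_polyX !map_polyC.
  rewrite -E -!mul_polyC mulrDr.
  congr (_ + _).
    by rewrite tofracM !mulrA; congr (_ * _ * _); rewrite -polyCM [tofrac b * _]mulrC.
  by rewrite -!polyCM zE !tofracM mulrACA divff // mulr1.
split; rewrite ?mulf_neq0 //.
rewrite -(size_map_inj_poly tI (rmorph0 _)) -ME size_scale //.
by rewrite tofrac_eq0 mulf_neq0.
Qed.

End FractionPolynomials.

Section WeightedReduction.
Variables (F : fieldType) (q c : nat) (f : {poly F}).
Hypotheses (q1 : (1 < q)%N) (c0 : (0 < c)%N).
Local Notation D := (q * c).+1.
Hypotheses (sf : size f = D.+1) (mf : f \is monic).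
Implicit Types P Q A B : {poly {poly F}}.

Definition as_poly : {poly {poly F}} := 'X^q - 'X - f%:P.

(* x^i y^j has pole order q i + D j at infinity; theta substitutes t^q for x and
   t^D for y, so that for deg_y P < q no two monomials of P get the same degree. *)
Definition theta (P : {poly {poly F}}) : {poly F} :=
  (map_poly (comp_poly 'X^q) P).['X^D].

Lemma theta_zmod : zmod_morphism theta.
Proof. by move=> P Q; rewrite /theta rmorphB hornerD hornerN. Qed.

Lemma theta_monoid : monoid_morphism theta.
Proof. by split=> [|P Q]; rewrite /theta ?rmorph1 ?hornerC // rmorphM hornerM. Qed.

Lemma thetaB P Q : theta (P - Q) = theta P - theta Q.
Proof. exact: theta_zmod. Qed.

Lemma thetaM P Q : theta (P * Q) = theta P * theta Q.
Proof. exact: theta_monoid.2. Qed.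

HB.instance Definition _ := GRing.isZmodMorphism.Build _ _ theta theta_zmod.
HB.instance Definition _ := GRing.isMonoidMorphism.Build _ _ theta theta_monoid.

(** A bound on the weight of each monomial separately, whereas the degree of [theta P] may drop by
    cancellation when deg_y P >= q. *)
Definition wle P (n : nat) := forall i j, P`_j`_i != 0 -> (q * i + D * j <= n)%N.

Lemma thetaE P : theta P = \sum_(j < size P) (P`_j \Po 'X^q) * 'X^(D * j).
Proof.
rewrite /theta horner_coef size_map_inj_poly ?comp_poly0 //.
  by apply: eq_bigr => j _; rewrite coef_map /= -exprM.
move=> u v /eqP; rewrite -subr_eq0 -comp_polyB comp_poly_eq0 ?subr_eq0 => [/eqP //|].
by rewrite size_polyXn ltnS (ltnW q1).
Qed.

Lemma theta_polyC p : theta p%:P = p \Po 'X^q.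
Proof. by rewrite /theta map_polyC hornerC. Qed.

Lemma theta_polyX : theta 'X = 'X^D.
Proof. by rewrite /theta map_polyX hornerX. Qed.

Lemma wleW P n m : (n <= m)%N -> wle P n -> wle P m.
Proof. by move=> nm wP i j /wP h; apply: leq_trans h nm. Qed.

Lemma wleD P Q n : wle P n -> wle Q n -> wle (P + Q) n.
Proof.
move=> wP wQ i j; rewrite !coefD => nz.
have [Pz|/wP //] := eqVneq P`_j`_i 0; apply: wQ.
by apply: contraNneq nz => Qz; rewrite Pz Qz addr0.
Qed.

Lemma wleN P n : wle P n -> wle (- P) n.
Proof. by move=> wP i j; rewrite !coefN oppr_eq0; apply: wP. Qed.

Lemma wleM P Q n m : wle P n -> wle Q m -> wle (P * Q) (n + m).
Proof.
move=> wP wQ i j; rewrite coefM coef_sum => nz.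
have [k] : exists k : 'I_j.+1, (P`_k * Q`_(j - k))`_i != 0.
  apply/existsP; apply: contraNT nz => /existsPn z; apply/eqP.
  by rewrite big1 // => k _; apply/eqP; have := z k; rewrite negbK.
rewrite coefM => nz'.
have [l] : exists l : 'I_i.+1, P`_k`_l * Q`_(j - k)`_(i - l) != 0.
  apply/existsP; apply: contraNT nz' => /existsPn z; apply/eqP.
  by rewrite big1 // => l _; apply/eqP; have := z l; rewrite negbK.
rewrite mulf_eq0 negb_or => /andP[/wP h1 /wQ h2].
have := leq_add h1 h2; congr (_ <= _)%N.
have lk : (k <= j)%N by rewrite -ltnS.
have li : (l <= i)%N by rewrite -ltnS.
by rewrite addnACA -!mulnDr !subnKC.
Qed.

Lemma size_theta_wle P n : wle P n -> (size (theta P) <= n.+1)%N.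
Proof.
move=> wP; rewrite thetaE (leq_trans (size_sum _ _ _)) //.
apply/bigmax_leqP => j _; apply/leq_sizeP => m mn.
rewrite coefMXn; case: ltnP => // Dm; rewrite coef_comp_poly_Xn ?(ltnW q1) //.
case: ifP => // /dvdnP[i E]; rewrite E mulnK ?(ltnW q1) //.
apply/eqP; apply: contraTT mn => /wP; rewrite -ltnNge ltnS mulnC => h.
by apply: leq_trans h; rewrite -E subnK.
Qed.

(** Modulo q the exponent q i + D j is j, so for j < q it determines both i and j. *)
Lemma theta_coef P i j : (size P <= q)%N -> (j < q)%N ->
  (theta P)`_(q * i + D * j) = P`_j`_i.
Proof.
move=> sP jq; rewrite thetaE coef_sum.
have term (l : nat) : (l < q)%N -> ((P`_l \Po 'X^q) * 'X^(D * l))`_(q * i + D * j)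
    = if l == j then P`_j`_i else 0.
  move=> lq; rewrite coefMXn; case: eqP => [->|/eqP lj].
    rewrite ltnNge leq_addl /= addnK coef_comp_poly_Xn ?(ltnW q1) //.
    by rewrite dvdn_mulr // mulKn ?(ltnW q1).
  case: ltnP => // le; rewrite coef_comp_poly_Xn ?(ltnW q1) //.
  case: ifP => // dv; case/eqP: lj.
  have : (q * i + D * j == D * l %[mod q])%N by rewrite eqn_mod_dvd.
  have -> : (q * i + D * j = (i + c * j) * q + j)%N by ring.
  have -> : (D * l = (c * l) * q + l)%N by ring.
  by rewrite !modnMDl !modn_small // => /eqP.
have [jP|Pj] := ltnP j (size P).
  rewrite (bigD1 (Ordinal jP)) //= term // eqxx big1 ?addr0 // => l.
  by rewrite -val_eqE /= => /negPf lj; rewrite term ?lj // (leq_trans _ sP).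
rewrite big1 => [|l _]; first by rewrite [P`_j]nth_default ?coef0.
by rewrite term ?(leq_trans _ sP) // ltn_eqF // (leq_trans _ Pj).
Qed.

Lemma wle_theta P n : (size P <= q)%N -> (size (theta P) <= n.+1)%N -> wle P n.
Proof.
move=> sP st i j nz; have jq : (j < q)%N.
  apply: leq_trans sP; rewrite ltnNge; apply: contra nz => jP.
  by rewrite [P`_j]nth_default ?coef0.
rewrite -ltnS (leq_trans _ st) // ltnNge; apply: contra nz => le.
by rewrite -(theta_coef i sP jq) nth_default.
Qed.

Lemma theta_eq0 P : (size P <= q)%N -> theta P = 0 -> P = 0.
Proof.
move=> sP t0; apply/polyP => j; rewrite coef0; apply/polyP => i; rewrite coef0.
have [jq|qj] := ltnP j q; first by rewrite -(theta_coef i sP jq) t0 coef0.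
by rewrite [P`_j]nth_default ?coef0 // (leq_trans sP).
Qed.

Lemma as_poly_monic : as_poly \is monic /\ size as_poly = q.+1.
Proof.
rewrite /as_poly -addrA -opprD; set h := 'X + _.
have lt : (size (- h)%R < size ('X^q : {poly {poly F}}))%N.
  by rewrite size_polyN /h size_polyXn size_XaddC.
by rewrite monicE lead_coefDl // size_polyDl // size_polyXn lead_coefXn.
Qed.

(** The terms t^(q D) coming from Y^q and from the leading term of f cancel, so theta of [as_poly]
    has degree strictly below its weight q D. *)
Lemma size_theta_as_poly : (size (theta as_poly) <= q * D)%N.
Proof.
rewrite /as_poly !rmorphB rmorphXn /= theta_polyX theta_polyC -exprM mulnC.
have -> : f \Po 'X^q = 'X^(q * D) + ((f - 'X^D) \Po 'X^q).
  by rewrite comp_polyB rmorphXn /= comp_polyX -exprM addrC subrK.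
rewrite addrAC opprD addrA subrr sub0r -opprD size_polyN.
have sfD : (size (f - 'X^D)%R <= D)%N.
  apply/leq_sizeP => j; rewrite leq_eqVlt => /orP[/eqP <-|Dj]; rewrite coefB coefXn.
    by rewrite eqxx -(monicP mf) lead_coefE sf subrr.
  by rewrite nth_default ?sf // gtn_eqF // subrr.
rewrite (leq_trans (size_polyD _ _)) // geq_max size_polyXn; apply/andP; split.
  apply: (leq_trans (size_comp_poly_leq _ _)); rewrite size_polyXn /=.
  have : ((size (f - 'X^D)%R).-1 <= q * c)%N by rewrite -ltnS; case: size sfD.
  suff h (s : nat) : (s <= q * c)%N -> (s * q < q * D)%N by apply: h.
  move=> h; rewrite mulnC ltn_mul2l (ltnW q1) ltnS //.
by rewrite -[X in (X < _)%N]mul1n ltn_mul2r.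
Qed.

Lemma wle_polyXn l : wle 'X^l (D * l).
Proof.
move=> i j; rewrite coefXn; have [->|_] := eqVneq j l; last by rewrite coef0 eqxx.
by rewrite coef1; case: i => [|i]; rewrite ?eqxx // muln0.
Qed.

Lemma wle_polyC p : wle p%:P (q * (size p).-1).
Proof.
move=> i j; rewrite coefC; have [->|_] := eqVneq j 0%N; last by rewrite coef0 eqxx.
move=> nz; rewrite muln0 addn0 leq_mul2l; apply/orP; right.
have : (i < size p)%N by rewrite ltnNge; apply: contra nz => le; rewrite nth_default.
by case: size.
Qed.

Lemma wle_as_poly : wle as_poly (q * D).
Proof.
apply: wleD; last first.
  by apply: wleN; apply: wleW (@wle_polyC f); rewrite sf.
apply: wleD; first by rewrite mulnC; apply: (@wle_polyXn q).
apply: wleN; rewrite -['X]expr1; apply: wleW (@wle_polyXn 1).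
by rewrite muln1 -[X in (X <= _)%N]mul1n leq_mul2r (ltnW q1) orbT.
Qed.

(** Division by [as_poly] in y, with weights followed. Each subtracted multiple has weight at most n
    but theta-degree below n, so the coefficient of t^n in [theta P] survives in [theta B]. *)
Lemma reduction P n : wle P n -> exists A B,
  [/\ P = A * as_poly + B, (size B <= q)%N, wle B n & (size (theta (P - B)) <= n)%N].
Proof.
have [sz] := ubnP (size P); elim: sz P => // sz IH P sP wP.
have [Pq|qP] := leqP (size P) q.
  by exists 0, P; rewrite mul0r add0r subrr rmorph0 size_poly0.
have [mg sg] := as_poly_monic.
pose l := (size P).-1; pose u := lead_coef P.
have sPl : size P = l.+1 by rewrite prednK // (leq_trans _ qP).
have lq : (q <= l)%N by rewrite -ltnS -sPl.
pose T := u%:P * 'X^(l - q).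
have wT : wle T (n - q * D).
  move=> i j; rewrite coefCM coefXn; have [->|_] := eqVneq j (l - q)%N; last by rewrite mulr0 coef0 eqxx.
  rewrite mulr1 => nz; have := wP i l; rewrite /u lead_coefE in nz; move=> /(_ nz).
  by rewrite [(D * l)%N](_ : _ = D * (l - q) + q * D)%N; [lia|nia].
have Dn : (q * D <= n)%N.
  have un0 : P`_l`_(size u).-1 != 0.
    by rewrite -[P`_l]/u -lead_coefE !lead_coef_eq0 -size_poly_eq0 sPl.
  by have := wP _ _ un0; nia.
pose P' := P - T * as_poly.
have u0 : u != 0 by rewrite lead_coef_eq0 -size_poly_eq0 sPl.
have T0 : T != 0 by rewrite mulf_neq0 ?polyC_eq0 // -size_poly_eq0 size_polyXn.
have sT : size (T * as_poly) = l.+1.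
  by rewrite size_Mmonic // sg /T mul_polyC size_scale // size_polyXn; lia.
have sP' : (size P' < size P)%N.
  rewrite sPl ltnS; apply/leq_sizeP => j; rewrite leq_eqVlt => /orP[/eqP <-|lj].
    have -> : P'`_l = u - lead_coef (T * as_poly) by rewrite coefB !lead_coefE sT.
    by rewrite lead_coef_Mmonic // /T lead_coefM lead_coefC lead_coefXn mulr1 subrr.
  by rewrite coefB !nth_default ?subrr // ?sT ?sPl.
have wP' : wle P' n.
  apply: wleD => //; apply: wleN; rewrite -(subnK Dn); apply: wleM wT wle_as_poly.
have [//|A [B [E sB wB tB]]] := IH P' _ wP'; first by apply: leq_trans sP' _.
exists (A + T), B; split=> //.
  by rewrite mulrDl addrAC -E /P' subrK.
have -> : P - B = (P' - B) + T * as_poly by rewrite /P'; ring.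
rewrite rmorphD rmorphM /= (leq_trans (size_polyD _ _)) // geq_max tB /=.
have [->|tT0] := eqVneq (theta T) 0; first by rewrite mul0r size_poly0.
have [->|g0] := eqVneq (theta as_poly) 0; first by rewrite mulr0 size_poly0.
rewrite size_mul // -subn1 (leq_trans (leq_sub2r 1 (leq_add (size_theta_wle wT)
  size_theta_as_poly))) //.
by rewrite addSn subnK // subn1.
Qed.

(** The leading term of theta P theta Q survives the reduction. This gives both the multiplicativity
    of the valuation at infinity and the irreducibility of [as_poly]. *)
Lemma reduction_product P Q A B : (size P <= q)%N -> (size Q <= q)%N -> P != 0 -> Q != 0 ->
  P * Q = A * as_poly + B -> (size B <= q)%N ->
  B != 0 /\ (size (theta B)).+1 = (size (theta P) + size (theta Q))%N.
Proof.
move=> sP sQ P0 Q0 E sB.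
have tP0 : theta P != 0 by apply: contra_neq P0; apply: theta_eq0.
have tQ0 : theta Q != 0 by apply: contra_neq Q0; apply: theta_eq0.
have [tP tQ] : (0 < size (theta P))%N /\ (0 < size (theta Q))%N by rewrite !size_poly_gt0.
have wP : wle P (size (theta P)).-1 by apply: wle_theta; rewrite ?prednK.
have wQ : wle Q (size (theta Q)).-1 by apply: wle_theta; rewrite ?prednK.
have [A' [B' [E' sB' _ tB']]] := reduction (wleM wP wQ).
have [mg sg] := as_poly_monic.
(* Remainders modulo the monic [as_poly] are unique, so the given one has the controlled weight. *)
have BB : B = B'.
  have E2 : (A - A') * as_poly = B' - B.
    by move: E; rewrite E' => E; rewrite mulrBl -[A * _](addrK B) -E; ring.
  have [/eqP|AA] := eqVneq (A - A') 0.
    rewrite subr_eq0 => /eqP AA; move: E2; rewrite AA subrr mul0r => /esym /eqP.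
    by rewrite subr_eq0 => /eqP.
  have := size_polyD B' (- B); rewrite -E2 size_Mmonic // sg size_polyN.
  have ar x b b' : (0 < x)%N -> (b <= q)%N -> (b' <= q)%N ->
    ((x + q.+1).-1 <= maxn b' b)%N -> False by lia.
  by move/(ar _ _ _ _ sB sB'); case; rewrite size_poly_gt0.
have tE : theta B = theta (P * Q) - theta (P * Q - B') by rewrite -rmorphB BB subKr.
have sPQ : size (theta (P * Q)) = (size (theta P) + size (theta Q)).-1.
  by rewrite rmorphM size_mul.
have sB1 : size (theta B) = (size (theta P) + size (theta Q)).-1.
  rewrite tE size_polyDl ?sPQ // size_polyN.
  apply: leq_ltn_trans tB' _.
  have ar x z : (0 < x)%N -> (0 < z)%N -> (x.-1 + z.-1 < (x + z).-1)%N by lia.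
  exact: ar.
split; last by rewrite sB1 prednK // addn_gt0 tP.
apply/eqP => B0; move: sB1; rewrite B0 rmorph0 size_poly0.
have ar x z : (0 < x)%N -> (0 < z)%N -> 0%N <> (x + z).-1 by lia.
exact: ar.
Qed.

(** Clearing denominators in a proper factorization gives P Q = c [as_poly] with both y-degrees
    below q, a product with remainder 0, against [reduction_product]. *)
Lemma as_poly_irreducible : irreducible_poly (map_poly (@FracField.tofrac {poly F}) as_poly).
Proof.
set tofrac := @FracField.tofrac _.
have tI : injective tofrac by move=> x y /eqP; rewrite tofrac_eq => /eqP.
have [mg sg] := as_poly_monic.
have sG : size (map_poly tofrac as_poly) = q.+1.
  by rewrite (size_map_inj_poly tI (rmorph0 _)).
have G0 : map_poly tofrac as_poly != 0 by rewrite -size_poly_eq0 sG.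
split=> [|h sh hG]; first by rewrite sG ltnS ltnW.
have h0 : h != 0 by apply: dvdpN0 hG G0.
rewrite -dvdp_size_eqp // sG; apply/negPn/negP => shq.
have [A EA] := dvdpP _ _ hG.
have A0 : A != 0 by apply: contraNneq G0 => A0; rewrite EA A0 mul0r.
have sAh : (size A + size h = q.+2)%N.
  have := congr1 (fun p : {poly _} => size p) EA; rewrite sG size_mul // => E.
  by rewrite E prednK // addn_gt0 size_poly_gt0 A0.
have sh1 : (0 < size h)%N by rewrite size_poly_gt0.
have sA1 : (0 < size A)%N by rewrite size_poly_gt0.
have [u [P [u0 sP EP]]] := clear_denominators A.
have [v [Q [v0 sQ EQ]]] := clear_denominators h.
have PQ : P * Q = (u * v)%:P * as_poly + 0.
  apply: (map_inj_poly tI (rmorph0 _)); rewrite addr0 rmorphM [RHS]rmorphM /= map_polyC -EP -EQ EA.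
  by rewrite -scalerAl -scalerAr scalerA -mul_polyC -tofracM.
have P0 : P != 0 by rewrite -size_poly_eq0 sP size_poly_eq0.
have Q0 : Q != 0 by rewrite -size_poly_eq0 sQ size_poly_eq0.
have sPq : (size P <= q)%N.
  rewrite sP; have ar x z : (x + z = q.+2)%N -> (0 < z)%N -> z != 1%N -> (x <= q)%N.
    by clear; lia.
  exact: ar sAh sh1 sh.
have sQq : (size Q <= q)%N.
  rewrite sQ; have ar x z : (x + z = q.+2)%N -> (0 < x)%N -> z != q.+1 -> (z <= q)%N.
    by clear; lia.
  exact: ar sAh sA1 shq.
have [//|] := reduction_product sPq sQq P0 Q0 PQ; first by rewrite size_poly0.
by rewrite eqxx.
Qed.

End WeightedReduction.

Section PolyFMorphism.
Variables (F : fieldType) (L : fieldExtType {fraction {poly F}}).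

Lemma polyF_zmod : zmod_morphism (polyF L).
Proof. by move=> u v; rewrite /polyF /ratpoly rmorphB scalerBl. Qed.

Lemma polyF_monoid : monoid_morphism (polyF L).
Proof.
split=> [|u v]; rewrite /polyF /ratpoly; first by rewrite rmorph1 scale1r.
by rewrite rmorphM -scalerA -scalerAl mul1r.
Qed.

HB.instance Definition _ := GRing.isZmodMorphism.Build _ _ (polyF L) polyF_zmod.
HB.instance Definition _ := GRing.isMonoidMorphism.Build _ _ (polyF L) polyF_monoid.

Lemma constF_zmod : zmod_morphism (constF L).
Proof. by move=> u v; rewrite /constF !rmorphB. Qed.

Lemma constF_monoid : monoid_morphism (constF L).
Proof. by split=> [|u v]; rewrite /constF ?rmorph1 ?rmorphM. Qed.

HB.instance Definition _ := GRing.isZmodMorphism.Build _ _ (constF L) constF_zmod.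
HB.instance Definition _ := GRing.isMonoidMorphism.Build _ _ (constF L) constF_monoid.

Implicit Types u v : {poly F}.

Lemma polyFB u v : polyF L (u - v) = polyF L u - polyF L v.
Proof. exact: polyF_zmod. Qed.

Lemma polyF0 : polyF L 0 = 0.
Proof. by rewrite -[X in polyF L X](subrr 0) polyFB subrr. Qed.

Lemma polyFD u v : polyF L (u + v) = polyF L u + polyF L v.
Proof. exact: (raddfD (polyF L : {additive _ -> _})). Qed.

Lemma polyFM u v : polyF L (u * v) = polyF L u * polyF L v.
Proof. exact: polyF_monoid.2. Qed.

Lemma polyF1 : polyF L 1 = 1.
Proof. exact: polyF_monoid.1. Qed.

Lemma polyFXn u n : polyF L (u ^+ n) = polyF L u ^+ n.
Proof. by elim: n => [|n IH]; rewrite ?polyF1 // !exprS polyFM IH. Qed.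

Lemma constF0 : constF L 0 = 0.
Proof. by rewrite /constF polyF0. Qed.

Lemma constF_eq0 (a : F) : (constF L a == 0) = (a == 0).
Proof. exact: fmorph_eq0. Qed.

Lemma polyF_eq0 u : (polyF L u == 0) = (u == 0).
Proof. by rewrite /polyF /ratpoly scaler_eq0 oner_eq0 orbF tofrac_eq0. Qed.

Lemma polyF_inj : injective (polyF L).
Proof. by move=> u v /eqP; rewrite -subr_eq0 -rmorphB polyF_eq0 subr_eq0 => /eqP. Qed.

Definition ev (y : L) (P : {poly {poly F}}) : L := (map_poly (polyF L) P).[y].

Lemma ev_zmod y : zmod_morphism (ev y).
Proof. by move=> P Q; rewrite /ev rmorphB hornerD hornerN. Qed.

Lemma ev_monoid y : monoid_morphism (ev y).
Proof. by split=> [|P Q]; rewrite /ev ?rmorph1 ?hornerC // rmorphM hornerM. Qed.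

HB.instance Definition _ y := GRing.isZmodMorphism.Build _ _ (ev y) (ev_zmod y).
HB.instance Definition _ y := GRing.isMonoidMorphism.Build _ _ (ev y) (ev_monoid y).

Implicit Types P Q : {poly {poly F}}.

Lemma evD y P Q : ev y (P + Q) = ev y P + ev y Q.
Proof. exact: (raddfD (ev y : {additive _ -> _})). Qed.

Lemma evB y P Q : ev y (P - Q) = ev y P - ev y Q.
Proof. exact: (raddfB (ev y : {additive _ -> _})). Qed.

Lemma evM y P Q : ev y (P * Q) = ev y P * ev y Q.
Proof. exact: (rmorphM (ev y : {rmorphism _ -> _})). Qed.

Lemma ev1 y : ev y 1 = 1.
Proof. exact: (rmorph1 (ev y : {rmorphism _ -> _})). Qed.

Lemma ev0 y : ev y 0 = 0.
Proof. exact: (raddf0 (ev y : {additive _ -> _})). Qed.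

Lemma evXn y P n : ev y (P ^+ n) = ev y P ^+ n.
Proof. by elim: n => [|n IH]; rewrite ?ev1 // !exprS evM IH. Qed.

Lemma ev_polyC y p : ev y p%:P = polyF L p.
Proof. by rewrite /ev map_polyC hornerC. Qed.

Lemma ev_polyX y : ev y 'X = y.
Proof. by rewrite /ev map_polyX hornerX. Qed.

Lemma evE y (P : {poly {poly F}}) n : (size P <= n)%N -> ev y P = \sum_(j < n) polyF L P`_j * y ^+ j.
Proof.
move=> sP; rewrite /ev (horner_coef_wide _ (n := n)); last first.
  by rewrite (size_map_inj_poly polyF_inj (rmorph0 _)).
by apply: eq_bigr => j _; rewrite coef_map.
Qed.

End PolyFMorphism.

Section FunctionField.
Variables (F : fieldType) (q c : nat) (f : {poly F}).
Hypotheses (q1 : (1 < q)%N) (c0 : (0 < c)%N).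
Local Notation D := (q * c).+1.
Hypotheses (sf : size f = D.+1) (mf : f \is monic).
Local Notation g := (as_poly q f).
Local Notation theta := (theta q c).
Variables (L : fieldExtType {fraction {poly F}}) (y : L).
Hypotheses (yE : y ^+ q - y = polyF L f) (ygen : <<1; y>>%VS = fullv).
Hypothesis (dimL : \dim {:L} = q).
Implicit Types P Q A B : {poly {poly F}}.

Lemma ev_as_poly : ev y g = 0.
Proof. by rewrite /as_poly !evB evXn ev_polyX ev_polyC yE subrr. Qed.

Lemma wle_exists P : exists n, wle q c P n.
Proof.
elim/poly_ind: P => [|P p [n wP]]; first by exists 0%N => i j; rewrite !coef0 eqxx.
exists (maxn (n + D * 1) (q * (size p).-1)); apply: wleD.
  by apply: wleW (leq_maxl _ _) _; apply: wleM wP _; apply: (@wle_polyXn F q c 1).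
by apply: wleW (leq_maxr _ _) _; apply: (@wle_polyC F q c p).
Qed.

Lemma ev_reduce P : exists2 B : {poly {poly F}}, (size B <= q)%N & ev y P = ev y B.
Proof.
have [n /(reduction q1 c0 sf mf)[A [B [-> sB _ _]]]] := wle_exists P.
by exists B => //; rewrite evD evM ev_as_poly mulr0 add0r.
Qed.

Lemma ev_surj (z : L) : exists u (B : {poly {poly F}}), [/\ u != 0, (size B <= q)%N & polyF L u * z = ev y B].
Proof.
have : z \in <<1; y>>%VS by rewrite ygen memvf.
case/Fadjoin_polyP => p /polyOver1P[p' ->] ->.
have [u [P [u0 _ E]]] := clear_denominators p'.
have [B sB EB] := ev_reduce P; exists u, B; split=> //; rewrite -EB.
rewrite /ev.
have -> : map_poly (polyF L) P = map_poly (in_alg L) (map_poly (@FracField.tofrac _) P).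
  by rewrite -map_poly_comp.
by rewrite -E linearZ /= hornerZ.
Qed.

Lemma ev_inj B : (size B <= q)%N -> ev y B = 0 -> B = 0.
Proof.
move=> sB B0; apply: contraTeq sB => Bn0; rewrite -ltnNge.
have := minPoly_dvdp (K := 1%AS) (x := y) (p := map_poly (polyF L) B).
have over : map_poly (polyF L) B \is a polyOver 1%VS.
  by apply/polyOverP => i; rewrite coef_map /= memvZ // mem1v.
move=> /(_ over); rewrite rootE -[_.[y]]/(ev y B) B0 eqxx => /(_ isT) /dvdp_leq.
rewrite map_poly_eq0_id0 ?polyF_eq0 ?lead_coef_eq0 // => /(_ Bn0).
rewrite size_minPoly (size_map_inj_poly (@polyF_inj _ L) (rmorph0 _)).
by have := dim_Fadjoin 1%AS y; rewrite dimv1 muln1 ygen dimL => <-.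
Qed.

Lemma ev_dvd P : ev y P = 0 -> exists A, P = A * g.
Proof.
have [n /(reduction q1 c0 sf mf)[A [B [-> sB _ _]]]] := wle_exists P.
rewrite evD evM ev_as_poly mulr0 add0r => /(ev_inj sB) ->.
by exists A; rewrite addr0.
Qed.

(** Every element is a quotient of values of [ev]. The first two hypotheses make the difference of
    values independent of the quotient chosen, so a valuation given on representatives extends to
    L. *)
Lemma place_of_valuation (v : {poly {poly F}} -> int) :
  (forall P Q, ev y P = ev y Q -> v P = v Q) ->
  (forall P Q, ev y P != 0 -> ev y Q != 0 -> v (P * Q) = v P + v Q) ->
  (forall P Q, ev y P != 0 -> ev y Q != 0 -> ev y (P + Q) != 0 ->
     Order.min (v P) (v Q) <= v (P + Q)) ->
  (forall a : F, a != 0 -> v a%:P%:P = 0) ->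
  (exists P Q, [/\ ev y P != 0, ev y Q != 0 & v P - v Q = 1]) ->
  exists p : place L, forall P, ev y P != 0 -> p (ev y P) = v P.
Proof.
move=> vE vM vD vC [P1 [Q1 [P10 Q10 v1]]].
have /choice[nd hnd] : forall z : L, exists AB : {poly {poly F}} * {poly {poly F}},
    z != 0 -> [/\ ev y AB.1 != 0, ev y AB.2 != 0 & ev y AB.2 * z = ev y AB.1].
  move=> z; have [u [B [u0 sB E]]] := ev_surj z; exists (B, u%:P) => z0 /=.
  by rewrite -E ev_polyC mulf_neq0 ?polyF_eq0.
pose V z := if z == 0 then 0 else v (nd z).1 - v (nd z).2.
have VE A B z : z != 0 -> ev y A != 0 -> ev y B != 0 -> ev y B * z = ev y A -> V z = v A - v B.
  move=> z0 A0 B0 E; have [n0 d0 E'] := hnd z z0; rewrite /V (negPf z0).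
  have : v ((nd z).1 * B) = v (A * (nd z).2).
    by apply: vE; rewrite !evM -E' -E mulrC mulrCA mulrC.
  rewrite !vM // => h.
  have ii (i1 i2 i3 i4 : int) : i1 + i2 = i3 + i4 -> i1 - i4 = i3 - i2 by clear; lia.
  exact: ii.
have V0 : V 0 = 0 by rewrite /V eqxx.
have VM (z w : L) : z != 0 -> w != 0 -> V (z * w) = V z + V w.
  move=> z0 w0; have [n0 d0 E] := hnd z z0; have [n0' d0' E'] := hnd w w0.
  rewrite (VE ((nd z).1 * (nd w).1) ((nd z).2 * (nd w).2)) ?evM ?mulf_neq0 //.
    rewrite !vM // (VE _ _ z _ _ _ E) // (VE _ _ w _ _ _ E') //.
    by rewrite opprD addrACA.
  by rewrite -E -E' mulrACA.
have VD (z w : L) : z != 0 -> w != 0 -> z + w != 0 -> Order.min (V z) (V w) <= V (z + w).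
  move=> z0 w0 zw0; have [n0 d0 E] := hnd z z0; have [n0' d0' E'] := hnd w w0.
  have E2 : ev y ((nd z).2 * (nd w).2) * (z + w)
      = ev y ((nd z).1 * (nd w).2 + (nd w).1 * (nd z).2).
    rewrite evD !evM -E -E' mulrDr; congr (_ + _); first by rewrite mulrAC.
    by rewrite [ev y (nd z).2 * _]mulrC mulrAC.
  have d2 : ev y ((nd z).2 * (nd w).2) != 0 by rewrite evM mulf_neq0.
  have n2 : ev y ((nd z).1 * (nd w).2 + (nd w).1 * (nd z).2) != 0.
    by rewrite -E2 mulf_neq0.
  rewrite (VE _ _ _ zw0 n2 d2 E2) (VE _ _ z _ _ _ E) // (VE _ _ w _ _ _ E') //.
  have a1 : ev y ((nd z).1 * (nd w).2) != 0 by rewrite evM mulf_neq0.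
  have a2 : ev y ((nd w).1 * (nd z).2) != 0 by rewrite evM mulf_neq0.
  have := vD _ _ a1 a2 n2; rewrite !vM //.
  move: (v (nd z).1) (v (nd z).2) (v (nd w).1) (v (nd w).2) (v (_ + _)); clear.
  by move=> i1 i2 i3 i4 i5; rewrite !ge_min => /orP[h|h]; apply/orP; [left|right]; lia.
have VC a : V (constF L a) = 0.
  have [->|a0] := eqVneq a 0; first by rewrite rmorph0 V0.
  have ca0 : constF L a != 0 by rewrite fmorph_eq0.
  rewrite (VE a%:P%:P 1) ?ev1 ?oner_neq0 ?ev_polyC ?mul1r //.
  by rewrite vC // (vC 1) ?oner_neq0 // subr0.
have V1 : exists t : L, t != 0 /\ V t = 1.
  exists (ev y P1 / ev y Q1); rewrite mulf_neq0 ?invr_eq0 //; split=> //.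
  by rewrite (VE P1 Q1) ?mulf_neq0 ?invr_eq0 // mulrC divfK.
exists (Place V0 VM VD VC V1) => P P0 /=.
by rewrite (VE P 1) ?ev1 ?oner_neq0 ?mul1r // (vC 1) ?oner_neq0 // subr0.
Qed.

End FunctionField.

(** * Places *)

Section Places.
Variables (F : fieldType) (L : fieldExtType {fraction {poly F}}).
Implicit Types (p : place L) (u v w z : L).

Lemma place_ext p1 p2 : (forall z, z != 0 -> p1 z = p2 z) -> p1 = p2.
Proof.
case: p1 p2 => [v1 a1 b1 c1 d1 e1] [v2 a2 b2 c2 d2 e2] /= h.
have E : v1 = v2.
  by apply/funext => z; have [->|/h //] := eqVneq z 0; rewrite a1 a2.
by move: a1 b1 c1 d1 e1; rewrite E => *; congr Place; apply: Prop_irrelevance.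
Qed.

Lemma place1 p : p 1 = 0.
Proof. by rewrite -(rmorph1 (constF L)) place_valC. Qed.

Lemma placeN p u : p (- u) = p u.
Proof.
have [->|u0] := eqVneq u 0; first by rewrite oppr0.
have m0 : (-1 : L) != 0 by rewrite oppr_eq0 oner_neq0.
by rewrite -mulN1r place_valM // -(rmorphN1 (constF L)) place_valC add0r.
Qed.

Lemma placeV p u : u != 0 -> p u^-1 = - p u.
Proof.
move=> u0; apply/eqP; rewrite -addr_eq0 -place_valM ?invr_eq0 // mulVf //.
by rewrite place1.
Qed.

Lemma placeXn p u n : u != 0 -> p (u ^+ n) = p u * n%:Z.
Proof.
move=> u0; elim: n => [|n IH]; first by rewrite place1 mulr0.
by rewrite exprS place_valM ?expf_neq0 // IH -addn1 PoszD mulrDr mulr1 addrC.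
Qed.

(** The premise stands for the value +oo at 0, so that the condition defines a subspace. *)
Definition pge p (n : int) u : Prop := u != 0 -> n <= p u.

Lemma pge0 p n : pge p n 0.
Proof. by rewrite /pge eqxx. Qed.

Lemma pgeD p n u v : pge p n u -> pge p n v -> pge p n (u + v).
Proof.
move=> hu hv uv0; have [u0|u0] := eqVneq u 0.
  by move: uv0; rewrite u0 add0r; apply: hv.
have [v0|v0] := eqVneq v 0; first by move: uv0; rewrite v0 addr0; apply: hu.
by apply: le_trans (place_valD p u0 v0 uv0); rewrite le_min hu ?hv.
Qed.

Lemma pgeN p n u : pge p n u -> pge p n (- u).
Proof. by move=> hu; rewrite /pge oppr_eq0 placeN; apply: hu. Qed.

Lemma pgeB p n u v : pge p n u -> pge p n v -> pge p n (u - v).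
Proof. by move=> hu hv; apply: pgeD => //; apply: pgeN. Qed.

Lemma pge_sum p n (I : Type) (r : seq I) (P : pred I) (E : I -> L) :
  (forall i, P i -> pge p n (E i)) -> pge p n (\sum_(i <- r | P i) E i).
Proof. by apply: (big_ind (pge p n)) => [|u v]; [apply: pge0|apply: pgeD]. Qed.

Lemma pgeM p n m u v : pge p n u -> pge p m v -> pge p (n + m) (u * v).
Proof.
move=> hu hv; rewrite /pge mulf_eq0 negb_or => /andP[u0 v0].
by rewrite place_valM // lerD ?hu ?hv.
Qed.

Lemma pgeW p n m u : m <= n -> pge p n u -> pge p m u.
Proof. by move=> mn hu u0; apply: le_trans mn (hu u0). Qed.

Lemma pgeZ p n a u : pge p n u -> pge p n (constF L a * u).
Proof.
by move=> hu; rewrite -[n]add0r; apply: pgeM => // _; rewrite place_valC.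
Qed.

Lemma pgeXn p u n : pge p 0 u -> pge p 0 (u ^+ n).
Proof.
move=> hu; elim: n => [|n IH]; first by rewrite expr0 /pge place1.
by rewrite exprS -[0]addr0; apply: pgeM.
Qed.

Lemma place_add_lt p u v : u != 0 -> pge p (p u + 1) v -> u + v != 0 /\ p (u + v) = p u.
Proof.
move=> u0 hv; have [->|v0] := eqVneq v 0; first by rewrite addr0.
have lt : p u < p v by have := hv v0; lia.
have uv0 : u + v != 0.
  apply: contraTneq lt => /eqP; rewrite addr_eq0 => /eqP ->.
  by rewrite placeN ltxx.
split=> //; apply/eqP; rewrite eq_le; apply/andP; split; last first.
  by have := place_valD p u0 v0 uv0; rewrite ge_min; lia.
have uE : u = (u + v) - v by rewrite addrK.
have := @place_valD _ _ p (u + v) (- v) uv0; rewrite oppr_eq0 addrK => /(_ v0 u0).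
by rewrite placeN ge_min; lia.
Qed.

Lemma place_sum_distinct p (I : finType) (u : I -> L) i0 : u i0 != 0 ->
  (forall i j, u i != 0 -> u j != 0 -> p (u i) = p (u j) -> i = j) ->
  exists i, [/\ u i != 0, \sum_i u i != 0, p (\sum_i u i) = p (u i) &
    forall j, u j != 0 -> p (u i) <= p (u j)].
Proof.
move=> u0 inj; case: (@arg_minP _ _ I i0 (fun i => u i != 0) (fun i => p (u i)) u0) => i ui mini.
exists i; rewrite (bigD1 i) //=.
have [|S0 SE] := @place_add_lt p (u i) (\sum_(j | j != i) u j) ui; last by split.
apply: pge_sum => j ji uj; have := mini j uj; rewrite le_eqVlt => /orP[/eqP E|]; last by lia.
by case/eqP: ji; apply: inj.
Qed.

End Places.

Section FinitePlaces.
Variables (F : finFieldType) (L : fieldExtType {fraction {poly F}}).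

Lemma subsp_pge (p : place L) n : subsp (constF L) (pge p n).
Proof. by split=> [|u v|a u]; [apply: pge0|apply: pgeD|apply: pgeZ]. Qed.

End FinitePlaces.

Section PlaceAtInfinity.
Variables (F : fieldType) (q c : nat) (f : {poly F}).
Hypotheses (q1 : (1 < q)%N) (c0 : (0 < c)%N).
Local Notation D := (q * c).+1.
Hypotheses (sf : size f = D.+1) (mf : f \is monic).
Local Notation g := (as_poly q f).
Local Notation theta := (theta q c).
Variables (L : fieldExtType {fraction {poly F}}) (y : L).
Hypotheses (yE : y ^+ q - y = polyF L f) (ygen : <<1; y>>%VS = fullv).
Hypothesis (dimL : \dim {:L} = q).
Implicit Types P Q A B : {poly {poly F}}.
Local Notation x := (xF L).
Local Notation ev := (ev y).

Lemma ev_inj2 B B' : (size B <= q)%N -> (size B' <= q)%N -> ev B = ev B' -> B = B'.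
Proof.
move=> sB sB' /eqP; rewrite -subr_eq0 -evB => /eqP /(ev_inj ygen dimL) E.
apply/eqP; rewrite -subr_eq0 E // (leq_trans (size_polyD _ _)) //.
by rewrite size_polyN geq_max sB sB'.
Qed.

Lemma theta_constC (a : F) : theta a%:P%:P = a%:P.
Proof. by rewrite theta_polyC comp_polyC. Qed.

(** The valuation is minus the degree of theta of the reduced representative, multiplicative by
    [reduction_product]. *)
Lemma place_infinity_exists : exists p : place L,
  forall B, (size B <= q)%N -> B != 0 -> p (ev B) = 1 - (size (theta B))%:Z.
Proof.
have /choice[red hred] : forall P, exists B, (size B <= q)%N /\ ev P = ev B.
  by move=> P; have [B sB E] := ev_reduce q1 c0 sf mf yE P; exists B.
have redE P B : (size B <= q)%N -> ev P = ev B -> red P = B.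
  by move=> sB E; apply: ev_inj2; rewrite ?(hred P).1 // -(hred P).2.
pose v P : int := 1 - (size (theta (red P)))%:Z.
have red0 P : ev P != 0 -> red P != 0.
  by apply: contra_neq => r0; rewrite (hred P).2 r0 ev0.
have [] := @place_of_valuation F q c f q1 c0 sf mf L y yE ygen v.
- by move=> P Q E; rewrite /v (redE P (red Q)) ?(hred Q).1 // E (hred Q).2.
- move=> P Q P0 Q0; have := (hred (P * Q)).2; rewrite evM (hred P).2 (hred Q).2 -evM.
  move/eqP; rewrite -subr_eq0 -evB => /eqP /(ev_dvd q1 c0 sf mf yE ygen dimL)[A /eqP].
  rewrite subr_eq => /eqP E.
  have [_ sE] := reduction_product q1 c0 sf mf (hred P).1 (hred Q).1 (red0 _ P0) (red0 _ Q0)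
    E (hred (P * Q)).1.
  rewrite /v; move: (size _) (size _) (size _) sE; clear; lia.
- move=> P Q P0 Q0 PQ0; have -> : v (P + Q) = 1 - (size (theta (red P) + theta (red Q)))%:Z.
    rewrite -(raddfD (theta : {additive _ -> _})) /v (redE (P + Q) (red P + red Q)) //.
      by rewrite (leq_trans (size_polyD _ _)) // geq_max (hred P).1 (hred Q).1.
    by rewrite !evD -(hred P).2 -(hred Q).2.
  rewrite /v; have := size_polyD (theta (red P)) (theta (red Q)).
  move: (size (theta (red P) + theta (red Q))%R) (size (theta (red P))) (size (theta (red Q))); clear.
  by move=> n1 n2 n3; rewrite ge_min leq_max => /orP[h|h]; apply/orP; [left|right]; lia.
- move=> a a0; rewrite /v (redE _ a%:P%:P) // ?theta_constC ?size_polyC ?a0 //.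
  by rewrite (leq_trans (leq_b1 _)) // ltnW.
- have xq : (size ('X%:P : {poly {poly F}}) <= q)%N.
    by rewrite size_polyC (leq_trans (leq_b1 _)) // ltnW.
  (* The quotient x^c / y has order - q c + D = 1. *)
  exists ('X^c)%:P, 'X.
  have E1 : red ('X^c)%:P = ('X^c)%:P.
    by apply: redE => //; rewrite size_polyC (leq_trans (leq_b1 _)) // ltnW.
  have E2 : red 'X = 'X by apply: redE; rewrite ?size_polyX.
  have n1 : ev ('X^c)%:P != 0 by rewrite ev_polyC polyF_eq0 -size_poly_eq0 size_polyXn.
  have n2 : ev 'X != 0.
    apply/eqP => /(ev_inj ygen dimL); rewrite size_polyX => /(_ q1) /eqP.
    by rewrite polyX_eq0.
  split=> //; rewrite /v E1 E2 theta_polyC theta_polyX comp_Xn_poly -exprM.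
  by rewrite !size_polyXn; clear; lia.
move=> p hp; exists p => B sB B0.
rewrite hp; last by apply: contra_neq B0 => /(ev_inj ygen dimL); apply.
by rewrite /v (redE B B).
Qed.

End PlaceAtInfinity.

Section PolyFValues.
Variables (F : fieldType) (L : fieldExtType {fraction {poly F}}).
Local Notation x := (xF L).
Implicit Types (p : place L) (u : {poly F}).

Lemma xF_neq0 : x != 0.
Proof. by rewrite polyF_eq0 polyX_eq0. Qed.

Lemma polyFE n u : (size u <= n)%N -> polyF L u = \sum_(i < n) constF L u`_i * x ^+ i.
Proof.
move=> su; have {1}-> : u = \poly_(i < n) u`_i.
  apply/polyP => i; rewrite coef_poly; case: ltnP => // ni.
  by rewrite nth_default // (leq_trans su).
rewrite poly_def (big_morph (polyF L) (polyFD L) (polyF0 L)).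
by apply: eq_bigr => i _; rewrite -mul_polyC polyFM polyFXn.
Qed.

Lemma place_polyF_pole p u : p x < 0 -> u != 0 ->
  p (polyF L u) = p x * (size u).-1%:Z.
Proof.
move=> px u0; pose n := (size u).-1.
have su : (size u <= n.+1)%N by rewrite /n prednK // size_poly_gt0.
rewrite (polyFE su) big_ord_recr /= addrC -/n.
have un : u`_n != 0 by rewrite /n -lead_coefE lead_coef_eq0.
have xn : x ^+ n != 0 by rewrite expf_neq0 ?xF_neq0.
have t0 : constF L u`_n * x ^+ n != 0 by rewrite mulf_neq0 // constF_eq0.
have pt : p (constF L u`_n * x ^+ n) = p x * n%:Z.
  by rewrite place_valM ?constF_eq0 // place_valC add0r placeXn // xF_neq0.
have [|_ -> //] := @place_add_lt F L p _ (\sum_(i < n) constF L u`_i * x ^+ i) t0.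
apply: pge_sum => i _; apply: pgeZ => _; rewrite pt placeXn ?xF_neq0 //.
have := ltn_ord i; move: (p x) (i : nat) px; clear; move=> a j; nia.
Qed.

Lemma place_polyF_ge0 p u : 0 <= p x -> pge p 0 (polyF L u).
Proof.
move=> px; rewrite (polyFE (leqnn _)); apply: pge_sum => i _; apply: pgeZ.
by apply: pgeXn.
Qed.

End PolyFValues.

Section PlaceAtInfinityTheory.
Variables (F : fieldType) (q c : nat) (f : {poly F}).
Hypotheses (q1 : (1 < q)%N) (c0 : (0 < c)%N).
Local Notation D := (q * c).+1.
Hypotheses (sf : size f = D.+1) (mf : f \is monic).
Local Notation theta := (theta q c).
Variables (L : fieldExtType {fraction {poly F}}) (y : L).
Hypotheses (yE : y ^+ q - y = polyF L f) (ygen : <<1; y>>%VS = fullv).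
Hypothesis (dimL : \dim {:L} = q).
Implicit Types (P Q A B : {poly {poly F}}) (p : place L).
Local Notation x := (xF L).
Local Notation ev := (ev y).

Lemma f_neq0 : f != 0. Proof. by rewrite -size_poly_eq0 sf. Qed.

Lemma y_neq0 : y != 0.
Proof.
apply/eqP => y0; have := yE; rewrite y0 expr0n subr0.
case: (q) q1 => // n _ /= /esym /eqP; rewrite polyF_eq0.
by rewrite (negPf f_neq0).
Qed.

Lemma y_integral p : 0 <= p x -> pge p 0 y.
Proof.
move=> px _; rewrite leNgt; apply/negP => py.
have yq0 : y ^+ q != 0 by rewrite expf_neq0 ?y_neq0.
have [|_] := @place_add_lt _ _ p (y ^+ q) (- y) yq0.
  apply: pgeN => _; rewrite placeXn ?y_neq0 //.
  by move: (p y) py q1; clear; move=> a; nia.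
rewrite yE placeXn ?y_neq0 // => E.
have := @place_polyF_ge0 _ _ p f px; rewrite /pge polyF_eq0 f_neq0 E => /(_ isT).
by move: (p y) py q1; clear; move=> a; nia.
Qed.

Lemma ev_integral p P : 0 <= p x -> pge p 0 (ev P).
Proof.
move=> px; rewrite (evE y (leqnn (size P))); apply: pge_sum => i _.
rewrite -[0]addr0; apply: pgeM; first exact: place_polyF_ge0.
by apply: pgeXn; apply: y_integral.
Qed.

Lemma pole_values p : p x < 0 -> exists2 s : int, 0 < s &
  p x = - s * q%:Z /\ p y = - s * D%:Z.
Proof.
move=> px; have E0 : p (y ^+ q - y) = p x * D%:Z.
  by rewrite yE place_polyF_pole ?f_neq0 // sf.
have Dpx : p x * D%:Z < 0 by move: (p x) px; clear; move=> a; nia.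
have py : p y < 0.
  rewrite ltNge; apply/negP => py.
  have : pge p 0 (y ^+ q - y) by apply: pgeB; [apply: pgeXn|] => _.
  rewrite /pge yE polyF_eq0 f_neq0 -yE E0 => /(_ isT) h.
  by move: Dpx; rewrite ltNge h.
have yq0 : y ^+ q != 0 by rewrite expf_neq0 ?y_neq0.
have [|_] := @place_add_lt _ _ p (y ^+ q) (- y) yq0.
  apply: pgeN => _; rewrite placeXn ?y_neq0 //.
  by move: (p y) py q1; clear; move=> a; nia.
rewrite E0 placeXn ?y_neq0 // => E.
(* The equation of the curve gives q p(y) = D p(x), and D = q c + 1, so this integer times q is -
   p(x). *)
exists (p x * c%:Z - p y).
  suff : (p x * c%:Z - p y) * q%:Z = - p x.
    by move: (p x * c%:Z - p y) (p x) px; clear; move=> a b; nia.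
  by move: E; rewrite -addn1 PoszD PoszM mulrDr; move: (p x) (p y); clear; move=> a b; nia.
by move: E; rewrite -addn1 PoszD PoszM; move: (p x) (p y) q1; clear; move=> a b; nia.
Qed.

Variable pinf : place L.
Hypothesis pinfE : forall B, (size B <= q)%N -> B != 0 ->
  pinf (ev B) = 1 - (size (theta B))%:Z.

Lemma pinf_x : pinf x = - q%:Z.
Proof.
rewrite -[x]/(polyF L 'X) -(ev_polyC y) pinfE ?polyC_eq0 ?polyX_eq0 //; last first.
  by rewrite size_polyC (leq_trans (leq_b1 _)) // ltnW.
by rewrite theta_polyC comp_polyX size_polyXn; lia.
Qed.

Lemma pinf_y : pinf y = - D%:Z.
Proof.
rewrite -{1}(ev_polyX y) pinfE ?polyX_eq0 ?size_polyX // theta_polyX size_polyXn.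
by lia.
Qed.

Lemma pinf_x_lt0 : pinf x < 0.
Proof. by rewrite pinf_x; move: q1; clear; lia. Qed.

(* The monomials x^i y^j with j < q have pairwise distinct orders at a pole of
   x, so all poles of x have proportional valuations on F[x, y]. *)
Lemma pinf_unique p : p x < 0 -> p = pinf.
Proof.
move=> px; have [s s0 [pxE pyE]] := pole_values px.
have term_val (B : {poly {poly F}}) (j : nat) : B`_j != 0 ->
    (pinf (polyF L B`_j * y ^+ j) = - (q%:Z * (size B`_j).-1%:Z + D%:Z * j%:Z)) /\
    p (polyF L B`_j * y ^+ j) = s * pinf (polyF L B`_j * y ^+ j).
  move=> Bj; have B0 : polyF L B`_j != 0 by rewrite polyF_eq0.
  have yj : y ^+ j != 0 by rewrite expf_neq0 ?y_neq0.
  have tv (p' : place L) : p' x < 0 -> p' (polyF L B`_j * y ^+ j)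
      = p' x * (size B`_j).-1%:Z + p' y * j%:Z.
    by move=> px'; rewrite place_valM // place_polyF_pole // placeXn ?y_neq0.
  rewrite (tv p px) (tv pinf pinf_x_lt0) pinf_x pinf_y pxE pyE.
  by move: (size B`_j).-1 => i; split; ring.
have val B : (size B <= q)%N -> B != 0 -> p (ev B) = s * pinf (ev B).
  move=> sB B0; rewrite (evE y sB).
  pose u (j : 'I_q) := polyF L B`_j * y ^+ j.
  have u0 j : (u j != 0) = (B`_j != 0).
    by rewrite mulf_eq0 polyF_eq0 expf_eq0 (negPf y_neq0) andbF orbF.
  have distinct (i j : 'I_q) : u i != 0 -> u j != 0 -> pinf (u i) = pinf (u j) -> i = j.
    rewrite !u0 => Bi Bj; rewrite (term_val B i Bi).1 (term_val B j Bj).1.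
    move: (size B`_i).-1 (size B`_j).-1 => bi bj E; apply: val_inj.
    move: (ltn_ord i) (ltn_ord j) E => /=; move: (nat_of_ord i) (nat_of_ord j).
    move=> i' j' iq jq E; have {}E : (q * bi + D * i' = q * bj + D * j')%N.
      by move: E; clear; lia.
    have := congr1 (modn^~ q) E.
    rewrite (_ : (q * bi + D * i' = (bi + c * i') * q + i')%N); last by ring.
    rewrite (_ : (q * bj + D * j' = (bj + c * j') * q + j')%N); last by ring.
    by rewrite !modnMDl !modn_small.
  have [i0 ui0] : exists i, u i != 0.
    have sz : ((size B).-1 < q)%N by rewrite (leq_trans _ sB) // prednK // size_poly_gt0.
    by exists (Ordinal sz); rewrite u0 /= -lead_coefE lead_coef_eq0.
  have [i [ui _ pi mini]] := place_sum_distinct ui0 distinct.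
  have [|j [uj _ pj minj]] := @place_sum_distinct _ _ p _ u _ ui0.
    move=> i' j' ui' uj'; have := ui'; have := uj'; rewrite !u0 => Bj' Bi'.
    rewrite /u (term_val B i' Bi').2 (term_val B j' Bj').2.
    by move/(mulfI (lt0r_neq0 s0)); apply: distinct.
  have := minj i ui; have := mini j uj.
  rewrite -/(u _) pi pj; move: (ui) (uj); rewrite !u0 => Bi Bj.
  rewrite /u (term_val B i Bi).2 (term_val B j Bj).2.
  move=> h1 h2; congr (_ * _); apply/eqP; rewrite eq_le h1 andbT.
  by rewrite -(ler_pM2l s0).
have valL z : z != 0 -> p z = s * pinf z.
  move=> z0; have [u [B [u0 sB E]]] := ev_surj q1 c0 sf mf yE ygen z.
  have B0 : B != 0.
    by apply: contraTneq z0 => B0; move/eqP: E; rewrite B0 ev0 mulf_eq0 polyF_eq0 (negPf u0) negbK.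
  have uq : (size u%:P <= q)%N by rewrite size_polyC (leq_trans (leq_b1 _)) // ltnW.
  have up : u%:P != 0 by rewrite polyC_eq0.
  have := val _ uq up; have := val _ sB B0; rewrite -E !place_valM ?polyF_eq0 // ev_polyC.
  by move: (p _) (pinf _) (p _) (pinf _); clear; move=> *; lia.
have s1 : s = 1.
  have [t [t0 pt]] := place_val_norm p; have := valL t t0; rewrite pt.
  move: (pinf t) s0; clear; move=> a s0 E.
  have a1 : 1 <= a by nia.
  nia.
by apply: place_ext => z z0; rewrite valL // s1 mul1r.
Qed.

(** Write z = B / u; at order 0, theta B and theta u have the same degree, and subtracting the ratio
    of their leading coefficients lowers the degree. So the residue field at infinity is F. *)
Lemma pinf_residue z : pge pinf 0 z -> exists a : F, pge pinf 1 (z - constF L a).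
Proof.
have [->|z0 /(_ z0)] := eqVneq z 0.
  by exists 0; rewrite constF0 subrr; apply: pge0.
move=> pz; have [pz1|pz1] := boolP (1 <= pinf z).
  by exists 0; rewrite constF0 subr0.
have {pz1}pz : pinf z = 0 by move: (pinf z) pz pz1; clear; move=> a; lia.
have [u [B [u0 sB E]]] := ev_surj q1 c0 sf mf yE ygen z.
have B0 : B != 0.
  by apply: contraTneq z0 => B0; move/eqP: E; rewrite B0 ev0 mulf_eq0 polyF_eq0 (negPf u0) negbK.
have uq : (size u%:P <= q)%N by rewrite size_polyC (leq_trans (leq_b1 _)) // ltnW.
have up : u%:P != 0 by rewrite polyC_eq0.
have Lu0 : polyF L u != 0 by rewrite polyF_eq0.
have pu := pinfE uq up; have pB := pinfE sB B0.
have tB0 : theta B != 0 by apply: contra_neq B0; apply: theta_eq0.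
have tu0 : theta u%:P != 0 by apply: contra_neq up; apply: theta_eq0.
have sE : size (theta B) = size (theta u%:P).
  move: pB; rewrite -E place_valM // pz addr0 -(ev_polyC y) pu.
  by move: (size _) (size _); clear; lia.
pose a := lead_coef (theta B) / lead_coef (theta u%:P); exists a.
pose C := B - (a%:P%:P * u%:P).
have sC : (size C <= q)%N.
  rewrite (leq_trans (size_polyD _ _)) // geq_max sB size_polyN -polyCM size_polyC.
  by rewrite (leq_trans (leq_b1 _)) // ltnW.
have EC : ev C = polyF L u * (z - constF L a).
  by rewrite evB evM !ev_polyC -E mulrBr [polyF L u * constF L a]mulrC.
move=> w0; have C0 : C != 0.
  by apply: contraNneq w0 => C0; move/eqP: EC; rewrite C0 ev0 eq_sym mulf_eq0 (negPf Lu0).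
have := pinfE sC C0; rewrite EC place_valM // -(ev_polyC y) pu.
suff : (size (theta C) < size (theta u%:P))%N.
  by move: (pinf _) (size _) (size _); clear; move=> *; lia.
have tC : theta C = theta B - a%:P * theta u%:P.
  by rewrite /C thetaB thetaM theta_constC.
have su : size (theta u%:P) = (size (theta u%:P)).-1.+1 by rewrite prednK // size_poly_gt0.
rewrite su ltnS tC; apply/leq_sizeP => j; rewrite leq_eqVlt => /orP[/eqP <-|lt].
  rewrite coefB coefCM -lead_coefE -{1}sE -lead_coefE /a divfK ?subrr //.
  by rewrite lead_coef_eq0.
by rewrite coefB coefCM !nth_default ?mulr0 ?subrr // ?sE su.
Qed.

(** If p z were nonzero, the nonzero terms of h(z) would have distinct values, and their sum could
    not vanish. *)
Lemma algebraic_val0 (p : place L) z (h : {poly F}) : z != 0 -> h != 0 ->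
  (map_poly (constF L) h).[z] = 0 -> p z = 0.
Proof.
move=> z0 h0 hz; apply/eqP; apply: contraTT isT => pz.
pose u (i : 'I_(size h)) := constF L h`_i * z ^+ i.
have u0 i : (u i != 0) = (h`_i != 0).
  by rewrite mulf_eq0 constF_eq0 expf_eq0 (negPf z0) andbF orbF.
have pu i : u i != 0 -> p (u i) = p z * (i : nat)%:Z.
  rewrite u0 => hi; rewrite place_valM ?constF_eq0 ?expf_neq0 // place_valC add0r.
  by rewrite placeXn.
have sz : ((size h).-1 < size h)%N by rewrite prednK // size_poly_gt0.
have [||i [_ S0 _ _]] := @place_sum_distinct _ _ p _ u (Ordinal sz).
- by rewrite u0 /= -lead_coefE lead_coef_eq0.
- move=> i j ui uj; rewrite !pu // => /(mulfI pz) [] E; exact: val_inj.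
case/eqP: S0; apply: etrans hz; rewrite horner_coef size_map_poly.
by apply: eq_bigr => i' _; rewrite coef_map.
Qed.

(** z minus its residue at infinity is again algebraic over F; if nonzero it would have value 0, yet
    its value is at least 1. *)
Lemma constant_field z (h : {poly F}) : h != 0 ->
  (map_poly (constF L) h).[z] = 0 -> exists a : F, z = constF L a.
Proof.
move=> h0 hz; have [->|z0] := eqVneq z 0.
  by exists 0; rewrite constF0.
have pz := algebraic_val0 pinf z0 h0 hz.
have [|a ha] := @pinf_residue z; first by rewrite /pge pz.
exists a; apply/eqP; rewrite -subr_eq0; apply/negPn/negP => w0.
pose k := h \Po ('X + a%:P).
have k0 : k != 0 by rewrite comp_poly2_eq0 // size_XaddC.
have kz : (map_poly (constF L) k).[z - constF L a] = 0.
  rewrite map_comp_poly horner_comp rmorphD /= map_polyX map_polyC /=.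
  by rewrite hornerD hornerX hornerC subrK.
by have := ha w0; rewrite (algebraic_val0 pinf w0 k0 kz).
Qed.

End PlaceAtInfinityTheory.

(** * Places above the points of the affine curve *)

Section FinitePlace.
Variables (F : fieldType) (q c : nat) (f : {poly F}).
Hypotheses (q1 : (1 < q)%N) (c0 : (0 < c)%N).
Local Notation D := (q * c).+1.
Hypotheses (sf : size f = D.+1) (mf : f \is monic).
Variables (L : fieldExtType {fraction {poly F}}) (y : L).
Hypotheses (yE : y ^+ q - y = polyF L f) (ygen : <<1; y>>%VS = fullv).
Hypothesis (dimL : \dim {:L} = q).
Local Notation ev := (ev y).

Variables (E : finFieldType) (j : {rmorphism F -> E}) (al be : E).
Variable frob : {rmorphism {poly E} -> {poly E}}.
Hypothesis frobE : forall u, frob u = u ^+ q.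
Local Notation fE := (map_poly j f).
Hypothesis abE : be ^+ q - be = fE.[al].
Implicit Types P Q A B : {poly {poly F}}.

Local Notation pi := ('X - al%:P).
Let delta := fE - fE.[al]%:P.

(* Truncations of the power series in X - al solving Y^q - Y = f, Y(al) = be. *)
Let ys (M : nat) : {poly E} := be%:P - \sum_(i < M) delta ^+ (q ^ i).

Definition psi M P : {poly E} := (map_poly (map_poly j) P).[ys M].

Let psiB M P Q : psi M (P - Q) = psi M P - psi M Q.
Proof. by rewrite /psi rmorphB hornerD hornerN. Qed.

Let psiD M P Q : psi M (P + Q) = psi M P + psi M Q.
Proof. by rewrite /psi rmorphD hornerD. Qed.

Let psiM M P Q : psi M (P * Q) = psi M P * psi M Q.
Proof. by rewrite /psi rmorphM hornerM. Qed.

Let psi_polyC M u : psi M u%:P = map_poly j u.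
Proof. by rewrite /psi map_polyC hornerC. Qed.

Let pi_delta : pi %| delta.
Proof. by rewrite dvdp_XsubCl rootE !hornerE subrr. Qed.

Let pi_delta_exp n i : (n <= i)%N -> pi ^+ n %| delta ^+ (q ^ i).
Proof.
move=> ni; apply: (dvdp_trans (dvdp_exp2l pi _)); last exact: dvdp_exp2r.
by rewrite (leq_trans ni) // ltnW // ltn_expl.
Qed.

(** The q-th power is additive on E[X], so the sum telescopes and only the error delta^(q^M)
    remains, which pi^M divides. *)
Let ys_root M : ys M ^+ q - ys M - fE = - delta ^+ (q ^ M).
Proof.
rewrite -frobE /ys rmorphB rmorph_sum frobE -polyC_exp.
under eq_bigr => i _ do rewrite frobE -exprM -expnSr.
have T : \sum_(i < M) delta ^+ (q ^ i.+1) - \sum_(i < M) delta ^+ (q ^ i)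
    = delta ^+ (q ^ M) - delta.
  rewrite -sumrB -(big_mkord xpredT (fun i => delta ^+ (q ^ i.+1) - delta ^+ (q ^ i))).
  by rewrite telescope_sumr // expn0 expr1.
have -> : (be ^+ q)%:P = fE.[al]%:P + be%:P by rewrite -abE polyCB subrK.
have -> : \sum_(i < M) delta ^+ (q ^ i.+1)
    = delta ^+ (q ^ M) - delta + \sum_(i < M) delta ^+ (q ^ i) by rewrite -T subrK.
rewrite {2}/delta; move: (delta ^+ _) (\sum_(i < M) _) fE.[al]%:P be%:P fE.
by move=> d S e b h; ring.
Qed.

Let psi_as_poly M n : (n <= M)%N -> pi ^+ n %| psi M (as_poly q f).
Proof.
move=> nM; have -> : psi M (as_poly q f) = ys M ^+ q - ys M - fE.
  rewrite /as_poly !psiB psi_polyC; congr (_ - _ - _).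
    by rewrite /psi rmorphXn /= map_polyX hornerXn.
  by rewrite /psi map_polyX hornerX.
by rewrite ys_root dvdpNr pi_delta_exp.
Qed.

Let horner_sub_dvd (p : {poly {poly E}}) (a b : {poly E}) : a - b %| p.[a] - p.[b].
Proof.
rewrite !horner_coef -sumrB.
apply: (big_ind (fun u => a - b %| u)) => [|u v|i _]; first exact: dvdp0.
  exact: dvdp_add.
by rewrite -mulrBr subrXX mulrCA dvdp_mulr.
Qed.

Let psi_stable n M M' P : (n <= M)%N -> (M <= M')%N -> pi ^+ n %| psi M' P - psi M P.
Proof.
move=> nM MM'; apply: dvdp_trans (horner_sub_dvd _ _ _).
have -> : ys M' - ys M = - \sum_(M <= i < M') delta ^+ (q ^ i).
  rewrite /ys -(big_mkord xpredT (fun i => delta ^+ (q ^ i))).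
  rewrite -(big_mkord xpredT (fun i => delta ^+ (q ^ i))) (big_cat_nat (leq0n M) MM') /=.
  by move: (\sum_(0 <= i < M) _) (\sum_(M <= i < M') _) be%:P => S T b; ring.
rewrite dvdpNr big_nat.
apply: (big_ind (fun u => pi ^+ n %| u)) => [|u v|i /andP[Mi _]]; [exact: dvdp0|exact: dvdp_add|].
by apply: pi_delta_exp; apply: leq_trans nM Mi.
Qed.

Let psi_ev n M P Q : (n <= M)%N -> ev P = ev Q -> pi ^+ n %| psi M P - psi M Q.
Proof.
move=> nM /eqP; rewrite -subr_eq0 -evB => /eqP /(ev_dvd q1 c0 sf mf yE ygen dimL)[A EA].
by rewrite -psiB EA psiM dvdp_mull // psi_as_poly.
Qed.

(** The order of P along the branch is at least n. Truncation at level n suffices: by [psi_stable]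
    higher levels agree modulo pi^n. *)
Let O n P := pi ^+ n %| psi n P.

Let OE n M P : (n <= M)%N -> O n P = (pi ^+ n %| psi M P).
Proof. by move=> nM; rewrite /O -(subrK (psi n P) (psi M P)) dvdp_addr ?psi_stable. Qed.

Let OW n m P : (n <= m)%N -> O m P -> O n P.
Proof. by move=> nm; rewrite (OE P nm) => /(dvdp_trans _); apply; apply: dvdp_exp2l. Qed.

Let O_ev n P Q : ev P = ev Q -> O n P = O n Q.
Proof.
move=> E0; rewrite /O -(subrK (psi n Q) (psi n P)) dvdp_addr //.
exact: psi_ev.
Qed.

Let size_pi n : size (pi ^+ n) = n.+1.
Proof. by rewrite size_exp_XsubC. Qed.

(** Some multiple of P represents a nonzero polynomial u in x alone, and the order of u at al is at
    most its degree. *)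
Let O_bound P : ev P != 0 -> exists n, ~~ O n P.
Proof.
move=> P0; have [u [Q [u0 _ EQ]]] := ev_surj q1 c0 sf mf yE ygen (ev P)^-1.
have E1 : ev (P * Q) = ev u%:P by rewrite evM -EQ ev_polyC mulrCA divff ?mulr1.
exists (size u); apply: contraL (isT) => OP.
have : O (size u) (P * Q) by rewrite /O psiM dvdp_mulr.
rewrite (O_ev _ E1) /O psi_polyC => /dvdp_leq.
by rewrite map_poly_eq0 u0 size_pi size_map_poly ltnn => /(_ isT).
Qed.

Let order_exists P : ev P != 0 -> exists n, O n P && ~~ O n.+1 P.
Proof.
move=> /O_bound ex; case: (ex_minnP ex) => -[|n] nO min.
  by move: nO; rewrite /O expr0 dvd1p.
exists n; rewrite nO andbT; apply/negPn/negP => /min.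
by rewrite ltnn.
Qed.

Let order_uniq P n m : O n P -> ~~ O n.+1 P -> O m P -> ~~ O m.+1 P -> n = m.
Proof.
move=> On nOn Om nOm; case: (ltngtP n m) => // [nm|mn].
  by rewrite (OW nm Om) in nOn.
by rewrite (OW mn On) in nOm.
Qed.

Lemma finite_place_exists : exists p : place L, forall P, ev P != 0 ->
  0 <= p (ev P) /\
  ((0 < p (ev P)) = ((map_poly (fun u => (map_poly j u).[al]) P).[be] == 0)).
Proof.
have /choice[n0 hn0] : forall P, exists n, ev P != 0 -> O n P && ~~ O n.+1 P.
  move=> P; have [P0|P0] := eqVneq (ev P) 0; first by exists 0%N.
  by have [n On] := order_exists P0; exists n.
pose v P : int := if ev P == 0 then 0 else (n0 P)%:Z.
have vP P : ev P != 0 -> [/\ v P = (n0 P)%:Z, O (n0 P) P & ~~ O (n0 P).+1 P].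
  by move=> P0; have /andP[] := hn0 P P0; rewrite /v (negPf P0).
have vU P n : ev P != 0 -> O n P -> ~~ O n.+1 P -> v P = n%:Z.
  by move=> P0 On nOn; have [-> Om nOm] := vP P P0; rewrite (order_uniq On nOn Om nOm).
have nroot P n : O n P -> ~~ O n.+1 P -> forall M, (n < M)%N ->
    exists2 A, psi M P = A * pi ^+ n & ~~ root A al.
  move=> On nOn M nM; move: On; rewrite (OE P (ltnW nM)) => /dvdpP[A EA].
  exists A => //; apply: contra nOn => rA; rewrite (OE P nM) EA exprS.
  by rewrite dvdp_mul // dvdp_XsubCl.
have vconst (u : {poly F}) (n : nat) : u != 0 -> pi ^+ n %| map_poly j u ->
    ~~ (pi ^+ n.+1 %| map_poly j u) -> v u%:P = n%:Z.
  by move=> u0 d1 d2; apply: vU; rewrite ?ev_polyC ?polyF_eq0 // /O psi_polyC.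
have vC (a : F) : a != 0 -> v a%:P%:P = 0.
  move=> a0; apply: (vconst _ 0%N); rewrite ?polyC_eq0 // ?expr0 ?dvd1p //.
  by rewrite map_polyC expr1 dvdp_XsubCl rootC fmorph_eq0.
have [] := @place_of_valuation F q c f q1 c0 sf mf L y yE ygen v.
- move=> P Q EPQ; have [P0|P0] := eqVneq (ev P) 0; first by rewrite /v -EPQ P0 eqxx.
  have [-> O1 nO1] := vP P P0; apply/esym/vU; rewrite -?EPQ //.
    by rewrite -(O_ev _ EPQ).
  by rewrite -(O_ev _ EPQ).
- move=> P Q P0 Q0; have [-> OP nOP] := vP P P0; have [-> OQ nOQ] := vP Q Q0.
  pose M := (n0 P + n0 Q).+1.
  have [|A EA rA] := nroot P _ OP nOP M; first by rewrite ltnS leq_addr.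
  have [|B EB rB] := nroot Q _ OQ nOQ M; first by rewrite ltnS leq_addl.
  have EPQ : psi M (P * Q) = A * B * pi ^+ (n0 P + n0 Q).
    by rewrite psiM EA EB exprD mulrACA.
  rewrite -PoszD; apply: vU; first by rewrite evM mulf_neq0.
    by rewrite (OE _ (leqnSn _)) EPQ dvdp_mull.
  rewrite /O EPQ exprS dvdp_mul2r ?expf_neq0 ?polyXsubC_eq0 //.
  by rewrite dvdp_XsubCl rootM negb_or rA rB.
- move=> P Q P0 Q0 PQ0; have [-> OP nOP] := vP P P0; have [-> OQ nOQ] := vP Q Q0.
  have [-> OPQ nOPQ] := vP _ PQ0.
  have h : (minn (n0 P) (n0 Q) <= n0 (P + Q)%R)%N.
    rewrite leqNgt; apply: contra nOPQ => lt; apply: (OW lt).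
    rewrite (OE _ (leqnn _)) psiD dvdp_add // -OE //.
      by apply: OW OP; rewrite geq_minl.
    by apply: OW OQ; rewrite geq_minr.
  by move: h; rewrite geq_min ge_min !lez_nat.
- exact: vC.
(* An element of order 1: this polynomial has coefficients in F and a simple root at al, even when
   al is not in F. *)
- pose t : {poly F} := 'X^(#|E|) - 'X.
  have tE : map_poly j t = 'X^(#|E|) - 'X.
    by rewrite rmorphB /= map_polyXn map_polyX.
  have ta : map_poly j t = pi * \prod_(z | z != al) ('X - z%:P).
    by rewrite tE finField_genPoly (bigD1 al).
  have nr : ~~ root (\prod_(z | z != al) ('X - z%:P)) al.
    rewrite /root horner_prod; apply/prodf_neq0 => z za.
    by rewrite hornerXsubC subr_eq0 eq_sym.
  have t0 : t != 0.
    rewrite -(map_poly_eq0 j) ta mulf_neq0 ?polyXsubC_eq0 //.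
    by apply: contraNneq nr => ->; rewrite root0.
  have vt : v t%:P = 1%N%:Z.
    apply: vconst => //; rewrite ta; first by rewrite expr1 dvdp_mulr.
    by rewrite expr2 dvdp_mul2l ?polyXsubC_eq0 // dvdp_XsubCl.
  exists t%:P, 1; split; rewrite ?ev1 ?oner_neq0 ?ev_polyC ?polyF_eq0 //.
  by rewrite vt -[1]/(1%:P%:P) vC ?oner_neq0 // subr0.
move=> p hp; exists p => P P0; rewrite hp //.
have [-> OP nOP] := vP P P0; split=> //.
have -> : ((0 : int) < (n0 P)%:Z) = O 1 P.
  rewrite ltz_nat; apply/idP/idP => [n0P|O1]; first exact: OW n0P OP.
  by rewrite lt0n; apply: contraNneq nOP => ->.
rewrite /O expr1 dvdp_XsubCl rootE.
have -> : (psi 1 P).[al] = (map_poly (fun u => (map_poly j u).[al]) P).[be]; last by [].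
have ya : (ys 1).[al] = be.
  by rewrite /ys big_ord1 expn0 expr1 /delta !hornerE subrr subr0.
rewrite /psi (horner_coef_wide _ (size_poly _ _)) (horner_coef_wide _ (size_poly _ _)).
rewrite horner_sum; apply: eq_bigr => i _.
by rewrite hornerM horner_exp ya !coef_poly ltn_ord.
Qed.

End FinitePlace.

Lemma finField_root_extension (F : finFieldType) (h : {poly F}) : (1 < size h)%N ->
  exists (E : finFieldType) (j : {rmorphism F -> E}) (al : E), root (map_poly j h) al.
Proof.
move=> sh; have h0 : h != 0 by rewrite -size_poly_gt0 ltnW.
have [L [rs hrs _]] := FinSplittingFieldFor h0.
have srs : size rs = (size h).-1.
  by have := eqp_size hrs; rewrite size_map_poly size_prod_XsubC => ->.
case: rs hrs srs => [|al rs] hrs srs; first by move: sh srs => /=; case: (size h) => [|[|]].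
exists (finvect_type L), (in_alg L : {rmorphism F -> finvect_type L}), al.
by rewrite (eqp_root hrs) root_prod_XsubC mem_head.
Qed.

Lemma minimal_vanishing (F E : fieldType) (j : {rmorphism F -> E}) (al : E) (u : {poly F}) :
  u != 0 -> root (map_poly j u) al -> exists d : {poly F},
  [/\ d != 0, root (map_poly j d) al & forall v, root (map_poly j v) al -> d %| v].
Proof.
move=> u0 ru.
have ex : exists n, `[< exists d : {poly F}, [/\ d != 0, root (map_poly j d) al & size d = n] >].
  by exists (size u); apply/asboolP; exists u.
have [n /asboolP[d [d0 rd sd]] mind] := ex_minnP ex.
exists d; split=> // v rv; rewrite /dvdp; apply/negPn/negP => m0.
have rm : root (map_poly j (v %% d)) al.
  have -> : v %% d = v - v %/ d * d by rewrite {2}(divp_eq v d) addrAC subrr add0r.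
  rewrite rootE rmorphB rmorphM /= hornerD hornerN hornerM.
  by rewrite (rootP rd) (rootP rv) mulr0 subr0.
have /mind : `[< exists d' : {poly F}, [/\ d' != 0, root (map_poly j d') al
   & size d' = size (v %% d)] >] by apply/asboolP; exists (v %% d).
by rewrite leqNgt -sd ltn_modp d0.
Qed.

Section Regular.
Variables (F : finFieldType) (p e q c : nat) (f : {poly F}).
Hypotheses (pF : p \in [pchar F]) (qE : q = (p ^ e)%N).
Hypotheses (q1 : (1 < q)%N) (c0 : (0 < c)%N).
Local Notation D := (q * c).+1.
Hypotheses (sf : size f = D.+1) (mf : f \is monic).
Hypothesis card_Fq : #|[set b : F | b ^+ q == b]| = q.
Variables (L : fieldExtType {fraction {poly F}}) (y : L).
Hypotheses (yE : y ^+ q - y = polyF L f) (ygen : <<1; y>>%VS = fullv).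
Hypothesis (dimL : \dim {:L} = q).
Local Notation ev := (ev y).
Local Notation x := (xF L).

Lemma point_over (u : {poly F}) : (1 < size u)%N ->
  exists (E : finFieldType) (j : {rmorphism F -> E}) (al be : E),
    root (map_poly j u) al /\ be ^+ q - be = (map_poly j f).[al].
Proof.
move=> su; have [E1 [j1 [al1 r1]]] := finField_root_extension su.
pose h : {poly E1} := 'X^q - ('X + ((map_poly j1 f).[al1])%:P).
have sh : size h = q.+1.
  by rewrite size_polyDl ?size_polyXn // size_polyN size_XaddC.
have [E2 [j2 [be rbe]]] : exists (E : finFieldType) (j : {rmorphism E1 -> E}) (be : E),
    root (map_poly j h) be by apply: finField_root_extension; rewrite sh ltnS ltnW.
exists E2, (j2 \o j1), (j2 al1), be; rewrite !map_poly_comp; split.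
  by rewrite fmorph_root.
move: rbe; rewrite rootE /h rmorphB rmorphD /= map_polyXn map_polyX map_polyC /=.
by rewrite !hornerE horner_map opprD addrA subr_eq0 => /eqP.
Qed.

(** Induction on the degree of a denominator u of z = B / u. Over a root al of u lie the q points
    (al, be + b), b in F_q; z is regular and u vanishes there, so B(al, Y), of degree below q, has q
    roots and is 0. Then the minimal polynomial of al divides both u and the coefficients of B. *)
Lemma regular_at_finite_places (z : L) :
  (forall pl : place L, 0 <= pl x -> pge pl 0 z) ->
  exists B : {poly {poly F}}, (size B <= q)%N /\ z = ev B.
Proof.
move=> reg.
suff clear n (u : {poly F}) (B : {poly {poly F}}) : (size u <= n)%N -> u != 0 -> (size B <= q)%N ->
    polyF L u * z = ev B -> exists B : {poly {poly F}}, (size B <= q)%N /\ z = ev B.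
  have [u [B [u0 sB EB]]] := ev_surj q1 c0 sf mf yE ygen z.
  exact: clear (leqnn _) u0 sB EB.
elim: n u B => [|n IH] u B su u0 sB EB.
  by move: su; rewrite leqn0 size_poly_eq0 (negPf u0).
have [su1|su1] := leqP (size u) 1.
  have [a Eu] : exists a, u = a%:P by exists u`_0; apply: size1_polyC.
  have a0 : a != 0 by rewrite -polyC_eq0 -Eu.
  exists ((a^-1)%:P%:P * B); split.
    by rewrite mul_polyC (leq_trans (size_scale_leq _ _)).
  by rewrite evM -EB ev_polyC mulrA -polyFM Eu -polyCM mulVf // polyF1 mul1r.
have [z0|z0] := eqVneq z 0.
  by exists 0; rewrite size_poly0 ev0.
have [E [j [al [be [ral abE]]]]] := point_over su1.
have pE : p \in [pchar {poly E}].
  by rewrite pchar_poly (fmorph_pchar j).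
have [frob frobE] := frobenius_power pE e; rewrite -qE in frobE.
pose h : {poly E} := map_poly (fun v : {poly F} => (map_poly j v).[al]) B.
have jq (b : F) : b ^+ q = b -> (be + j b) ^+ q - (be + j b) = (map_poly j f).[al].
  move=> bq; rewrite -abE.
  have pE1 : p \in [pchar E] by rewrite (fmorph_pchar j).
  have [fr frE] := frobenius_power pE1 e; rewrite -qE in frE.
  rewrite -!frE rmorphD /= !frE -rmorphXn /= bq.
  by rewrite opprD addrACA subrr addr0.
have hroot (b : F) : b ^+ q = b -> root h (be + j b).
  move=> bq; have [pl hpl] := finite_place_exists q1 c0 sf mf yE ygen dimL frobE (jq b bq).
  have Lu0 : polyF L u != 0 by rewrite polyF_eq0.
  have plx : 0 <= pl x.
    by have [] := hpl 'X%:P; rewrite ev_polyC ?polyF_eq0 ?polyX_eq0.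
  have plu : 0 < pl (polyF L u).
    have [|_] := hpl u%:P; rewrite ev_polyC // => ->.
    rewrite (_ : map_poly _ _ = (map_poly j u).[al]%:P) ?hornerC //.
    apply/polyP => i; rewrite coef_map_id0 ?rmorph0 ?horner0 // !coefC.
    by case: ifP => // _; rewrite rmorph0 horner0.
  have plz : 0 <= pl z by apply: reg.
  have plB : 0 < pl (ev B) by rewrite -EB place_valM // ltr_pwDl.
  have [|_ E0] := hpl B; last by rewrite rootE /h -E0.
  by rewrite -EB mulf_neq0.
have h0 : h = 0.
  pose rs := [seq be + j b | b <- enum [set b : F | b ^+ q == b]].
  apply: (roots_geq_poly_eq0 (rs := rs)).
  - by apply/allP => _ /mapP[b + ->]; rewrite mem_enum inE => /eqP; apply: hroot.
  - by rewrite map_inj_uniq ?enum_uniq // => b b' /addrI /fmorph_inj.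
  - by rewrite size_map -cardE card_Fq (leq_trans (size_poly _ _)).
have rB i : root (map_poly j B`_i) al.
  have := congr1 (fun k : {poly E} => k`_i) h0; rewrite coef0 coef_map_id0 ?rmorph0 ?horner0 //.
  by move/eqP.
have [d [d0 rd dmin]] := minimal_vanishing u0 ral.
have du := dmin u ral.
pose B' := \poly_(i < q) (B`_i %/ d).
have BE : B = d%:P * B'.
  apply/polyP => i; rewrite coefCM coef_poly; case: ltnP => iq.
    by rewrite mulrC divpK // dmin.
  by rewrite mulr0 nth_default // (leq_trans sB).
have sd : (1 < size d)%N.
  rewrite ltnNge; apply/negP => /size1_polyC Ed; move: rd; rewrite Ed map_polyC rootC.
  by rewrite fmorph_eq0 -polyC_eq0 -Ed (negPf d0).
apply: (IH (u %/ d) B').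
- have : (size (u %/ d)%R < size u)%N.
    rewrite size_divp // ltn_subrL; apply/andP; split; last by rewrite size_poly_gt0.
    by rewrite -subn1 subn_gt0.
  by move=> lt; rewrite -ltnS (leq_trans lt).
- by rewrite divp_eq0 (negPf u0) (negPf d0) /= -leqNgt dvdp_leq.
- exact: size_poly.
have Ld0 : polyF L d != 0 by rewrite polyF_eq0.
apply: (mulfI Ld0); rewrite mulrA -polyFM [d * _]mulrC divpK // EB.
by rewrite -(ev_polyC y d) -evM -BE.
Qed.

End Regular.

(** * Weak approximation and the fundamental inequality *)

Section WeakApproximation.
Variables (F : fieldType) (L : fieldExtType {fraction {poly F}}).
Implicit Types (p r : place L) (s : seq (place L)) (u v w z : L).

(** Units for p1 are units for p2, so p2 is a nonnegative multiple of p1; normalization makes the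
    factor 1. *)
Lemma place_ring_incl p1 p2 : (forall u, u != 0 -> 0 <= p1 u -> 0 <= p2 u) -> p1 = p2.
Proof.
move=> incl.
have unit u : u != 0 -> p1 u = 0 -> p2 u = 0.
  move=> u0 pu; apply/eqP; rewrite eq_le (incl u) ?pu // andbT.
  by have := incl u^-1; rewrite !placeV // pu oppr0 invr_eq0 oppr_ge0 => /(_ u0 (lexx _)).
have [t [t0 pt]] := place_val_norm p1.
have pos u n : u != 0 -> p1 u = n%:Z -> p2 u = p2 t * n%:Z.
  move=> u0 pu; have tn : t ^+ n != 0 by rewrite expf_neq0.
  have := unit (u / t ^+ n); rewrite !place_valM ?invr_eq0 // !placeV // !placeXn // pu pt.
  rewrite mul1r subrr mulf_neq0 ?invr_eq0 // => /(_ isT (erefl _)) /eqP.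
  by rewrite subr_eq0 => /eqP.
have lin u : u != 0 -> p2 u = p2 t * p1 u.
  move=> u0; case E : (p1 u) => [n|n]; first exact: pos.
  have := pos u^-1 n.+1; rewrite invr_eq0 !placeV // E => /(_ u0 (erefl _)) h.
  by apply: oppr_inj; rewrite h -mulrN.
have t2 : 0 <= p2 t by apply: incl; rewrite ?pt.
have t1 : p2 t = 1.
  have [t' [t'0 pt']] := place_val_norm p2; have := lin t' t'0; rewrite pt'.
  move: (p2 t) (p1 t') t2; clear => a b a0 E; have b0 : 1 <= b by nia.
  by nia.
by apply: place_ext => u u0; rewrite lin // t1 mul1r.
Qed.

Lemma separate_two p1 p2 : p1 != p2 -> exists u, [/\ u != 0, 0 < p1 u & p2 u < 0].
Proof.
move=> ne.
have half a b : a != b -> exists u : L, [/\ u != 0, 0 <= (a : place L) u & (b : place L) u < 0].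
  move=> ab; apply: contrapT => no; case/eqP: ab; apply: place_ring_incl => u u0 au.
  by rewrite leNgt; apply/negP => bu; apply: no; exists u.
have [u [u0 pu ru]] := half _ _ ne.
have [v [v0 rv pv]] : exists v : L, [/\ v != 0, 0 <= p2 v & p1 v < 0].
  by apply: half; rewrite eq_sym.
exists (u / v); rewrite mulf_neq0 ?invr_eq0 // !place_valM ?invr_eq0 // !placeV //.
by split=> //; lia.
Qed.

Lemma separate p s : p \notin s -> exists z,
  [/\ z != 0, 0 < p z & forall r, r \in s -> r z < 0].
Proof.
elim: s => [|r0 s IH].
  by have [t [t0 pt]] := place_val_norm p; exists t; rewrite pt.
rewrite inE negb_or => /andP[pr0 ps].
have [z [z0 pz sz]] := IH ps; have [v [v0 pv rv]] := separate_two pr0.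
have [r0z|r0z] := ltP (r0 z) 0.
  by exists z; split=> // r; rewrite inE => /orP[/eqP ->|/sz].
(* N exceeds every |r z|, so z and v^N have different orders at each r in s, the smaller being
   negative whatever the sign of r v. *)
pose N := (\sum_(r <- s) `|r z|%N).+1; pose w := v ^+ N.
have w0 : w != 0 by rewrite expf_neq0.
have rw r : r w = r v * N%:Z by rewrite placeXn.
have [|zw0 rzw] := @place_add_lt _ _ r0 w z w0.
  by move=> _; rewrite rw; move: (r0 v) (r0 z) rv r0z => i j; nia.
rewrite addrC in zw0 rzw.
exists (z + w); split=> //.
  apply: lt_le_trans (place_valD p z0 w0 zw0).
  by rewrite lt_min pz rw mulr_gt0.
move=> r; rewrite inE => /orP[/eqP ->|rs].
  by rewrite rzw rw; move: (r0 v) rv => i; nia.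
have rz := sz r rs.
have Nr : `|r z|%N%:Z < N%:Z.
  by rewrite ltz_nat ltnS (big_rem r) //= leq_addr.
have [rv0|rv0] := leP 0 (r v).
  have [|_ ->] := @place_add_lt _ _ r z w z0; last by [].
  by move=> _; rewrite rw; move: (r v) (r z) rv0 rz => i j; nia.
have [|_] := @place_add_lt _ _ r w z w0.
  by move=> _; rewrite rw; move: (r v) (r z) rv0 rz Nr => i j; nia.
by rewrite addrC rw => ->; move: (r v) rv0 => i; nia.
Qed.

(** 1 / (1 + z^(N+1)) is close to 1 where z vanishes and close to 0 where z has a pole. *)
Lemma approximate_one p s (N : nat) : p \notin s -> exists e : L,
  pge p N%:Z (e - 1) /\ (forall r, r \in s -> pge r N%:Z e).
Proof.
move=> ps; have [z [z0 pz sz]] := separate ps.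
pose w := z ^+ N.+1; have w0 : w != 0 by rewrite expf_neq0.
have rw r : r w = r z * N.+1%:Z by rewrite placeXn.
have [|d0 pd] := @place_add_lt _ _ p 1 w (oner_neq0 _).
  by move=> _; rewrite place1 rw; move: (p z) pz => i; nia.
exists (1 + w)^-1; split=> [|r /sz rz].
  have -> : (1 + w)^-1 - 1 = - w / (1 + w).
    by apply: (mulIf d0); rewrite divfK // mulrBl mulVf // mul1r opprD addrA subrr add0r.
  move=> _; rewrite place_valM ?oppr_eq0 ?invr_eq0 // placeN placeV // pd place1 rw.
  by move: (p z) pz => i; nia.
have [|_ rd] := @place_add_lt _ _ r w 1 w0.
  by move=> _; rewrite place1 rw; move: (r z) rz => i; nia.
move=> _; rewrite placeV // addrC rd rw.
by move: (r z) rz => i; nia.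
Qed.

Lemma approximate p s w (m : nat) : p \notin s -> exists z : L,
  pge p m%:Z (z - w) /\ (forall r, r \in s -> pge r m%:Z z).
Proof.
move=> ps; have [w0|w0] := eqVneq w 0.
  by exists 0; rewrite w0 subrr; split=> [|r _]; apply: pge0.
pose N := (m + \sum_(r <- p :: s) `|r w|)%N.
have [e [pe se]] := approximate_one N ps.
have bound r : r \in p :: s -> m%:Z <= N%:Z + r w.
  move=> rs; have : (`|r w| <= \sum_(r <- p :: s) `|r w|)%N by rewrite (big_rem r) //= leq_addr.
  by rewrite /N; move: (\sum_(r <- _) _)%N (r w) => k i; lia.
exists (e * w); split=> [|r rs].
  rewrite -[X in _ - X]mul1r -mulrBl; apply: pgeW (bound p (mem_head _ _)) _.
  by apply: pgeM.
apply: pgeW (bound r _) _; first by rewrite inE rs orbT.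
by apply: pgeM => //; apply: se.
Qed.

End WeakApproximation.

Section DegreeBound.
Variables (F : finFieldType) (q c : nat) (f : {poly F}).
Hypotheses (q1 : (1 < q)%N) (c0 : (0 < c)%N).
Local Notation D := (q * c).+1.
Hypotheses (sf : size f = D.+1) (mf : f \is monic).
Variables (L : fieldExtType {fraction {poly F}}) (y : L).
Hypotheses (yE : y ^+ q - y = polyF L f) (ygen : <<1; y>>%VS = fullv).
Hypothesis (dimL : \dim {:L} = q).
Local Notation ev := (ev y).
Local Notation x := (xF L).
Local Notation iota := (constF L).
Local Notation zero := (fun z : L => z = 0).

Definition monomial (k : nat) (ij : 'I_k * 'I_q) : L := x ^+ ij.1 * y ^+ ij.2.

Lemma ev_monomials k (B : {poly {poly F}}) : (size B <= q)%N ->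
  (forall j, (size (B`_j)%R <= k)%N) ->
  ev B = lcomb iota (@monomial k) (fun ij => B`_(ij.2)`_(ij.1)).
Proof.
move=> sB sk; rewrite (evE y sB) /lcomb.
rewrite -(pair_bigA _ (fun (i : 'I_k) (j : 'I_q) => iota B`_j`_i * monomial (i, j))) exchange_big /=.
apply: eq_bigr => j _; rewrite (polyFE L (sk j)) mulr_suml; apply: eq_bigr => i _.
by rewrite mulrA.
Qed.

Lemma common_denominator (I : finType) (z : I -> L) : exists (u : {poly F}) (k : nat),
  u != 0 /\ forall i, exists B : {poly {poly F}},
    [/\ (size B <= q)%N, forall j, (size (B`_j)%R <= k)%N & polyF L u * z i = ev B].
Proof.
have /choice[uB huB] : forall i, exists uB : {poly F} * {poly {poly F}},
    [/\ uB.1 != 0, (size uB.2 <= q)%N & polyF L uB.1 * z i = ev uB.2].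
  by move=> i; have [u [B h]] := ev_surj q1 c0 sf mf yE ygen (z i); exists (u, B).
pose u := \prod_i (uB i).1.
pose v i := \prod_(l | l != i) (uB l).1.
pose B i := (v i)%:P * (uB i).2.
exists u, (\max_i \max_(j < q) size ((B i)`_j)%R)%N; split.
  by apply/prodf_neq0 => i _; have [] := huB i.
move=> i; have [_ sB E] := huB i.
have sBi : (size (B i) <= q)%N by rewrite /B mul_polyC (leq_trans (size_scale_leq _ _)).
exists (B i); split=> // [j|].
  have [jq|qj] := ltnP j q; last by rewrite nth_default ?size_poly0 // (leq_trans sBi).
  apply: leq_trans (leq_bigmax i).
  exact: (leq_bigmax (Ordinal jq)).
rewrite /B evM -E ev_polyC mulrA -polyFM; congr (polyF L _ * _).
by rewrite /u (bigD1 i) //= mulrC.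
Qed.

(* The elements h^l z_i, l < T, are independent over F and lie in u^-1 F[x,y]
   with x-degree at most T deg h + O(1); let T grow. *)
Lemma independent_bound (I : finType) (z : I -> L) (h : {poly F}) :
  (forall T, indep iota (fun li : 'I_T * I => polyF L h ^+ li.1 * z li.2) zero) ->
  (#|I| <= q * (size h).-1)%N.
Proof.
move=> ind; have [u [k [u0 hz]]] := common_denominator z.
have Lu0 : polyF L u != 0 by rewrite polyF_eq0.
have bound T : (T * #|I| <= (k + T * (size h).-1) * q)%N.
  pose w (li : 'I_T * I) := polyF L u * (polyF L h ^+ li.1 * z li.2).
  have iw : indep iota w zero.
    move=> a; have -> : lcomb iota w a = polyF L u *
        lcomb iota (fun li : 'I_T * I => polyF L h ^+ li.1 * z li.2) a.
      by rewrite /lcomb mulr_sumr; apply: eq_bigr => i _; rewrite mulrCA.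
    by move/eqP; rewrite mulf_eq0 (negPf Lu0) => /eqP /ind.
  have := @indep_leq F L iota _ _ w (@monomial (k + T * (size h).-1)) zero (subsp0 _) iw.
  rewrite !card_prod !card_ord; apply=> -[l i].
  have [B [sB kB EB]] := hz i; pose C := (h ^+ l)%:P * B.
  exists (fun ij : 'I_(k + T * (size h).-1) * 'I_q => C`_(ij.2)`_(ij.1)); rewrite -ev_monomials.
  - by rewrite /C evM -EB ev_polyC polyFXn /w /= mulrCA subrr.
  - by rewrite /C mul_polyC (leq_trans (size_scale_leq _ _)).
  - move=> j; rewrite coefCM (leq_trans (size_polyMleq _ _)) //.
    have : (size (h ^+ l)%R <= (l * (size h).-1).+1)%N.
      by rewrite (leq_trans (size_poly_exp_leq _ _)) // mulnC.
    have := leq_mul (ltnW (ltn_ord l)) (leqnn (size h).-1).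
    have := kB j; move: (size _) (size _) (_ * _)%N (_ * _)%N; clear => a b d e; lia.
(* With T = k q + 1 the excess k q is smaller than T, which forces |I| <= q deg h. *)
have := bound (k * q).+1; move: (size h).-1 #|I| => d n; clear; nia.
Qed.

End DegreeBound.

Section FundamentalInequality.
Variables (F : finFieldType) (q c : nat) (f : {poly F}).
Hypotheses (q1 : (1 < q)%N) (c0 : (0 < c)%N).
Local Notation D := (q * c).+1.
Hypotheses (sf : size f = D.+1) (mf : f \is monic).
Variables (L : fieldExtType {fraction {poly F}}) (y : L).
Hypotheses (yE : y ^+ q - y = polyF L f) (ygen : <<1; y>>%VS = fullv).
Hypothesis (dimL : \dim {:L} = q).
Local Notation x := (xF L).
Local Notation iota := (constF L).
Local Notation zero := (fun z : L => z = 0).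

Variables (k : nat) (pl : 'I_k -> place L) (h : {poly F}) (e n : 'I_k -> nat).
Variable b : forall i, 'I_(n i) -> L.
Hypotheses (pl_inj : injective pl) (pl_x : forall i, 0 <= pl i x) (h0 : h != 0).
Hypotheses (pl_h : forall i, pl i (polyF L h) = (e i)%:Z).
Hypotheses (b_int : forall i s, pge (pl i) 0 (@b i s)).
Hypotheses (b_ind : forall i, indep iota (@b i) (pge (pl i) 1)).

Let T := {i : 'I_k & ('I_(e i) * 'I_(n i))%type}.
Let m := (\sum_i e i)%N.

Let em i : (e i <= m)%N.
Proof. by rewrite /m (bigD1 i) //= leq_addr. Qed.

(* tau i is a uniformizer at pl i; z approximates tau^a b at pl i and vanishes
   to high order at the other places. *)
Let approximants : exists (tau : 'I_k -> L) (z : T -> L),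
  [/\ forall i, tau i != 0, forall i, pl i (tau i) = 1,
      forall t : T, pge (pl (tag t)) m%:Z
        (z t - tau (tag t) ^+ (tagged t).1 * @b (tag t) (tagged t).2) &
      forall (t : T) i, i != tag t -> pge (pl i) m%:Z (z t)].
Proof.
have /choice[tau htau] : forall i, exists t, t != 0 /\ pl i t = 1.
  by move=> i; apply: place_val_norm.
have /choice[z hz] : forall t : T, exists z, pge (pl (tag t)) m%:Z
      (z - tau (tag t) ^+ (tagged t).1 * @b (tag t) (tagged t).2) /\
    forall i, i != tag t -> pge (pl i) m%:Z z.
  move=> t; have [|z [z1 z2]] := @approximate F L (pl (tag t))
      [seq pl i | i <- enum 'I_k & i != tag t]
      (tau (tag t) ^+ (tagged t).1 * @b (tag t) (tagged t).2) m.
    by apply/mapP => -[i]; rewrite mem_filter => /andP[it _] /pl_inj E; rewrite E eqxx in it.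
  exists z; split=> // i it; apply: z2; apply: map_f.
  by rewrite mem_filter it mem_enum.
exists tau, z; split=> [i|i|t|t i].
- by have [] := htau i.
- by have [] := htau i.
- by have [] := hz t.
- by have [_] := hz t; apply.
Qed.

(** At [pl i] the approximants of other tags are negligible, and those of tag i have leading parts
    tau^A b; independence of the residues of the b kills the coefficients by induction on A. *)
Let combine (tau : 'I_k -> L) (z : T -> L) (a : T -> F) :
  (forall i, tau i != 0) -> (forall i, pl i (tau i) = 1) ->
  (forall t : T, pge (pl (tag t)) m%:Z
        (z t - tau (tag t) ^+ (tagged t).1 * @b (tag t) (tagged t).2)) ->
  (forall (t : T) i, i != tag t -> pge (pl i) m%:Z (z t)) ->
  (forall i, pge (pl i) (e i)%:Z (lcomb iota z a)) -> forall t, a t = 0.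
Proof.
move=> tau0 ptau z1 z2 za.
suff main i (A : 'I_(e i)) (s : 'I_(n i)) : a (existT _ i (A, s)) = 0.
  by move=> [i [A s]]; apply: main.
pose av (A : 'I_(e i)) s := a (existT _ i (A, s)).
have local : pge (pl i) (e i)%:Z
    (\sum_(A < e i) \sum_(s < n i) iota (av A s) * (tau i ^+ A * @b i s)).
  have -> : \sum_(A < e i) \sum_(s < n i) iota (av A s) * (tau i ^+ A * @b i s)
     = lcomb iota z a - \sum_t iota (a t) * (z t -
         if tag t == i then tau (tag t) ^+ (tagged t).1 * @b (tag t) (tagged t).2 else 0).
    rewrite /lcomb -sumrB.
    pose G i' (As : 'I_(e i') * 'I_(n i')) := if i' == i then
      iota (a (existT _ i' As)) * (tau i' ^+ As.1 * @b i' As.2) else 0.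
    rewrite (eq_bigr (fun t : T => G (tag t) (tagged t))); last first.
      move=> [i' As] _ /=; rewrite mulrBr opprB addrCA subrr addr0 /G.
      by case: ifP; rewrite ?mulr0.
    rewrite -(sig_big_dep xpredT (fun _ => xpredT) G).
    rewrite (bigD1 i) //= [X in _ + X]big1 ?addr0; last first.
      by move=> i' /negPf i'i; rewrite big1 // => As _; rewrite /G i'i.
    rewrite pair_bigA; apply: eq_bigr => -[A' s'] _.
    by rewrite /G eqxx.
  apply: pgeB; first exact: za.
  apply: pge_sum => t _; apply: pgeZ; apply: (pgeW (n := m%:Z)); first by rewrite lez_nat em.
  case: eqP => [<-|/eqP it]; first exact: z1.
  by rewrite subr0; apply: z2; rewrite eq_sym.
have [N] := ubnP (nat_of_ord A); elim: N A s => // N IH A s; rewrite ltnS => AN.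
have low (A' : 'I_(e i)) s' : (A' < A)%N -> av A' s' = 0.
  by move=> lt; apply: IH; apply: leq_trans AN.
have term (A' : 'I_(e i)) (s' : 'I_(n i)) : pge (pl i) (nat_of_ord A')%:Z (iota (av A' s') * (tau i ^+ A' * @b i s')).
  apply: pgeZ; rewrite -[X in pge _ X]addr0; apply: pgeM => // _.
  by rewrite placeXn // ptau mul1r.
have : pge (pl i) ((nat_of_ord A)%:Z + 1) (tau i ^+ A * lcomb iota (@b i) (av A)).
  have -> : tau i ^+ A * lcomb iota (@b i) (av A) =
      \sum_(A' < e i) \sum_(s' < n i) iota (av A' s') * (tau i ^+ A' * @b i s')
      - \sum_(A' < e i | A' != A) \sum_(s' < n i) iota (av A' s') * (tau i ^+ A' * @b i s').
    rewrite [X in X - _](bigD1 A) //= addrK mulr_sumr; apply: eq_bigr => s' _.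
    by rewrite mulrCA.
  apply: pgeB.
    by apply: pgeW local; have := ltn_ord A; lia.
  apply: pge_sum => A' A'A; apply: pge_sum => s' _.
  have [lt|gt] := ltnP A' A; first by rewrite low // constF0 mul0r; apply: pge0.
  apply: pgeW (term A' s'); have : (A < A')%N by rewrite ltn_neqAle eq_sym A'A.
  by lia.
move=> hA; apply: (b_ind _ (i := i) (c := av A)); move=> w0.
have tA : tau i ^+ A != 0 by rewrite expf_neq0.
have := hA; rewrite /pge mulf_neq0 // => /(_ isT).
by rewrite place_valM // placeXn // ptau mul1r lerD2l.
Qed.

(** By [independent_bound] it suffices that the h^l z_t are independent over F. In a relation the
    lowest block of coefficients yields a combination of the z_t divisible by h, to which [combine]
    applies. *)
Lemma fundamental_inequality : (\sum_i e i * n i <= q * (size h).-1)%N.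
Proof.
have [tau [z [tau0 ptau z1 z2]]] := approximants.
have cT : #|{: T}| = (\sum_i e i * n i)%N.
  rewrite card_tagged sumnE big_map big_enum /=.
  by apply: eq_bigr => i _; rewrite card_prod !card_ord.
rewrite -cT; apply: (independent_bound q1 c0 sf mf yE ygen (z := z)) => N.
have zint t i : pge (pl i) 0 (z t).
  have [E|it] := eqVneq i (tag t); last by apply: pgeW (z2 t i it).
  rewrite E -[z t](subrK (tau (tag t) ^+ (tagged t).1 * @b (tag t) (tagged t).2)).
  apply: pgeD; first by apply: pgeW (z1 t).
  rewrite -[X in pge _ X]addr0; apply: pgeM => //.
  by apply: pgeXn => _; rewrite ptau.
move=> a; pose u (l : 'I_N) := lcomb iota z (fun t => a (l, t)).
have -> : lcomb iota (fun li : 'I_N * T => polyF L h ^+ li.1 * z li.2) a =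
    \sum_(l < N) polyF L h ^+ l * u l.
  rewrite [RHS](eq_bigr (fun l : 'I_N => \sum_t iota (a (l, t)) * (polyF L h ^+ l * z t))).
    by rewrite pair_bigA; apply: eq_bigr => -[l t] _.
  by move=> l _; rewrite mulr_sumr; apply: eq_bigr => t _; rewrite mulrCA.
move=> E [l t]; have [M] := ubnP (nat_of_ord l); elim: M l t => // M IH l t.
rewrite ltnS => lM; have Lh0 : polyF L h != 0 by rewrite polyF_eq0.
have low (l' : 'I_N) : (l' < l)%N -> u l' = 0.
  move=> lt; rewrite /u /lcomb big1 // => t' _.
  by rewrite (IH l' t' (leq_trans lt lM)) rmorph0 mul0r.
apply: (combine (a := fun t => a (l, t)) tau0 ptau z1 z2) => i.
(* The terms above l divided by h^(l+1): the lower ones vanish by induction, so u l = - h R with R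
   integral at each [pl i]. *)
pose R := \sum_(l' < N | (l < l')%N) polyF L h ^+ (l' - l.+1) * u l'.
have uE : u l = - (polyF L h * R).
  have hl : polyF L h ^+ l != 0 by rewrite expf_neq0.
  apply: (mulfI hl); apply/eqP; rewrite mulrN -addr_eq0; apply/eqP; apply: etrans E.
  rewrite [RHS](bigD1 l) //= (bigID (fun l' : 'I_N => (l' < l)%N)) /= big1 ?add0r; last first.
    by move=> l' /andP[_ lt]; rewrite low // mulr0.
  congr (_ + _); rewrite /R !mulr_sumr; apply: eq_big => l'.
    by rewrite -leqNgt ltn_neqAle eq_sym -val_eqE.
  by move=> lt; rewrite !mulrA -exprSr -exprD subnKC.
rewrite -/(u l) uE; apply: pgeN; rewrite -[X in pge _ X]addr0; apply: pgeM.
  by move=> _; rewrite pl_h.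
apply: pge_sum => l' _; rewrite -[X in pge _ X]addr0; apply: pgeM.
  by apply: pgeXn => _; rewrite pl_h.
by apply: pge_sum => t' _; apply: pgeZ.
Qed.

End FundamentalInequality.

(** * Riemann-Roch spaces and the genus *)

Section QuotientDimensions.
Variables (F : finFieldType) (L : fieldExtType {fraction {poly F}}).
Local Notation iota := (constF L).
Local Notation zero := (fun z : L => z = 0).
Implicit Types (V W U : L -> Prop) (P : place L) (D : place L -> int).

Lemma has_quot_dim_fdim V W d : V 0 -> subsp iota W ->
  has_quot_dim V W d <-> fdim iota V W d.
Proof.
move=> V0 sW; split=> -[b].
  case=> Vb sb; exists b; split=> // [c Wc i|z /sb[c [Wc _]]]; last first.
    by exists (fun i => c 0 i).
  have [c0 [_ c0u]] := sb 0 V0.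
  have E1 : c0 = 0.
    apply: c0u; rewrite big1 ?subr0 => [|j _]; first by case: sW.
    by rewrite mxE rmorph0 mul0r.
  have /rowP/(_ i) : c0 = \row_j c j.
    apply: c0u; rewrite sub0r; apply: (subspN sW).
    suff -> : \sum_(i < d) iota ((\row_j c j) 0 i) * b i = lcomb iota b c by [].
    by apply: eq_bigr => j _; rewrite mxE.
  by rewrite E1 !mxE.
case=> Vb ib sb; exists b; split=> // z /sb[c Wc].
exists (\row_j c j); split=> [|c' Wc'].
  suff -> : \sum_(i < d) iota ((\row_j c j) 0 i) * b i = lcomb iota b c by [].
  by apply: eq_bigr => j _; rewrite mxE.
apply/rowP => i; rewrite mxE; apply/eqP; rewrite -subr_eq0; apply/eqP.
apply: (ib (fun i => c i - c' 0 i)); rewrite -lcombB.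
have := subspB sW Wc' Wc.
by rewrite opprB addrC addrA subrK.
Qed.

Lemma quot_dimE V W d : V 0 -> subsp iota W -> fdim iota V W d ->
  quot_dim V W = d.
Proof.
move=> V0 sW fd; apply: classical_sets.xget_unique.
  exact/(has_quot_dim_fdim _ V0 sW).
by move=> d' /(has_quot_dim_fdim _ V0 sW) fd'; apply: fdim_uniq fd.
Qed.

Lemma fdim_add V U W m n : subsp iota U -> (forall z, W z -> U z) ->
  (forall z, U z -> V z) -> fdim iota V U m -> fdim iota U W n ->
  fdim iota V W (m + n).
Proof.
move=> sU WU UV [b [Vb ib sb]] [b' [Ub ib' sb']].
pose w i := match split i with inl j => b j | inr j => b' j end.
have wE c : lcomb iota w c = lcomb iota b (fun j => c (lshift n j))
    + lcomb iota b' (fun j => c (rshift m j)).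
  rewrite /lcomb big_split_ord /=; congr (_ + _); apply: eq_bigr => j _.
    by rewrite /w (unsplitK (inl j)).
  by rewrite /w (unsplitK (inr j)).
exists w; split=> [i|c|z Vz].
- by rewrite /w; case: split => j //; apply: UV.
- rewrite wE => Wc.
  have cl : forall j, c (lshift n j) = 0.
    apply: (ib (fun j => c (lshift n j))).
    have := subspB sU (WU _ Wc) (subsp_lcomb (fun j => c (rshift m j)) sU Ub).
    by rewrite addrK.
  have E : lcomb iota b (fun j => c (lshift n j)) = 0.
    by rewrite /lcomb big1 // => j _; rewrite cl rmorph0 mul0r.
  move: Wc; rewrite E add0r => /(ib' (fun j => c (rshift m j))) cr i.
  by rewrite -(splitK i); case: (split i).
have [c1 U1] := sb z Vz; have [c2 W2] := sb' _ U1.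
exists (fun i => match split i with inl j => c1 j | inr j => c2 j end).
rewrite wE opprD addrA; congr (W (_ - _ - _)): W2.
  by apply: eq_bigr => j _; rewrite (unsplitK (inl j)).
by apply: eq_bigr => j _; rewrite (unsplitK (inr j)).
Qed.

Lemma fdim_scale V s d : s != 0 -> fdim iota V zero d ->
  fdim iota (fun z => V (s * z)) zero d.
Proof.
move=> s0 [b [Vb ib sb]]; exists (fun i => s^-1 * b i).
have E c : lcomb iota (fun i => s^-1 * b i) c = s^-1 * lcomb iota b c.
  by rewrite /lcomb mulr_sumr; apply: eq_bigr => i _; rewrite mulrCA.
split=> [i|c|z /sb[c hc]]; first by rewrite mulVKf.
  rewrite E => /eqP; rewrite mulf_eq0 invr_eq0 (negbTE s0) /= => /eqP.
  exact: ib.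
exists c; rewrite E; apply: (mulfI s0).
by rewrite mulr0 mulrBr mulVKf.
Qed.

Lemma fdim_sub V V' W d : subsp iota V' -> subsp iota W ->
  (forall z, V' z -> V z) -> fdim iota V W d -> exists d', fdim iota V' W d'.
Proof.
move=> sV' sW sub fd.
have [|d' _ fd'] := @fdim_exists _ _ iota V' W d sV' sW; last by exists d'.
by move=> m u Vu; apply: (fdim_ge sW fd) => i; apply: sub.
Qed.

(** D is an arbitrary function on places, so that auxiliary divisors such as [twist] need no finite
    support to be written down. *)
Definition rr_space D z := z != 0 -> forall P : place L, 0 <= P z + D P.

Lemma rr_spaceE D : rr_space D = fun z => forall P, pge P (- D P) z.
Proof.
apply/funext => z; apply/propext; split=> [h P z0|h z0 P].
  by have := h z0 P; lia.
by have := h P z0; lia.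
Qed.

Lemma subsp_rr_space D : subsp iota (rr_space D).
Proof.
rewrite rr_spaceE; split=> [P|u v hu hv P|a u hu P]; first exact: pge0.
  exact: pgeD.
exact: pgeZ.
Qed.

Lemma place_idealE P : place_ideal P = pge P 1.
Proof.
by apply/funext => z; apply/propext; split=> h z0; have := h z0;
  rewrite gtz0_ge1.
Qed.

Lemma place_degE P d : fdim iota (pge P 0) (pge P 1) d -> place_deg P = d.
Proof.
rewrite /place_deg place_idealE; apply: quot_dimE; first exact: pge0.
exact: subsp_pge.
Qed.

Lemma place_exists_value P n : exists2 s, s != 0 & P s = n.
Proof.
have [t [t0 tE]] := place_val_norm P; case: n => n.
  by exists (t ^+ n); rewrite ?expf_neq0 // placeXn // tE mul1r.
exists (t ^+ n.+1)^-1; rewrite ?invr_eq0 ?expf_neq0 //.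
by rewrite placeV ?expf_neq0 // placeXn // tE mul1r NegzE.
Qed.

Hypothesis residue_fdim : forall P,
  fdim iota (pge P 0) (pge P 1) (place_deg P).

(** Multiplication by an element of order D P + 1 at P sends the larger space into the valuation
    ring of P, and only the smaller space into the maximal ideal: the quotient embeds in the residue
    field. *)
Lemma rr_space_add_place D P : exists2 n, (n <= place_deg P)%N &
  fdim iota (rr_space (fun Q => D Q + (P == Q)%:Z)) (rr_space D) n.
Proof.
apply: fdim_exists; [exact: subsp_rr_space|exact: subsp_rr_space|].
move=> m u Vu iu.
have [s s0 sE] := place_exists_value P (D P + 1).
have E d : lcomb iota (fun i => s * u i) d = s * lcomb iota u d.
  by rewrite /lcomb mulr_sumr; apply: eq_bigr => i _; rewrite mulrCA.
apply: (fdim_ge (u := fun i => s * u i) (subsp_pge P 1) (residue_fdim P)).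
  move=> i; rewrite /pge mulf_eq0 negb_or => /andP[_ ui].
  by rewrite place_valM // sE; have := Vu i ui P; rewrite eqxx; lia.
move=> d; rewrite E => h; apply: iu => z0 Q.
have [<-|PQ] := eqVneq P Q.
  by have := h; rewrite /pge mulf_neq0 // place_valM // sE => /(_ isT); lia.
have := subsp_lcomb d (subsp_rr_space (fun Q => D Q + (P == Q)%:Z)) Vu z0 Q.
by rewrite (negbTE PQ) addr0.
Qed.

Lemma rr_space_add_places (s : seq (place L)) D d :
  fdim iota (rr_space (fun Q => D Q + (count_mem Q s)%:Z)) zero d ->
  exists2 d', fdim iota (rr_space D) zero d' &
    (d <= d' + \sum_(P <- s) place_deg P)%N.
Proof.
elim: s D d => [|P s IH] D d.
  under [X in rr_space X]eq_fun do rewrite /= addr0.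
  by exists d => //; rewrite big_nil addn0.
have -> : (fun Q => D Q + (count_mem Q (P :: s))%:Z)
    = (fun Q => D Q + (P == Q)%:Z + (count_mem Q s)%:Z).
  by apply/funext => Q /=; rewrite PoszD addrA.
move=> /IH[d1 fd1 le1].
have sub z : rr_space D z -> rr_space (fun Q => D Q + (P == Q)%:Z) z.
  by move=> h z0 Q; have := h z0 Q; lia.
have [d' fd'] := fdim_sub (subsp_rr_space D) (subsp0 iota) sub fd1.
have [n le fn] := rr_space_add_place D P.
exists d' => //; rewrite big_cons.
have z0 z : z = 0 -> rr_space D z by move=> ->; case: (subsp_rr_space D).
have := fdim_add (subsp_rr_space D) z0 sub fn fd'.
by move=> /(fdim_uniq (subsp0 iota) fd1) E; rewrite E in le1; lia.
Qed.

End QuotientDimensions.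

Section ResidueDegrees.
Variables (F : finFieldType) (q c : nat) (f : {poly F}).
Hypotheses (q1 : (1 < q)%N) (c0 : (0 < c)%N).
Local Notation D := (q * c).+1.
Hypotheses (sf : size f = D.+1) (mf : f \is monic).
Variables (L : fieldExtType {fraction {poly F}}) (y : L).
Hypotheses (yE : y ^+ q - y = polyF L f) (ygen : <<1; y>>%VS = fullv).
Hypothesis (dimL : \dim {:L} = q).
Local Notation x := (xF L).
Local Notation iota := (constF L).
Local Notation zero := (fun z : L => z = 0).
Implicit Types (P : place L) (h : {poly F}).

(** Otherwise P would be trivial on F(x), hence nonnegative on all of L, against the inverse of a
    uniformizer. *)
Lemma finite_place_zero P : 0 <= P x ->
  exists2 h, h != 0 & 0 < P (polyF L h).
Proof.
move=> Px; apply: contrapT => none.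
have P0 h : h != 0 -> P (polyF L h) = 0.
  move=> h0; apply/eqP; rewrite eq_le place_polyF_ge0 ?polyF_eq0 // andbT.
  by rewrite leNgt; apply/negP => Ph; apply: none; exists h.
have Pge (z : L) : z != 0 -> 0 <= P z.
  move=> z0; have [u [B [u0 _ E]]] := ev_surj q1 c0 sf mf yE ygen z.
  have uz0 : polyF L u * z != 0 by rewrite mulf_neq0 ?polyF_eq0.
  have := ev_integral q1 sf yE (P := B) Px.
  by rewrite -E => /(_ uz0); rewrite place_valM ?polyF_eq0 // P0 // add0r.
have [t [t0 tE]] := place_val_norm P.
by have := Pge t^-1; rewrite invr_eq0 placeV // tE => /(_ t0).
Qed.

Lemma indep_one P : indep iota (fun _ : 'I_1 => 1) (pge P 1).
Proof.
move=> a; rewrite /lcomb big_ord1 mulr1 => h i; rewrite (ord1 i).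
by apply/eqP; apply: contraT => a0; have := h; rewrite /pge constF_eq0 a0
  place_valC => /(_ isT).
Qed.

Lemma residue_fdim_infinity P : P x < 0 -> fdim iota (pge P 0) (pge P 1) 1.
Proof.
move=> Px; have [pinf pinfE] := place_infinity_exists q1 c0 sf mf yE ygen dimL.
rewrite (pinf_unique q1 c0 sf mf yE ygen dimL pinfE Px).
exists (fun _ => 1); split=> [_||z].
- by rewrite /pge place1.
- exact: indep_one.
move=> /(pinf_residue q1 c0 sf mf yE ygen pinfE)[a az].
by exists (fun _ => a); rewrite /lcomb big_ord1 mulr1.
Qed.

(** At a finite place, e f <= q deg h for a polynomial h vanishing there bounds the residue degree.
    So [place_deg] is a true dimension and not the default value of [quot_dim]. *)
Lemma residue_fdim P : fdim iota (pge P 0) (pge P 1) (place_deg P).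
Proof.
suff [d _ fd] : exists2 d, True & fdim iota (pge P 0) (pge P 1) d.
  by rewrite (place_degE fd).
have [Px|Px] := leP 0 (P x).
  have [h h0 Ph] := finite_place_zero Px.
  have [|d _ fd] := @fdim_exists _ _ iota (pge P 0) (pge P 1)
    (q * (size h).-1) (subsp_pge P 0) (subsp_pge P 1); last by exists d.
  move=> m u Vu iu.
  have := @fundamental_inequality F q c f q1 c0 sf mf L y yE ygen dimL 1
    (fun _ => P) h (fun _ => `|P (polyF L h)|%N) (fun _ => m) (fun _ => u).
  rewrite big_ord1 => le; have {le} : (`|P (polyF L h)| * m <= q * (size h).-1)%N.
    by apply: le => // [i j|_]; [rewrite !ord1|rewrite gez0_abs // ltW].
  by apply: leq_trans; rewrite leq_pmull // absz_gt0 gt_eqF.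
by exists 1%N => //; apply: residue_fdim_infinity.
Qed.

Lemma place_deg_gt0 P : (0 < place_deg P)%N.
Proof.
apply: (fdim_ge (subsp_pge P 1) (residue_fdim P) _ (@indep_one P)) => _.
by rewrite /pge place1.
Qed.

Lemma place_deg_infinity P : P x < 0 -> place_deg P = 1%N.
Proof. by move=> Px; apply/place_degE/residue_fdim_infinity. Qed.

Lemma zeros_degree h (s : seq (place L)) : h != 0 -> uniq s ->
  (forall P, P \in s -> 0 <= P x) ->
  \sum_(P <- s) P (polyF L h) * (place_deg P)%:Z <= (q * (size h).-1)%:Z.
Proof.
move=> h0 us sx.
pose pl (i : 'I_(size s)) := tnth (in_tuple s) i.
have plx i : 0 <= pl i x by apply: sx; apply: mem_tnth.
have plh i : pl i (polyF L h) = `|pl i (polyF L h)|%N%:Z.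
  by rewrite gez0_abs // place_polyF_ge0 ?polyF_eq0.
have hb i : exists b : 'I_(place_deg (pl i)) -> L,
    (forall j, pge (pl i) 0 (b j)) /\ indep iota b (pge (pl i) 1).
  by have [b [b1 b2 _]] := residue_fdim (pl i); exists b.
have inj : injective pl by apply/tuple_uniqP.
have le := fundamental_inequality q1 c0 sf mf yE ygen dimL inj h0 plh
  (fun i => (projT2 (cid (hb i))).1) (fun i => (projT2 (cid (hb i))).2).
rewrite big_tnth; move: le; rewrite -lez_nat; apply: le_trans.
rewrite (big_morph Posz PoszD (erefl _)); apply: ler_sum => i _.
by rewrite PoszM -plh.
Qed.

(** Each zero counts at least 1 in [zeros_degree], so lists of zeros are bounded in length, and one
    of maximal length is complete. *)
Lemma finite_zeros h : h != 0 -> exists2 s : seq (place L), uniq s &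
  forall P, (P \in s) = (0 <= P x) && (0 < P (polyF L h)).
Proof.
move=> h0; pose Z P := (0 <= P x) && (0 < P (polyF L h)).
pose Q m := `[< exists s : seq (place L), [/\ uniq s, all Z s & size s = m] >].
have Q0 : exists m, Q m by exists 0%N; apply/asboolP; exists [::].
have QB m : Q m -> (m <= q * (size h).-1)%N.
  move=> /asboolP[s [us /allP Zs <-]]; rewrite -lez_nat.
  apply: le_trans (zeros_degree h0 us _); last by move=> P /Zs /andP[].
  rewrite -sum1_size (big_morph Posz PoszD (erefl _)) big_seq [leRHS]big_seq; apply: ler_sum => P /Zs /andP[_ Ph].
  by have := place_deg_gt0 P; nia.
have [m /asboolP[s [us Zs sm]] maxm] := ex_maxnP Q0 QB.
exists s => // P; rewrite -/(Z P); apply/idP/idP; first exact: (allP Zs).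
move=> ZP; apply: contraT => Ps.
suff /maxm : Q m.+1 by rewrite ltnn.
by apply/asboolP; exists (P :: s); rewrite /= Ps us ZP Zs sm.
Qed.

End ResidueDegrees.

Lemma fdim_card (F : finFieldType) (L : comNzRingType) (iota : {rmorphism F -> L})
    (V W : L -> Prop) (I : finType) (b : I -> L) :
  (forall i, V (b i)) -> indep iota b W ->
  (forall z, V z -> exists a, W (z - lcomb iota b a)) -> fdim iota V W #|I|.
Proof.
move=> Vb ib sb; exists (b \o enum_val).
have E a : lcomb iota (b \o enum_val) a = lcomb iota b (a \o enum_rank).
  rewrite /lcomb [RHS](reindex _ (onW_bij _ (enum_val_bij I))) /=.
  by apply: eq_bigr => i _; rewrite enum_valK.
split=> [i|a|z /sb[a Wa]]; first exact: Vb.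
  by rewrite E => /ib ai i; rewrite -(enum_valK i); apply: ai.
exists (a \o enum_val); rewrite E.
suff -> : lcomb iota b ((a \o enum_val) \o enum_rank) = lcomb iota b a by [].
by apply: eq_bigr => i _; rewrite /= enum_rankK.
Qed.

Section RiemannRochAtInfinity.
Variables (F : finFieldType) (p e q c : nat) (f : {poly F}).
Hypotheses (pF : p \in [pchar F]) (qE : q = (p ^ e)%N).
Hypotheses (q1 : (1 < q)%N) (c0 : (0 < c)%N).
Local Notation D := (q * c).+1.
Hypotheses (sf : size f = D.+1) (mf : f \is monic).
Hypothesis card_Fq : #|[set b : F | b ^+ q == b]| = q.
Variables (L : fieldExtType {fraction {poly F}}) (y : L).
Hypotheses (yE : y ^+ q - y = polyF L f) (ygen : <<1; y>>%VS = fullv).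
Hypothesis (dimL : \dim {:L} = q).
Local Notation x := (xF L).
Local Notation iota := (constF L).
Local Notation zero := (fun z : L => z = 0).
Local Notation ev := (ev y).
Implicit Types (P : place L) (h : {poly F}) (B : {poly {poly F}}).

(** Selecting by the sign at x avoids carrying a chosen place; there is only one, by
    [pinf_unique]. *)
Definition at_infinity (n : int) P : int := if P x < 0 then n else 0.

Lemma rr_space_infinity (n : nat) z : rr_space (at_infinity n%:Z) z <->
  exists B, [/\ (size B <= q)%N, wle q c B n & z = ev B].
Proof.
have [pinf pinfE] := place_infinity_exists q1 c0 sf mf yE ygen dimL.
have px0 := pinf_x_lt0 q1 c0 sf mf dimL pinfE.
split=> [zV|[B [sB wB ->]] B0 P].
  have [P Px|B [sB E]] :=
      regular_at_finite_places pF qE q1 c0 sf mf card_Fq yE ygen dimL (z := z).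
    move=> z0; have := zV z0 P.
    by rewrite /at_infinity ltNge Px addr0.
  exists B; split=> //; have [->|B0] := eqVneq B 0.
    by move=> i j; rewrite !coef0 eqxx.
  have z0 : z != 0 by apply: contra_neq B0; rewrite E; apply: (ev_inj ygen dimL sB).
  apply: (wle_theta q1 sB).
  by have := zV z0 pinf; rewrite /at_infinity px0 E pinfE //; lia.
rewrite /at_infinity; case: ltP => Px; last first.
  by rewrite addr0; apply: (ev_integral q1 sf yE Px).
rewrite (pinf_unique q1 c0 sf mf yE ygen dimL pinfE Px) pinfE //; last first.
  by apply: contra_neq B0 => ->; rewrite ev0.
by have := size_theta_wle q1 wB; lia.
Qed.

(** The number of i with q i + D j <= q t, that is i + c j + j / q <= t: equality i = t - c j is
    possible only for j = 0. *)
Definition column (t j : nat) : nat := t - c * j + (j == 0).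

Lemma column_wle t i j : (j < q)%N -> (c * q <= t)%N ->
  (q * i + D * j <= q * t)%N = (i < column t j)%N.
Proof.
rewrite /column; case: j => [|j] jq ct.
  by rewrite !muln0 addn0 subn0 addn1 ltnS leq_pmul2l // ltnW.
rewrite addn0; have cj : (c * j.+1 <= t)%N.
  by apply: leq_trans ct; rewrite leq_mul2l ltnW ?orbT.
apply/idP/idP => h; last by move: (subnKC cj) h; nia.
rewrite ltnNge; apply/negP => ti; have : (q * t <= q * i + q * (c * j.+1))%N.
  by rewrite -mulnDr leq_mul2l; apply/orP; right; lia.
by move: h; rewrite mulSn -mulnA; lia.
Qed.

Lemma fdim_rr_infinity t : (c * q <= t)%N ->
  fdim iota (rr_space (at_infinity (q * t)%:Z)) zero (\sum_(j < q) column t j).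
Proof.
move=> ct; pose I := {j : 'I_q & 'I_(column t j)}.
pose b (s : I) : L := x ^+ tagged s * y ^+ tag s.
pose B (a : I -> F) : {poly {poly F}} :=
  \poly_(j < q) \poly_(i < column t j) (if (insub j : option 'I_q) is Some j' then
    if (insub i : option 'I_(column t j')) is Some i' then
    a (Tagged (fun j : 'I_q => 'I_(column t j)) i') else 0 else 0).
have -> : (\sum_(j < q) column t j)%N = #|{: I}|.
  rewrite card_tagged sumnE big_map big_enum.
  by apply: eq_bigr => j _; rewrite card_ord.
have sB a : (size (B a) <= q)%N by apply: size_poly.
have BE a (j : 'I_q) (i : 'I_(column t j)) :
    (B a)`_j`_i = a (Tagged (fun j : 'I_q => 'I_(column t j)) i).
  by rewrite coef_poly ltn_ord coef_poly ltn_ord !valK.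
have wB a : wle q c (B a) (q * t).
  move=> i j; have [jq|qj] := ltnP j q; last first.
    by rewrite (nth_default _ (leq_trans (sB a) qj)) coef0 eqxx.
  rewrite column_wle // coef_poly jq coef_poly.
  by case: ltnP => //; rewrite eqxx.
have lE (A : {poly {poly F}}) : (size A <= q)%N -> wle q c A (q * t) ->
    ev A = lcomb iota b (fun s : I => A`_(tag s)`_(tagged s)).
  move=> sA wA; rewrite (evE y sA) /lcomb.
  rewrite -(sig_big_dep xpredT (fun _ => xpredT)
    (fun (j : 'I_q) (i : 'I_(column t j)) => iota A`_j`_i * (x ^+ i * y ^+ j))) /=.
  apply: eq_bigr => j _; rewrite (@polyFE _ L (column t j)).
    by rewrite mulr_suml; apply: eq_bigr => i _; rewrite mulrA.
  apply/leq_sizeP => i ji; apply/eqP; apply: contraT => /wA.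
  by rewrite column_wle // ltnNge ji.
have lB a : lcomb iota b a = ev (B a).
  by rewrite lE //; apply: eq_bigr => -[j i] _; rewrite BE.
apply: (fdim_card (b := b)) => [s|a|z].
- apply/rr_space_infinity; exists (B (fun s' => (s' == s)%:R)); split=> //.
  rewrite -lB /lcomb (bigD1 s) //= eqxx rmorph1 mul1r big1 ?addr0 // => s' ss'.
  by rewrite (negbTE ss') rmorph0 mul0r.
- rewrite lB => /(ev_inj ygen dimL (sB a)) E [j i].
  by rewrite -BE E !coef0.
move=> /rr_space_infinity[A [sA wA ->]].
by exists (fun s : I => A`_(tag s)`_(tagged s)); rewrite lE // subrr.
Qed.

Lemma sum_columns t : (c * q <= t)%N ->
  (\sum_(j < q) column t j + c * 'C(q, 2) = q * t + 1)%N.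
Proof.
move=> ct; rewrite -bin2_sum big_mkord big_distrr -big_split /=.
rewrite (eq_bigr (fun j : 'I_q => (t + (j == 0 :> nat))%N)) => [|j _].
  rewrite big_split /= sum_nat_const card_ord; congr addn.
  case: q q1 => // q' _; rewrite big_ord_recl /= big1 //.
rewrite /column addnAC subnK //.
by apply: leq_trans ct; rewrite leq_mul2l ltnW ?orbT.
Qed.

End RiemannRochAtInfinity.

Section GenusBound.
Variables (F : finFieldType) (p e q c : nat) (f : {poly F}).
Hypotheses (pF : p \in [pchar F]) (qE : q = (p ^ e)%N).
Hypotheses (q1 : (1 < q)%N) (c0 : (0 < c)%N).
Hypotheses (sf : size f = (q * c).+2) (mf : f \is monic).
Hypothesis card_Fq : #|[set b : F | b ^+ q == b]| = q.
Variables (L : fieldExtType {fraction {poly F}}) (y : L).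
Hypotheses (yE : y ^+ q - y = polyF L f) (ygen : <<1; y>>%VS = fullv).
Hypothesis (dimL : \dim {:L} = q).
Local Notation x := (xF L).
Local Notation iota := (constF L).
Local Notation zero := (fun z : L => z = 0).
Implicit Types (P Q : place L) (h : {poly F}) (D : place L -> int).

Lemma infinity_exists : exists2 pinf : place L, pinf x < 0 &
  forall P, P x < 0 -> P = pinf.
Proof.
have [pinf pinfE] := place_infinity_exists q1 c0 sf mf yE ygen dimL.
exists pinf; first exact: (pinf_x_lt0 q1 c0 sf mf dimL pinfE).
by move=> P; apply: (pinf_unique q1 c0 sf mf yE ygen dimL pinfE).
Qed.

Lemma infinity_x P : P x < 0 -> P x = - q%:Z.
Proof.
have [pinf pinfE] := place_infinity_exists q1 c0 sf mf yE ygen dimL.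
move=> /(pinf_unique q1 c0 sf mf yE ygen dimL pinfE) ->.
exact: (pinf_x q1 c0 sf mf dimL pinfE).
Qed.

Definition twist h (n : nat) P : int :=
  P (polyF L h) + at_infinity (q * n)%:Z P.

Lemma rr_space_twist h n : h != 0 -> rr_space (twist h n) =
  fun z => rr_space (at_infinity (q * n)%:Z) (polyF L h * z).
Proof.
move=> h0; have H0 : polyF L h != 0 by rewrite polyF_eq0.
apply/funext => z; apply/propext; split=> [zV|zV z0 P].
  rewrite /rr_space mulf_eq0 negb_or => /andP[_ z0] P.
  by rewrite place_valM // [P _ + _]addrC -addrA; apply: zV.
have := zV (mulf_neq0 H0 z0) P.
by rewrite place_valM // [P _ + _]addrC -addrA.
Qed.

Lemma fdim_rr_twist h n : h != 0 -> (c * q <= n)%N ->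
  fdim iota (rr_space (twist h n)) zero (\sum_(j < q) column c n j).
Proof.
move=> h0 cn; rewrite (rr_space_twist n h0).
apply: fdim_scale; first by rewrite polyF_eq0.
exact: (fdim_rr_infinity pF qE q1 c0 sf mf card_Fq yE ygen dimL cn).
Qed.

Lemma dominating_polynomial D (s : seq (place L)) : exists2 h, h != 0 &
  forall P, P \in s -> 0 <= P x -> D P <= P (polyF L h).
Proof.
elim: s => [|Q s [h h0 hs]]; first by exists 1; rewrite ?oner_neq0.
have [Qx|Qx] := leP 0 (Q x); last first.
  exists h => // P; rewrite inE => /orP[/eqP ->|/hs //].
  by move=> Qx0; move: Qx; rewrite ltNge Qx0.
have [g g0 Qg] := finite_place_zero q1 c0 sf mf yE ygen Qx.
exists (h * g ^+ `|D Q|); first by rewrite mulf_neq0 ?expf_neq0.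
move=> P Ps Px; rewrite polyFM polyFXn place_valM ?expf_neq0 ?polyF_eq0 //.
rewrite placeXn ?polyF_eq0 //.
have hP : 0 <= P (polyF L h) by apply: place_polyF_ge0; rewrite ?polyF_eq0.
have gP : 0 <= P (polyF L g) by apply: place_polyF_ge0; rewrite ?polyF_eq0.
move: Ps; rewrite inE => /orP[/eqP E|/hs/(_ Px) le]; last first.
  by apply: le_trans le _; rewrite lerDl mulr_ge0.
by move: Qg hP; rewrite E; nia.
Qed.

(** At infinity h contributes - q deg h, which cancels the bound of [zeros_degree] on its zeros. *)
Lemma degree_twist_le h n (U : seq (place L)) : h != 0 -> uniq U ->
  (exists2 P, P \in U & P x < 0) ->
  \sum_(P <- U) twist h n P * (place_deg P)%:Z <= (q * n)%:Z.
Proof.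
move=> h0 uU [pinf Up px0]; rewrite (bigD1_seq pinf) //=.
have [pinf' _ uni] := infinity_exists.
have fin P : P != pinf -> 0 <= P x.
  rewrite leNgt; apply: contra => Px; apply/eqP.
  by rewrite (uni P Px) (uni pinf px0).
rewrite (place_deg_infinity q1 c0 sf mf yE ygen dimL px0) mulr1.
rewrite /twist {1}/at_infinity px0 place_polyF_pole // (infinity_x px0).
rewrite -big_filter.
have := zeros_degree q1 c0 sf mf yE ygen dimL (s := [seq P <- U | P != pinf]) h0.
rewrite filter_uniq // => /(_ isT) le.
have {le} : \sum_(P <- [seq P <- U | P != pinf]) P (polyF L h) * (place_deg P)%:Z
    <= (q * (size h).-1)%:Z.
  by apply: le => P; rewrite mem_filter => /andP[/fin].
rewrite !big_filter => le.
rewrite (eq_bigr (fun P => P (polyF L h) * (place_deg P)%:Z)) => [|P /fin Px].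
  move: le; rewrite !PoszM; set S := \sum_(P <- U | _) _ => le.
  by rewrite mulNr addrAC gerDr addrC subr_le0.
by rewrite /at_infinity ltNge Px addr0.
Qed.

Lemma sum_support (U s : seq (place L)) (E : place L -> int) : uniq U -> uniq s ->
  {subset s <= U} -> (forall P, P \notin s -> E P = 0) ->
  \sum_(P <- U) E P = \sum_(P <- s) E P.
Proof.
move=> uU us sU E0; rewrite (bigID (mem s)) /= [X in _ + X]big1 // addr0.
rewrite -big_filter; apply: perm_big; apply: uniq_perm; rewrite ?filter_uniq //.
by move=> P; rewrite mem_filter andb_idr // => /sU.
Qed.

(** With E = [twist h n] >= D one has l(E) <= l(D) + deg E - deg D, while l(E) = q n + 1 - g and deg
    E <= q n. *)
Lemma genus_bound D (s0 : seq (place L)) : uniq s0 ->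
  (forall P, P \notin s0 -> D P = 0) ->
  exists2 d, fdim iota (rr_space D) zero d &
  \sum_(P <- s0) D P * (place_deg P)%:Z - d%:Z + 1 <= (c * 'C(q, 2))%:Z.
Proof.
move=> us0 D0; have [h h0 hD] := dominating_polynomial D s0.
have [pinf px0 uni] := infinity_exists.
have [Z uZ ZE] := finite_zeros q1 c0 sf mf yE ygen dimL h0.
(* The first two summands make the twist dominate D at infinity, the third is the range of
   [fdim_rr_infinity]. *)
pose n := ((size h).-1 + `|D pinf| + c * q)%N.
pose U := undup (pinf :: s0 ++ Z).
have uU : uniq U by apply: undup_uniq.
have memU P : (P \in U) = [|| P == pinf, P \in s0 | P \in Z].
  by rewrite mem_undup inE mem_cat.
have tw P : twist h n P = if P x < 0 then - q%:Z * (size h).-1%:Z + (q * n)%:Z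
    else P (polyF L h).
  rewrite /twist /at_infinity; case: ltP => Px; last by rewrite addr0.
  by rewrite place_polyF_pole // (infinity_x Px).
have Dtw P : D P <= twist h n P.
  rewrite tw; case: ltP => Px; first by rewrite (uni P Px) /n; nia.
  have [/hD/(_ Px) //|/D0 ->] := boolP (P \in s0).
  by apply: place_polyF_ge0; rewrite ?polyF_eq0.
(* The difference of the twist and D, as a list of places with multiplicity. *)
pose s := flatten [seq nseq `|twist h n P - D P| P | P <- U].
have out P : P \notin U -> D P = 0 /\ twist h n P = 0.
  rewrite memU negb_or negb_or ZE => /and3P[Ppi Ps0 PZ]; split; first exact: D0.
  rewrite tw; case: ltP => Px; first by rewrite (uni P Px) eqxx in Ppi.
  move: PZ; rewrite Px /= -leNgt => Ph; apply: le_anti.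
  by rewrite Ph place_polyF_ge0 ?polyF_eq0.
have cs Q : D Q + (count_mem Q s)%:Z = twist h n Q.
  have -> : count_mem Q s = (\sum_(P <- U) (P == Q) * `|twist h n P - D P|)%N.
    rewrite /s count_flatten sumnE !big_map; apply: eq_bigr => P _.
    by rewrite count_nseq.
  have [QU|QU] := boolP (Q \in U); last first.
    rewrite big1_seq; first by have [-> ->] := out Q QU.
    by move=> P /= PU; case: eqP => // E; rewrite -E PU in QU.
  rewrite (bigD1_seq Q) //= eqxx mul1n big1 ?addn0 => [|P PQ]; last first.
    by rewrite (negbTE PQ).
  by have := Dtw Q; lia.
have ss : (\sum_(P <- s) place_deg P =
    \sum_(P <- U) `|twist h n P - D P| * place_deg P)%N.
  rewrite /s big_flatten /= big_map; apply: eq_bigr => P _.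
  by rewrite big_nseq iter_addn_0 mulnC.
have cn : (c * q <= n)%N by rewrite leq_addl.
have := fdim_rr_twist h0 cn.
have -> : twist h n = fun Q => D Q + (count_mem Q s)%:Z.
  by apply/funext => Q; rewrite cs.
move=> /(rr_space_add_places (residue_fdim q1 c0 sf mf yE ygen dimL))[d fd le].
exists d => //.
have E : \sum_(P <- s0) D P * (place_deg P)%:Z =
    \sum_(P <- U) D P * (place_deg P)%:Z.
  rewrite (sum_support uU us0) // => [P Ps|P /D0 ->]; last by rewrite mul0r.
  by rewrite memU Ps orbT.
have := degree_twist_le n h0 uU; have -> : \sum_(P <- U) twist h n P * (place_deg P)%:Z
    = \sum_(P <- s0) D P * (place_deg P)%:Z + (\sum_(P <- s) place_deg P)%N%:Z.
  rewrite E ss (big_morph Posz PoszD (erefl _)) -big_split /=.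
  apply: eq_bigr => P _; rewrite PoszM -mulrDl; congr (_ * _).
  by have := Dtw P; lia.
move=> degU; have {}degU := degU (ex_intro2 _ _ pinf _ px0).
have := sum_columns q1 cn; move: le.
move: (\sum_(j < q) _)%N (\sum_(P <- s) _)%N degU => a b degU.
by have := degU; rewrite memU eqxx => /(_ isT); lia.
Qed.

(** The dimension formula at t = c q; n > 0 ensures that the divisor n P has P in its support. *)
Lemma genus_attained P : P x < 0 -> exists n d : nat,
  fdim iota (rr_space (fun Q => if Q == P then n%:Z else 0)) zero d /\
  (n + 1 = d + c * 'C(q, 2))%N /\ (0 < n)%N.
Proof.
move=> Px; exists (q * (c * q))%N, (\sum_(j < q) column c (c * q) j)%N; split.
  have -> : (fun Q => if Q == P then (q * (c * q))%:Z else 0) =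
      at_infinity (q * (c * q))%:Z.
    apply/funext => Q; rewrite /at_infinity.
    have [->|QP] := eqVneq Q P; first by rewrite Px.
    case: ltP => // Qx; case/eqP: QP; have [pinf _ uni] := infinity_exists.
    by rewrite (uni P Px) (uni Q Qx).
  exact: (fdim_rr_infinity pF qE q1 c0 sf mf card_Fq yE ygen dimL (leqnn _)).
split; first by rewrite (sum_columns q1 (leqnn _)).
by rewrite !muln_gt0 c0 ltnW.
Qed.

End GenusBound.

From mathcomp Require Import freeg.

(** * Genus of the curve and minimality *)

Section Genus.
Variables (F : finFieldType) (p e q c : nat) (f : {poly F}).
Hypotheses (pF : p \in [pchar F]) (qE : q = (p ^ e)%N).
Hypotheses (q1 : (1 < q)%N) (c0 : (0 < c)%N).
Hypotheses (sf : size f = (q * c).+2) (mf : f \is monic).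
Hypothesis card_Fq : #|[set b : F | b ^+ q == b]| = q.

Lemma genus_artin_schreier (L : fieldExtType {fraction {poly F}}) (y : L) :
  y ^+ q - y = polyF L f -> <<1; y>>%VS = fullv -> \dim {:L} = q ->
  is_genus L (c * 'C(q, 2)).
Proof.
move=> yE ygen dimL.
have dimE (D : divisor L) d :
    fdim (constF L) (rr_space (fun P => coeff P D)) (fun z => z = 0) d -> div_dim D = d.
  move=> fd; apply: quot_dimE fd; last exact: subsp0.
  by case: (subsp_rr_space (fun P => coeff P D)).
split=> [D|].
  have [|d fd] := genus_bound pF qE q1 c0 sf mf card_Fq yE ygen dimL
    (D := fun P => coeff P D) (uniq_dom D).
    by move=> P /coeff_outdom.
  by rewrite (dimE D d fd).
have [P Px _] := infinity_exists q1 c0 sf mf yE ygen dimL.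
have [n [d [fd [nd n0]]]] :=
  genus_attained pF qE q1 c0 sf mf card_Fq yE ygen dimL Px.
exists << n%:Z *g P >>.
rewrite (dimE _ d); last first.
  have -> : (fun Q => coeff Q << n%:Z *g P >>) =
      fun Q => if Q == P then n%:Z else 0; last exact: fd.
  apply/funext => Q; rewrite coeffU eq_sym.
  by case: eqP; rewrite ?mulr1 ?mulr0.
rewrite /div_deg domU; last by rewrite eqz_nat -lt0n.
rewrite big_seq1 coeffU eqxx mulr1.
rewrite (place_deg_infinity q1 c0 sf mf yE ygen dimL Px).
by move: nd; lia.
Qed.

Lemma artin_schreier_function_field :
  exists (L : fieldExtType {fraction {poly F}}) (y : L), is_function_field q f y.
Proof.
have [L dimL [y yr ygen]] := irredp_FAdjoin (as_poly_irreducible q1 c0 sf mf).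
have yE : y ^+ q - y = polyF L f.
  have : ev y (as_poly q f) = 0.
    by rewrite -(rootP yr); congr (_.[y]); rewrite -map_poly_comp; apply: eq_map_poly.
  rewrite /as_poly !evB evXn ev_polyX ev_polyC => /eqP.
  by rewrite subr_eq0 => /eqP.
have {}dimL : \dim {:L} = q.
  rewrite dimL (size_map_inj_poly _ (rmorph0 _)) ?(as_poly_monic f q1).2 //.
  by move=> u v /eqP; rewrite tofrac_eq => /eqP.
exists L, y; split=> // z h h0 hz.
have [pinf pinfE] := place_infinity_exists q1 c0 sf mf yE ygen dimL.
exact: (constant_field q1 c0 sf mf yE ygen pinfE h0 hz).
Qed.

Lemma curve_genus : curve_has_genus q f (c * 'C(q, 2)).
Proof.
have [L [y hL]] := artin_schreier_function_field.
by exists L, y; split=> //; case: hL => yE ygen dimL _; apply: genus_artin_schreier yE ygen dimL.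
Qed.

End Genus.

Theorem theorem6 (p e q : nat) (hp : prime p) (hpodd : odd p) (he : (0 < e)%N)
  (hq : q = (p ^ e)%N)
  (k d n a : nat) (hk : (0 < k)%N) (hkeven : ~~ odd k)
  (hd : (2 < d)%N) (hdk : (d %| k)%N) (hpd : ~~ (p %| d)%N)
  (hn : (0 < n)%N) (hkn : (2 * k %| n)%N)
  (ha : (totient d + 2 * a)%N = k)
  (F : finFieldType) (hF : #|F| = (q ^ n)%N)
  (Phi : {poly F}) (hPhi : is_cyclotomic d Phi) :
  minimal_curve q (curve_rhs q k n a Phi).
Proof.
pose m := (n %/ (2 * k))%N.
have nE : n = (k * (2 * m))%N by rewrite -[LHS](divnK hkn) -/m; lia.
have m0 : (0 < m)%N by move: hn; rewrite nE !muln_gt0 => /and3P[].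
have q1 : (1 < q)%N by rewrite hq -(exp1n e) ltn_exp2r // prime_gt1.
have pF : p \in [pchar F].
  by apply: (card_finPcharP (n := (e * n)%N)) => //; rewrite hF hq expnM.
have [count sPhi mPhi a0] := curve_point_count hp hpodd he hq hk hd hdk hpd hn hkn ha hF hPhi.
set f := curve_rhs q k n a Phi in count *.
have [sf mf] := size_curve_rhs q1 a sPhi mPhi hk nE m0.
pose r := (totient d + a + k * m.-1)%N.
have r0 : (0 < r)%N by rewrite !addn_gt0 a0 orbT.
have qc : (q ^ r = q * q ^ r.-1)%N by rewrite -expnS prednK.
have [s sE] := frobenius_power pF e.
have card_Fq : #|[set b : F | b ^+ q == b]| = q.
  rewrite -[RHS](card_fixed_points (s := s) q1 hn _ hF) => [|b]; last by rewrite sE hq.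
  by apply: eq_card => b; rewrite !inE sE hq.
exists (q ^ r.-1 * 'C(q, 2))%N; split.
  apply: (curve_genus pF hq q1 _ _ mf card_Fq); first by rewrite expn_gt0 ltnW.
  by rewrite sf -/r qc.
(* The square root of q^n is q^(km), and n - a = r + km because phi(d) + 2a = k. So 2 g sqrt(q^n) is
   exactly the deficit in [count]. *)
have E : (2 * (q ^ r.-1 * 'C(q, 2)) * q ^ (k * m) = (q - 1) * q ^ (n - a))%N.
  have -> : (n - a = r + k * m)%N.
    rewrite nE /r -{1 3}(prednK m0) mulnCA mulnS.
    by move: (k * m.-1)%N ha; clear; lia.
  have := bin_ffact q 2; rewrite ffactnS ffactn1 => b2.
  rewrite expnD qc mulnCA (_ : 2 * 'C(q, 2) = q * q.-1)%N; last by rewrite -b2 mulnC.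
  by rewrite subn1; move: (q ^ r.-1)%N (q ^ _)%N q.-1; clear; lia.
rewrite /num_rational_points hF.
have -> : sqrtC (q ^ n)%:R = (q ^ (k * m))%:R :> algC.
  by rewrite nE mulnCA mulnC expnM natrX sqrCK ?ler0n.
by rewrite -!natrM E -count natrD addrAC addrK -addn1 natrD.
Qed.
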